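(* Let $\beta>1$, and for even $N\in\mathbb{N}$ let $M_N$ be the magnetization process of the dynamic mean-field Ising (Curie--Weiss) model with $N$ spins at inverse temperature $\beta$, started at $M_N(0)=0$. For $R\in(0,m_* )$ let $\tau_N(R)=\inf\{t\ge 0: |M_N(t)|\ge R\}$. Then for any $R\in(0,m_* )$, as $N\to\infty$ (along even $N$), the following joint convergence in distribution of $\mathbb{R}^2$-valued random vectors holds: \[ \left(\operatorname{sgn} M_N(\tau_N(R)),\ \tau_N(R)-\frac{1}{2a}\ln N\right)\ \longrightarrow\ \left(\operatorname{sgn} G,\ -\frac{1}{a}\ln|G|+D(R)\right), \] where $G$ is a standard Gaussian random variable, $a=2\beta-2$, and \[ D(R)=K(R)+\frac{\ln R}{a}+\frac{\ln(a/2)}{2a},\qquad K(R)=-\int_0^R\frac{Q(x)}{a\,x\,b(x)}\,dx . \]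
   Context: Model: fix $\beta>1$. Let $X=(X_i)_{i=1}^N$ be the continuous-time Markov process on $\{-1,+1\}^N$ in which spin $i$ flips, in configuration $x$, at rate $c_i(x)=\exp\{-\beta x_i M(x)\}$, where $M(x)=\frac1N\sum_{i=1}^N x_i$. The magnetization process $M_N(t)=M(X(t))$ is then a continuous-time Markov jump process on $\{-1,-1+2/N,\dots,1-2/N,1\}$ with the transition $m\mapsto m+2/N$ at rate $\lambda_+(m,N)=N\frac{1-m}{2}e^{\beta m}$ and the transition $m\mapsto m-2/N$ at rate $\lambda_-(m,N)=N\frac{1+m}{2}e^{-\beta m}$. Paths are cadlag, $N$ is even, and $M_N(0)=0$. Notation: $b(m)=\frac{2}{N}(\lambda_+(m,N)-\lambda_-(m,N))=(1-m)e^{\beta m}-(1+m)e^{-\beta m}$; $a=b'(0)=2\beta-2>0$; $Q(x)=b(x)-ax$. The number $m_*\in(0,1)$ is the unique positive solution of $\beta m=\frac12\ln\frac{1+m}{1-m}$ (equivalently, the unique zero of $b$ in $(0,1)$; one has $b>0$ on $(0,m_* )$). *)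

(* Defs.v *)
From HB Require Import structures.
From mathcomp Require Import all_boot all_order all_algebra.
From mathcomp Require Import all_classical all_reals all_analysis.

Set Implicit Arguments.
Unset Strict Implicit.
Unset Printing Implicit Defensive.

Import Order.TTheory GRing.Theory Num.Theory.
Import numFieldNormedType.Exports.

Local Open Scope classical_set_scope.
Local Open Scope ring_scope.

Section MarkovJumpProcess.
Variables (R : realType) (S : finType).

(* Only the off-diagonal values of the rate function q are relevant. *)
Record transition_function (q : S -> S -> R) (P : R -> S -> S -> R) : Prop := {
  tf_ge0 : forall t x y, 0 <= t -> 0 <= P t x y ;
  tf_sum1 : forall t x, 0 <= t -> \sum_(y : S) P t x y = 1 ;
  tf_id : forall x y, P 0 x y = (x == y)%:R ;
  tf_chapman_kolmogorov : forall s t x z, 0 <= s -> 0 <= t ->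
    P (s + t) x z = \sum_(y : S) P s x y * P t y z ;
  tf_rate : forall x y, x != y -> P h x y / h @[h --> 0^'+] --> q x y }.

(* Times range over [0, +oo[; the values of X at negative times are junk.
   The Markov property is the conditional-probability formula multiplied by
   the probability of the conditioning event; S carries the discrete topology
   in the two path conditions. *)
Record markov_jump_process (q : S -> S -> R) (d : measure_display)
    (T : measurableType d) (Pr : probability T R) (X : R -> T -> S) : Prop := {
  mjp_measurable : forall t x, 0 <= t -> measurable [set w | X t w = x] ;
  mjp_markov : exists2 P : R -> S -> S -> R, transition_function q P &
    forall (n : nat) (t : nat -> R) (x : nat -> S),
      0 <= t 0%N -> (forall i, t i <= t i.+1) ->
      Pr [set w | forall i, (i <= n.+1)%N -> X (t i) w = x i] =
      (Pr [set w | forall i, (i <= n)%N -> X (t i) w = x i]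
       * (P (t n.+1 - t n) (x n) (x n.+1))%:E)%E ;
  mjp_right_continuous : forall w t, 0 <= t ->
    \forall s \near t^'+, X s w = X t w ;
  mjp_left_limits : forall w t, 0 < t ->
    exists x, \forall s \near t^'-, X s w = x }.

End MarkovJumpProcess.

Section CurieWeiss.
Variable R : realType.

(* {-1,+1}^N, with true standing for +1 and false for -1. *)
Definition config (N : nat) := {ffun 'I_N -> bool}.

Definition spin (b : bool) : R := if b then 1 else -1.

Definition magnetization (N : nat) (x : config N) : R :=
  N%:R^-1 * \sum_(i < N) spin (x i).

Definition flip (N : nat) (i : 'I_N) (x : config N) : config N :=
  [ffun j => if j == i then ~~ x j else x j].

Definition flip_rate (beta : R) (N : nat) (i : 'I_N) (x : config N) : R :=
  expR (- beta * spin (x i) * magnetization x).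

Definition cw_rate (beta : R) (N : nat) (x y : config N) : R :=
  \sum_(i < N | y == flip i x) flip_rate beta i x.

Definition curie_weiss_process (beta : R) (N : nat) (d : measure_display)
    (T : measurableType d) (Pr : probability T R) (X : R -> T -> config N) :=
  markov_jump_process (@cw_rate beta N) Pr X.

Definition magnetization_process (N : nat) (T : Type) (X : R -> T -> config N)
    (t : R) (w : T) : R := magnetization (X t w).

(* inf set0 = 0: a path that never leaves ]-r, r[ (an event of probability 0
   for the process considered here) gets the value 0 instead of +oo, so that
   the exit time is real-valued. *)
Definition exit_time (T : Type) (M : R -> T -> R) (r : R) (w : T) : R :=
  inf [set t : R | 0 <= t /\ r <= `|M t w|].

Definition drift (beta m : R) : R :=
  (1 - m) * expR (beta * m) - (1 + m) * expR (- beta * m).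

Definition growth (beta : R) : R := 2 * beta - 2.

Definition remainder (beta x : R) : R := drift beta x - growth beta * x.

Definition is_mstar (beta m : R) : Prop :=
  0 < m < 1 /\ beta * m = 2^-1 * ln ((1 + m) / (1 - m)).

Definition Kconst (beta r : R) : R :=
  - \int[lebesgue_measure]_(x in `[0, r])
      (remainder beta x / (growth beta * x * drift beta x)).

Definition Dconst (beta r : R) : R :=
  Kconst beta r + ln r / growth beta
  + ln (growth beta / 2) / (2 * growth beta).

End CurieWeiss.

Definition standard_gaussian (R : realType) (d : measure_display)
    (T : measurableType d) (P : probability T R) (G : {RV P >-> R}) : Prop :=
  forall A : set R, measurable A -> distribution P G A = normal_prob 0 1 A.

Record cvg_in_distribution (R : realType)
    (d : nat -> measure_display) (T : forall k, measurableType (d k))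
    (P : forall k, probability (T k) R) (V : forall k, T k -> R * R)
    (d' : measure_display) (T' : measurableType d')
    (P' : probability T' R) (V' : T' -> R * R) : Prop := {
  cid_measurable : forall k, measurable_fun setT (V k) ;
  cid_measurable_lim : measurable_fun setT V' ;
  cid_cvg : forall f : R * R -> R, continuous f ->
    (exists C, forall z, `|f z| <= C) ->
    'E_(P k)[fun w => f (V k w)]%E @[k --> \oo]
      --> 'E_P'[fun w => f (V' w)]%E }.

(* Main.v *)
Require Import Defs.
From HB Require Import structures.
From mathcomp Require Import all_boot all_order all_algebra.
From mathcomp Require Import all_classical all_reals all_analysis.
From mathcomp Require Import measurable_realfun ring lra.

(* The coordinate psi with psi' * drift = a * psi linearizes the drift, so
   Z(t) = exp (- a t) * sqrt (a N / 2) * psi (M(t)) is nearly a martingale up to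
   the exit time tau; its jumps are O(exp (- a t) / sqrt N) and its quadratic
   variation accumulates at rate 2 a exp (- 2 a t). Hence Z(tau) is nearly standard
   Gaussian, and (sgn M(tau), tau) is read off Z(tau), because |M(tau)| differs
   from r by at most 2 / N. Quantitatively, Z is compared with the heat flow
   F(t, z) = ncdf ((c - z) / sqrt (v + exp (- 2 a t))) of a smoothed step: with
   H = (1 + Z ^ 2) exp (B exp (- a t)), both F + (C / sqrt N) H and
   - F + (C / sqrt N) H are space-time supersolutions of the generator inside
   {|M| < r}, hence supermartingales when stopped at tau. Stopping is handled on
   the grids h k / n, on which the Markov property is a finite-dimensional
   statement, and n tends to infinity by right-continuity of the paths. *)

Set Implicit Arguments.
Unset Strict Implicit.
Unset Printing Implicit Defensive.

Import Order.TTheory GRing.Theory Num.Theory.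
Import numFieldNormedType.Exports.

Local Open Scope classical_set_scope.
Local Open Scope ring_scope.

(** * Expectation of bounded random variables *)

(** The generator errors are of order [exp (- a t) (1 + Z ^ 2) / sqrt N], and [exp (- a t)] is
    integrable over all times: this is why the factor [exp (B exp (- a t))] can absorb them while
    staying below [exp B], and why no estimate degrades as the time horizon grows. The horizon can
    therefore be [ln N / a], where [exp (- a t) = 1 / N]. A path that has not left by then has both
    [Z] and the coordinate that encodes its exit of size [O(1 / sqrt N)], so neither a tail bound
    for tau nor its almost sure finiteness has to be proved. The step is smoothed with a variance
    [v > 0] because the variance [exp (- 2 a t)] still to come vanishes with time, and without [v]
    the derivatives of the heat flow would blow up; [v] is made small only after the limit in [N] is
    known for each fixed [v]. The sign and the time are continuous functions of the limiting
    coordinate except at 0, which the Gaussian does not charge. *)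

Section BoundedExpectation.
Context (R : realType) (d : measure_display) (T : measurableType d).
Variable P : probability T R.
Implicit Types f g : T -> R.

Definition bounded_rv f :=
  measurable_fun setT f /\ exists C, forall w, `|f w| <= C.

Definition expect f : R := \int[P]_w f w.

Lemma bounded_rv_integrable f : bounded_rv f -> P.-integrable setT (EFin \o f).
Proof.
move=> [mf [C fC]]; apply: (@le_integrable _ _ _ _ setT _ _ (cst C%:E)) => //.
- exact/measurable_EFinP.
- move=> w _ /=; rewrite lee_fin.
  by rewrite (le_trans (fC w))// ler_norm.
- exact: finite_measure_integrable_cst.
Qed.

Lemma bounded_rv_cst c : bounded_rv (fun=> c).
Proof. by split=> //; exists `|c|. Qed.

Lemma bounded_rvD f g : bounded_rv f -> bounded_rv g ->
  bounded_rv (fun w => f w + g w).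
Proof.
move=> [mf [C fC]] [mg [C' gC]]; split; first exact: measurable_funD.
by exists (C + C') => w; rewrite (le_trans (ler_normD _ _))// lerD.
Qed.

Lemma bounded_rvM f g : bounded_rv f -> bounded_rv g ->
  bounded_rv (fun w => f w * g w).
Proof.
move=> [mf [C fC]] [mg [C' gC]]; split; first exact: measurable_funM.
by exists (C * C') => w; rewrite normrM ler_pM.
Qed.

Lemma bounded_rvZ c f : bounded_rv f -> bounded_rv (fun w => c * f w).
Proof. by move=> bf; apply: bounded_rvM => //; exact: bounded_rv_cst. Qed.

Lemma bounded_rvB f g : bounded_rv f -> bounded_rv g ->
  bounded_rv (fun w => f w - g w).
Proof.
move=> bf bg; have := bounded_rvD bf (bounded_rvZ (-1) bg).
by under eq_fun do rewrite mulN1r.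
Qed.

Lemma bounded_rv_indic A : measurable A -> bounded_rv \1_A.
Proof.
move=> mA; split; first exact: measurable_indic.
by exists 1 => w; rewrite indicE; case: (_ \in _); rewrite ?normr1 ?normr0.
Qed.

Lemma bounded_rv_sum (I : Type) (s : seq I) (p : pred I) (F : I -> T -> R) :
  (forall i, p i -> bounded_rv (F i)) ->
  bounded_rv (fun w => \sum_(i <- s | p i) F i w).
Proof.
move=> bF; elim: s => [|i s IHs].
  by under eq_fun do rewrite big_nil; exact: bounded_rv_cst.
under eq_fun do rewrite big_cons; case: (boolP (p i)) => [pi|//].
by apply: bounded_rvD => //; exact: bF.
Qed.

Lemma expect_cst c : expect (fun=> c) = c.
Proof. by rewrite /expect Rintegral_cst//= probability_setT mulr1. Qed.

Lemma expectD f g : bounded_rv f -> bounded_rv g ->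
  expect (fun w => f w + g w) = expect f + expect g.
Proof. by move=> bf bg; rewrite /expect RintegralD//; exact: bounded_rv_integrable. Qed.

Lemma expectB f g : bounded_rv f -> bounded_rv g ->
  expect (fun w => f w - g w) = expect f - expect g.
Proof. by move=> bf bg; rewrite /expect RintegralB//; exact: bounded_rv_integrable. Qed.

Lemma expectZ c f : bounded_rv f -> expect (fun w => c * f w) = c * expect f.
Proof. by move=> bf; rewrite /expect RintegralZl//; exact: bounded_rv_integrable. Qed.

Lemma expect_indic A : measurable A -> expect \1_A = fine (P A).
Proof. by move=> mA; rewrite /expect /Rintegral integral_indic// setIT. Qed.

Lemma expect_sum (I : Type) (s : seq I) (p : pred I) (F : I -> T -> R) :
  (forall i, p i -> bounded_rv (F i)) ->
  expect (fun w => \sum_(i <- s | p i) F i w) = \sum_(i <- s | p i) expect (F i).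
Proof.
move=> bF; elim: s => [|i s IHs].
  by under eq_fun do rewrite big_nil; rewrite expect_cst big_nil.
under eq_fun do rewrite big_cons; rewrite big_cons; case: (boolP (p i)) => [pi|//].
by rewrite expectD ?IHs//; [exact: bF|exact: bounded_rv_sum].
Qed.

Lemma le_expect f g : bounded_rv f -> bounded_rv g -> (forall w, f w <= g w) ->
  expect f <= expect g.
Proof.
by move=> bf bg fg; apply: le_Rintegral => //; exact: bounded_rv_integrable.
Qed.

Lemma le_expect_as (A : set T) f g : measurable A -> P A = 1%E ->
  bounded_rv f -> bounded_rv g -> (forall w, A w -> f w <= g w) ->
  expect f <= expect g.
Proof.
move=> mA PA bf bg fg; have [mf [C fC]] := bf; have [mg [C' gC]] := bg.
have mAC : measurable (~` A) by exact: measurableC.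
(* Off [A] the difference is at most the sum of the two bounds, and this correction has expectation
   0. *)
have bC : bounded_rv (fun w => (C + C') * \1_(~` A) w).
  by apply: bounded_rvZ; exact: bounded_rv_indic.
have : expect f <= expect (fun w => g w + (C + C') * \1_(~` A) w).
  apply: le_expect => //; first exact: bounded_rvD.
  move=> w; rewrite indicE; case: (boolP (w \in ~` A)) => [_|]; last first.
    by rewrite notin_setE/= => /contrapT Aw; rewrite mulr0 addr0; exact: fg.
  have := fC w; have := gC w; rewrite !ler_norml => /andP[? ?] /andP[? ?].
  by rewrite mulr1; lra.
rewrite expectD// expectZ ?expect_indic//; last exact: bounded_rv_indic.
by rewrite probability_setC// PA subee// mulr0 addr0.
Qed.

Lemma expect_cvg (F : nat -> T -> R) f C :
  (forall n, measurable_fun setT (F n)) -> (forall n w, `|F n w| <= C) ->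
  (forall w, F n w @[n --> \oo] --> f w) ->
  bounded_rv f /\ expect (F n) @[n --> \oo] --> expect f.
Proof.
move=> mF FC Ff; have mf : measurable_fun setT f.
  by apply: (measurable_fun_cvg (h := F)) => // w _; exact: Ff.
have bf : bounded_rv f.
  split=> //; exists C => w; have := Ff w => /cvg_norm cf.
  by apply: (cvgr_to_le cf); apply: nearW => n; exact: FC.
split=> //.
have [|||||_ _] := @dominated_convergence _ _ _ P setT measurableT
  (fun n => EFin \o F n) (EFin \o f) (cst C%:E).
- by move=> n; exact/measurable_EFinP.
- exact/measurable_EFinP.
- by apply: aeW => w _ /=; apply: cvg_EFin; [exact: nearW|exact: Ff].
- exact: finite_measure_integrable_cst.
- by apply: aeW => w n _ /=; rewrite lee_fin.
have fin : (\int[P]_w (EFin \o f) w)%E \is a fin_num.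
  exact: integrable_fin_num (bounded_rv_integrable bf).
by rewrite -[X in _ --> X -> _](fineK fin) => /fine_cvg.
Qed.

End BoundedExpectation.

(** * Calculus on the real line *)

Section DerivePointwise.
Context {R : realType}.
Implicit Types (f g : R -> R) (x a b c : R).

(** The rules below concern pointwise formulas, so the derivative of an explicit expression is
    assembled as a term; [is_deriveE] leaves the identification of its value as an algebraic
    identity. *)
Lemma is_deriveE f x a b : is_derive x 1 f a -> a = b -> is_derive x 1 f b.
Proof. by move=> ? <-. Qed.

Lemma is_derive_cstf c x : is_derive x 1 (fun=> c) 0.
Proof. exact: is_derive_cst. Qed.

Lemma is_derive_idf x : is_derive x 1 (fun y : R => y) 1.
Proof. exact: is_derive_id. Qed.

Lemma is_deriveDf f g x a b : is_derive x 1 f a -> is_derive x 1 g b ->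
  is_derive x 1 (fun y => f y + g y) (a + b).
Proof. by move=> ? ?; exact: (@is_deriveD _ _ _ f g). Qed.

Lemma is_deriveNf f x a : is_derive x 1 f a -> is_derive x 1 (fun y => - f y) (- a).
Proof. by move=> ?; exact: (@is_deriveN _ _ _ f). Qed.

Lemma is_deriveBf f g x a b : is_derive x 1 f a -> is_derive x 1 g b ->
  is_derive x 1 (fun y => f y - g y) (a - b).
Proof. by move=> ? ?; exact: (@is_deriveB _ _ _ f g). Qed.

Lemma is_deriveMf f g x a b : is_derive x 1 f a -> is_derive x 1 g b ->
  is_derive x 1 (fun y => f y * g y) (a * g x + f x * b).
Proof.
move=> df dg; have /is_deriveE := is_deriveM df dg; apply.
by rewrite /GRing.scale/=; ring.
Qed.

Lemma is_deriveZf f x c a : is_derive x 1 f a ->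
  is_derive x 1 (fun y => c * f y) (c * a).
Proof.
move=> df; apply: (is_deriveE (is_deriveMf (is_derive_cstf c x) df)); ring.
Qed.

Lemma is_derive_compf f g x a b : is_derive (g x) 1 f a -> is_derive x 1 g b ->
  is_derive x 1 (fun y => f (g y)) (a * b).
Proof.
move=> df dg; have /is_deriveE := is_derive1_comp df dg; apply.
by rewrite /GRing.scale/=; ring.
Qed.

Lemma is_deriveVf g x b : g x != 0 -> is_derive x 1 g b ->
  is_derive x 1 (fun y => (g y)^-1) (- b / g x ^+ 2).
Proof.
move=> gx0 dg; have /is_deriveE := is_deriveV gx0 dg; apply.
by rewrite /GRing.scale/=; field.
Qed.

Lemma is_derive_expf g x b : is_derive x 1 g b ->
  is_derive x 1 (fun y => expR (g y)) (b * expR (g x)).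
Proof.
move=> dg; apply: (is_deriveE (is_derive_compf (is_derive_expR (g x)) dg)).
by rewrite mulrC.
Qed.

Lemma is_derive_sqrf g x b : is_derive x 1 g b ->
  is_derive x 1 (fun y => g y ^+ 2) (2 * g x * b).
Proof.
by move=> dg; apply: (is_deriveE (is_deriveMf dg dg)); ring.
Qed.

Lemma is_derive_continuous f x a : is_derive x 1 f a -> {for x, continuous f}.
Proof.
move=> df; apply: differentiable_continuous; apply/derivable1_diffP.
exact: ex_derive.
Qed.

End DerivePointwise.

Section Calculus.
Context {R : realType}.
Implicit Types f df : R -> R.

Lemma continuous_segment_bounded f (a b : R) : continuous f ->
  exists2 C, 0 <= C & forall t, a <= t <= b -> `|f t| <= C.
Proof.
move=> cf; have [ab|ba] := leP a b; last first.
  exists 0 => // t /andP[at_ tb]; have := le_trans at_ tb.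
  by rewrite leNgt ba.
have cfab : {within `[a, b], continuous (fun t => `|f t|)}.
  apply: continuous_subspaceT => t.
  by apply: (continuous_comp (cf t)); exact: norm_continuous.
have [c _ cP] := EVT_max ab cfab.
by exists `|f c| => // t tab; apply: cP; rewrite in_itv.
Qed.

(** Estimates near each point [(t, 0)] become uniform in [t] through the near-covering form of
    compactness. The point [t + h] may leave the segment. *)
Lemma continuous_segment_uniform f (a b e : R) : continuous f -> 0 < e ->
  exists2 h0, 0 < h0 & forall h t, 0 <= h < h0 -> a <= t <= b ->
    `|f (t + h) - f t| <= e.
Proof.
move=> cf e0; have /compact_near_coveringP := @segment_compact R a b.
move=> /(_ _ (nbhs (0 : R)) (fun h t => `|f (t + h) - f t| <= e) _)[|].
  move=> t _.
  have /cvgrPdist_le/(_ (e / 2)) := cf t; rewrite divr_gt0// => /(_ isT) nt.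
  have c2 : (p.1 + p.2) @[p --> (t, 0 : R)] --> t.
    rewrite -[X in _ --> X]addr0; apply: cvgD; first exact: cvg_fst.
    exact: cvg_snd.
  have c1 : p.1 @[p --> (t, 0 : R)] --> t by exact: cvg_fst.
  have n1 : \forall p \near (t, 0 : R), `|f t - f p.1| <= e / 2 := c1 _ nt.
  have n2 : \forall p \near (t, 0 : R), `|f t - f (p.1 + p.2)| <= e / 2 :=
    c2 _ nt.
  suff : \forall p \near (t, 0 : R), `|f (p.1 + p.2) - f p.1| <= e by [].
  near=> p.
  have h1 : `|f t - f p.1| <= e / 2 by near: p.
  have h2 : `|f t - f (p.1 + p.2)| <= e / 2 by near: p.
  rewrite -(subrKA (f t)) (le_trans (ler_normD _ _))//.
  by rewrite [e]splitr lerD// distrC.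
move=> h0 /= h0_gt0 H; exists h0 => // h t /andP[h_ge0 hh0] tab.
by apply: H => //=; rewrite sub0r normrN ger0_norm.
Unshelve. all: by end_near. Qed.

Lemma mean_value_bound f df (a b K : R) :
  (forall u, Num.min a b <= u <= Num.max a b -> is_derive u 1 f (df u)) ->
  (forall u, Num.min a b <= u <= Num.max a b -> `|df u| <= K) ->
  `|f b - f a| <= K * `|b - a|.
Proof.
wlog ab : a b / a <= b.
  move=> H; case: (boolP (a <= b)) => [ab|]; first exact: H.
  rewrite -ltNge => /ltW ba h1 h2; rewrite distrC [X in _ <= K * X]distrC.
  by apply: H => // u; rewrite minC maxC; [exact: h1|exact: h2].
rewrite (min_idPl ab) (max_idPr ab) => dfP dfK.
have [||c cab ->] := @MVT_segment R f df a b ab _ _.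
- by move=> x /andP[ax xb]; apply: dfP; rewrite !ltW.
- apply: derivable_within_continuous => x xab.
  by apply: ex_derive; apply: dfP.
by rewrite normrM ler_wpM2r// dfK.
Qed.

Lemma derive_segment_uniform f df (a b e : R) :
  (forall t : R, is_derive t 1 f (df t)) -> continuous df -> 0 < e ->
  exists2 h0, 0 < h0 & forall h t, 0 <= h < h0 -> a <= t <= b ->
    `|f (t + h) - f t - h * df t| <= e * h.
Proof.
move=> fdf cdf e0; have [h0 h0_gt0 H] := continuous_segment_uniform a b cdf e0.
exists h0 => // h t /andP[h_ge0 hh0] tab.
(* Without its linear part the function has derivative [df u - df t], which uniform continuity makes
   small. *)
pose g u := f u - (u - t) * df t.
have -> : f (t + h) - f t - h * df t = g (t + h) - g t by rewrite /g; ring.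
have le_th : t <= t + h by rewrite lerDl.
have hE : t + h - t = h by ring.
have := @mean_value_bound g (fun u => df u - df t) t (t + h) e.
rewrite (min_idPl le_th) (max_idPr le_th) hE (ger0_norm h_ge0); apply.
- move=> u _; apply: (is_deriveE (is_deriveBf (fdf u) (is_deriveMf
    (is_deriveBf (is_derive_idf u) (is_derive_cstf t u))
    (is_derive_cstf (df t) u)))).
  by ring.
- move=> u /andP[tu uth]; rewrite -[u](subrKC t); apply: H => //.
  by rewrite subr_ge0 tu/= (le_lt_trans _ hh0)// lerBlDl.
Qed.

(** Three nested mean value estimates, from [f2] down to [f]; the factor 1/6 of the sharp remainder
    is given up. *)
Lemma taylor3_bound f f1 f2 f3 (C x h : R) :
  (forall u : R, is_derive u 1 f (f1 u)) -> (forall u : R, is_derive u 1 f1 (f2 u)) ->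
  (forall u : R, is_derive u 1 f2 (f3 u)) -> (forall u, `|f3 u| <= C) ->
  `|f (x + h) - f x - h * f1 x - h ^+ 2 / 2 * f2 x| <= C * `|h| ^+ 3.
Proof.
move=> d0 d1 d2 bd3.
have nh u : Num.min 0 h <= u <= Num.max 0 h -> `|u| <= `|h|.
  case/andP; have [h0|h0] := leP 0 h.
    by move=> u0 uh; rewrite !ger0_norm// (le_trans u0).
  by move=> hu u0; rewrite !ler0_norm ?lerN2// ltW.
have C0 : 0 <= C by apply: le_trans (bd3 0).
have b2 u : Num.min 0 h <= u <= Num.max 0 h -> `|f2 (x + u) - f2 x| <= C * `|h|.
  move=> /nh uh; apply: (@le_trans _ _ (C * `|u|)); last by rewrite ler_wpM2l.
  have uE : x + u - x = u by ring.
  have := @mean_value_bound f2 f3 x (x + u) C; rewrite uE; apply=> v _.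
  exact: bd3.
pose g1 u := f1 (x + u) - f1 x - u * f2 x.
have shift (k k1 : R -> R) (u : R) : (forall v : R, is_derive v 1 k (k1 v)) ->
    is_derive u 1 (fun u => k (x + u)) (k1 (x + u)).
  move=> dk; apply: (is_deriveE (is_derive_compf (dk (x + u))
    (is_deriveDf (is_derive_cstf x u) (is_derive_idf u)))).
  by ring.
have dlin (c u : R) : is_derive u 1 (fun u : R => u * c) c.
  apply: (is_deriveE (is_deriveMf (is_derive_idf u) (is_derive_cstf c u))).
  by ring.
have b1 u : Num.min 0 h <= u <= Num.max 0 h -> `|g1 u| <= C * `|h| ^+ 2.
  move=> uh; have -> : g1 u = g1 u - g1 0 by rewrite /g1 addr0; ring.
  apply: (@le_trans _ _ (C * `|h| * `|u - 0|)); last first.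
    by rewrite subr0 expr2 mulrA ler_wpM2l ?mulr_ge0// nh.
  apply: (@mean_value_bound g1 (fun u => f2 (x + u) - f2 x)).
    move=> v _; apply: (is_deriveE (is_deriveBf (is_deriveBf (shift _ _ v d1)
      (is_derive_cstf (f1 x) v)) (dlin (f2 x) v))).
    by ring.
  move=> v /andP[v1 v2]; apply: b2; apply/andP; split.
    rewrite (le_trans _ v1)// le_min ge_min lexx/=.
    by case/andP: uh.
  rewrite (le_trans v2)// ge_max le_max lexx/=.
  by case/andP: uh.
pose g u := f (x + u) - f x - u * f1 x - u ^+ 2 / 2 * f2 x.
have -> : f (x + h) - f x - h * f1 x - h ^+ 2 / 2 * f2 x = g h - g 0.
  by rewrite /g addr0; ring.
have -> : `|h| ^+ 3 = `|h| ^+ 2 * `|h - 0| by rewrite subr0 exprSr.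
rewrite mulrA; apply: (@mean_value_bound g g1) => // u _.
apply: (is_deriveE (is_deriveBf (is_deriveBf (is_deriveBf (shift _ _ u d0)
  (is_derive_cstf (f x) u)) (dlin (f1 x) u)) (is_deriveMf (is_deriveMf
  (is_derive_sqrf (is_derive_idf u)) (is_derive_cstf 2^-1 u))
  (is_derive_cstf (f2 x) u)))).
by rewrite /g1; field.
Qed.

End Calculus.

(** * Exit from a set along a right-continuous path *)

Section PathExit.
Context {R : realType} {S : finType} (D : pred S) (p : R -> S).
Hypothesis p_rc : forall t, 0 <= t -> \forall s \near t^'+, p s = p t.

Definition exit_set : set R := [set t | 0 <= t /\ ~~ D (p t)].

(** The minimum of [h] and the exit time. The test for an exit before [h] keeps the value 0 of [inf]
    on the empty set from being taken for an exit. *)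
Definition stop_time (h : R) : R :=
  if `[< exists2 t, exit_set t & t <= h >] then inf exit_set else h.

Definition grid_exit (e : R) (n : nat) : nat :=
  find (fun i => ~~ D (p (i%:R * e))) (iota 0 n).

Lemma exit_set_lbound : has_lbound exit_set.
Proof. by exists 0 => t []. Qed.

Lemma exit_inf_ge0 : 0 <= inf exit_set.
Proof.
have [E0|E0] := pselect (exit_set !=set0); first by apply: lb_le_inf => // t [].
by rewrite inf_out// => -[].
Qed.

(** Just after the infimum the path keeps the value it has there, and exit times accumulate at the
    infimum unless it is one itself; so this value already lies outside [D]. *)
Lemma exit_inf_mem : exit_set !=set0 -> exit_set (inf exit_set).
Proof.
move=> E0; split; first exact: exit_inf_ge0.
have [e /= e0 pe] := p_rc exit_inf_ge0.
have [s Es se] := inf_adherent e0 (conj E0 exit_set_lbound).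
have := ge_inf exit_set_lbound Es; rewrite le_eqVlt => /predU1P[->|lts].
  by case: Es.
rewrite -(pe s) //; last 1 first.
  by rewrite /= distrC gtr0_norm ?subr_gt0// ltrBlDl.
by case: Es.
Qed.

Lemma grid_exit_le e n : (grid_exit e n <= n)%N.
Proof. by rewrite -[leqRHS](size_iota 0) find_size. Qed.

Lemma grid_exitE e n k : (k <= n)%N ->
  (forall i, (i < k)%N -> D (p (i%:R * e))) ->
  ((k < n)%N -> ~~ D (p (k%:R * e))) -> grid_exit e n = k.
Proof.
move=> kn Dk NDk; apply/eqP; rewrite eqn_leq; apply/andP; split; rewrite leqNgt.
  apply/negP => kg; have k_n := leq_trans kg (grid_exit_le e n).
  by have := before_find 0%N kg; rewrite nth_iota// add0n NDk.
apply/negP => gk; have gn := leq_trans gk kn.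
have : has (fun i => ~~ D (p (i%:R * e))) (iota 0 n) by rewrite has_find size_iota.
by move=> /(nth_find 0%N); rewrite nth_iota// add0n Dk.
Qed.

Lemma grid_exit_none e n : 0 < e ->
  ~ (exists2 t, exit_set t & t <= n%:R * e) -> grid_exit e n = n.
Proof.
move=> e0 NE; apply: grid_exitE => // [i i_n|]; last by rewrite ltnn.
apply: contrapT => /negP NDi; apply: NE; exists (i%:R * e).
  by split => //; rewrite mulr_ge0// ltW.
by rewrite ler_pM2r// ler_nat ltnW.
Qed.

(** The first grid point at or after the exit time comes before the path has moved again, so it sees
    the exit state. Grid points before the exit time are inside [D]. *)
Lemma grid_exit_some e n eta : 0 < e -> e < eta ->
  (forall s, inf exit_set < s < inf exit_set + eta -> p s = p (inf exit_set)) ->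
  (exists2 t, exit_set t & t <= n%:R * e) ->
  inf exit_set <= (grid_exit e n)%:R * e < inf exit_set + e /\
  p ((grid_exit e n)%:R * e) = p (inf exit_set).
Proof.
set tau := inf exit_set => e0 e_eta pE [t Et tn].
have E0 : exit_set !=set0 by exists t.
have tau_n : tau <= n%:R * e by apply: le_trans tn; exact: ge_inf exit_set_lbound _ Et.
have ex_k : exists k, tau <= k%:R * e by exists n.
case: (ex_minnP ex_k) => k tau_k kmin.
have kn : (k <= n)%N by exact: kmin.
have before i : (i < k)%N -> i%:R * e < tau.
  by move=> ik; rewrite ltNge; apply: contraTN ik => /kmin; rewrite leqNgt.
have k_tau : k%:R * e < tau + e.
  case: k before {tau_k kmin kn} => [_|k /(_ k (ltnSn _))].
    by rewrite mul0r; have := exit_inf_ge0; rewrite -/tau; lra.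
  by rewrite -natr1 mulrDl mul1r ltrD2r.
have pk : p (k%:R * e) = p tau.
  move: tau_k; rewrite le_eqVlt => /predU1P[->//|tk].
  by apply: pE; rewrite tk/= (lt_trans k_tau)// ltrD2l.
have -> : grid_exit e n = k.
  apply: grid_exitE => // [i /before ik|_]; last first.
    by rewrite pk; have [] := exit_inf_mem E0.
  apply: contrapT => /negP NDi; move: ik; apply/negP; rewrite -leNgt.
  apply: ge_inf exit_set_lbound _ _; split => //.
  by rewrite mulr_ge0// ltW.
by rewrite tau_k k_tau pk.
Qed.

Lemma grid_exit_near (e : nat -> R) (n : nat -> nat) :
  (forall k, 0 < e k) -> e k @[k --> \oo] --> 0 ->
  exit_set !=set0 ->
  (\forall k \near \oo, inf exit_set <= (n k)%:R * e k) ->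
  (grid_exit (e k) (n k))%:R * e k @[k --> \oo] --> inf exit_set /\
  \forall k \near \oo, p ((grid_exit (e k) (n k))%:R * e k) = p (inf exit_set).
Proof.
move=> e0 ecvg E0 nn.
have [eta /= eta0 pe] := p_rc exit_inf_ge0.
have pE s : inf exit_set < s < inf exit_set + eta -> p s = p (inf exit_set).
  move=> /andP[s1 s2]; apply: pe => //=.
  by rewrite distrC gtr0_norm ?subr_gt0// ltrBlDl.
have Hk : \forall k \near \oo,
    inf exit_set <= (grid_exit (e k) (n k))%:R * e k < inf exit_set + e k /\
    p ((grid_exit (e k) (n k))%:R * e k) = p (inf exit_set).
  near=> k; apply: (@grid_exit_some _ _ eta) => //.
    have : `|e k| < eta by near: k; exact: (cvgr0Pnorm_lt _).1.
    by rewrite gtr0_norm.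
  exists (inf exit_set); first exact: exit_inf_mem.
  by near: k.
split; last by apply: filterS Hk => k [].
apply/cvgrPdist_lt => eps eps0; near=> k.
have [/andP[h1 h2] _] : inf exit_set <= (grid_exit (e k) (n k))%:R * e k < inf exit_set + e k /\
    p ((grid_exit (e k) (n k))%:R * e k) = p (inf exit_set) by near: k.
have : `|e k| < eps by near: k; exact: (cvgr0Pnorm_lt _).1.
rewrite gtr0_norm// distrC ger0_norm ?subr_ge0// => ?.
by rewrite ltrBlDl (lt_trans h2)// ltrD2l.
Unshelve. all: by end_near. Qed.

(** The grid of mesh [h / k.+1] with [k.+1] steps ends exactly at [h], so a path without exit up to
    [h] is stopped at [h] by both rules. The states agree eventually, not only in the limit. *)
Lemma grid_stop_near (h : R) : 0 < h ->
  (grid_exit (h / k.+1%:R) k.+1)%:R * (h / k.+1%:R) @[k --> \oo] --> stop_time h /\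
  \forall k \near \oo,
    p ((grid_exit (h / k.+1%:R) k.+1)%:R * (h / k.+1%:R)) = p (stop_time h).
Proof.
move=> h0; have kE k : k.+1%:R * (h / k.+1%:R) = h :> R by rewrite mulrC divfK// pnatr_eq0.
rewrite /stop_time; case: asboolP => [[t Et th]|NE].
  apply: grid_exit_near => //.
  - by move=> k; rewrite divr_gt0.
  - rewrite -[X in _ --> X](mulr0 h); apply: cvgM; first exact: cvg_cst.
    exact: cvg_harmonic.
  - by exists t.
  - apply: nearW => k; rewrite kE (le_trans _ th)//.
    exact: ge_inf exit_set_lbound _ Et.
have gE k : grid_exit (h / k.+1%:R) k.+1 = k.+1.
  by apply: grid_exit_none; [rewrite divr_gt0|rewrite kE].
split; last by apply: nearW => k; rewrite gE kE.
by under eq_fun do rewrite gE kE; exact: cvg_cst.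
Qed.

End PathExit.

(** * Stopped Markov jump processes *)

Section GridMarkov.
Context {R : realType} {S : finType} (q : S -> S -> R).
Context {d : measure_display} {T : measurableType d} (Pr : probability T R).
Variable X : R -> T -> S.
Hypothesis hX : markov_jump_process q Pr X.
Variables (D : pred S) (e : R).
Hypothesis e0 : 0 < e.

Let t (i : nat) : R := i%:R * e.
Let t_ge0 i : 0 <= t i. Proof. by rewrite mulr_ge0// ltW. Qed.

Lemma measurable_state (s : R) (B : pred S) : 0 <= s ->
  measurable [set w | B (X s w)].
Proof.
move=> s0; rewrite (_ : [set w | _] = \bigcup_(x in [set x | B x]) [set w | X s w = x]).
  by apply: fin_bigcup_measurable => // x _; exact: (mjp_measurable hX).
apply/seteqP; split=> w /=; first by move=> BX; exists (X s w).
by move=> [x /= Bx ->].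
Qed.

Let inside (k : nat) : set T := [set w | forall i, (i < k)%N -> D (X (t i) w)].
Let follow (j n : nat) (x : nat -> S) : set T :=
  [set w | forall i, (j <= i <= n)%N -> X (t i) w = x i].

Let measurable_inside k : measurable (inside k).
Proof.
rewrite (_ : inside k = \bigcap_(i in [set i | (i < k)%N]) [set w | D (X (t i) w)])//.
by apply: bigcap_measurableType => i _; exact: measurable_state.
Qed.

Let measurable_follow j n x : measurable (follow j n x).
Proof.
rewrite (_ : follow j n x =
  \bigcap_(i in [set i | (j <= i <= n)%N]) [set w | X (t i) w = x i])//.
by apply: bigcap_measurableType => i _; exact: (mjp_measurable hX).
Qed.

Lemma prob_state_split (A : set T) (s : R) (B : pred S) : measurable A -> 0 <= s ->
  fine (Pr (A `&` [set w | B (X s w)])) =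
  \sum_(x | B x) fine (Pr (A `&` [set w | X s w = x])).
Proof.
move=> mA s0; have mX x := mjp_measurable hX x s0.
have mB := measurable_state B s0.
rewrite -expect_indic; last exact: measurableI.
transitivity (expect Pr (fun w => \sum_(x | B x) \1_(A `&` [set w | X s w = x]) w)).
  congr expect; apply/funext => w; rewrite indicI.
  case: (boolP (B (X s w))) => BX.
    rewrite (bigD1 (X s w))//= [X in _ + X]big1 => [|x /andP[_ xX]]; last first.
      rewrite indicI /= (_ : \1_[set w | X s w = x] w = 0) ?mulr0//.
      by rewrite indicE memNset//= => /eqP; rewrite eq_sym (negbTE xX).
    by rewrite indicI/= addr0 !indicE; congr (_ * _%:R); rewrite !mem_set.
  rewrite big1 => [|x Bx]; first by rewrite /= [X in _ * X]indicE memNset ?mulr0//=; exact/negP.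
  rewrite indicI /= (_ : \1_[set w | X s w = x] w = 0) ?mulr0//.
  by rewrite indicE memNset//= => XE; move: BX; rewrite XE Bx.
rewrite expect_sum => [|x _]; last by apply: bounded_rv_indic; exact: measurableI.
by apply: eq_bigr => x _; rewrite expect_indic//; exact: measurableI.
Qed.

Variable P : R -> S -> S -> R.
Hypothesis HP : forall (n : nat) (t : nat -> R) (x : nat -> S),
  0 <= t 0%N -> (forall i, t i <= t i.+1) ->
  Pr [set w | forall i, (i <= n.+1)%N -> X (t i) w = x i] =
  (Pr [set w | forall i, (i <= n)%N -> X (t i) w = x i]
   * (P (t n.+1 - t n) (x n) (x n.+1))%:E)%E.

(** The Markov property is given only for fully prescribed trajectories. By induction on [j], the
    condition of lying in [D] at time [j] is resolved into a sum over the states [z] of [D], each of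
    which extends the prescribed part backwards by one step. *)
Let prob_follow_step k j (x : nat -> S) : (j <= k)%N ->
  fine (Pr (inside j `&` follow j k.+1 x)) =
  fine (Pr (inside j `&` follow j k x)) * P e (x k) (x k.+1).
Proof.
elim: j x => [x _|j IHj x jk].
  have inside0 : inside 0 = setT by apply/seteqP; split.
  have t_incr i : t i <= t i.+1 by rewrite ler_pM2r// ler_nat.
  have := HP k x (t_ge0 0) t_incr; rewrite inside0 !setTI /follow => ->.
  rewrite fineM ?fin_num_measure//=; last exact: (measurable_follow 0 k x).
  by congr (_ * P _ _ _); rewrite /t -natr1; ring.
pose upd z i := if i == j then z else x i.
have split_j n : (j < n)%N -> inside j.+1 `&` follow j.+1 n x =
    (inside j `&` follow j.+1 n x) `&` [set w | D (X (t j) w)].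
  move=> jn; apply/seteqP; split=> w /=.
    move=> [h1 h2]; split; last exact: h1.
    by split=> // i ij; apply: h1; rewrite ltnS ltnW.
  move=> [[h1 h2] h3]; split=> // i; rewrite ltnS leq_eqVlt => /predU1P[->//|].
  exact: h1.
have follow_upd n z : (j < n)%N ->
    (inside j `&` follow j.+1 n x) `&` [set w | X (t j) w = z] =
    inside j `&` follow j n (upd z).
  move=> jn; apply/seteqP; split=> w /=.
    move=> [[h1 h2] h3]; split=> // i /andP[ji i_n]; rewrite /upd.
    case: eqVneq => [->//|ij]; apply: h2.
    by rewrite i_n andbT ltn_neqAle eq_sym ij.
  move=> [h1 h2]; split; last first.
    by rewrite (h2 j) ?leqnn ?(ltnW jn)// /upd eqxx.
  split=> // i /andP[ji i_n]; rewrite (h2 i) ?i_n ?(ltnW ji)// /upd.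
  by case: eqVneq ji => // ->; rewrite ltnn.
have mIF n : measurable (inside j `&` follow j.+1 n x) by exact: measurableI.
have jk1 : (j < k.+1)%N by rewrite ltnS ltnW.
rewrite !split_j// !prob_state_split// mulr_suml.
apply: eq_bigr => z Dz; rewrite !follow_upd// IHj ?(ltnW jk)//.
congr (_ * P _ _ _); rewrite /upd.
  by case: eqVneq jk => // ->; rewrite ltnn.
by case: eqVneq jk => // <-; rewrite ltnNge leqnSn.
Qed.

Lemma prob_inside_step k x y :
  fine (Pr (inside k `&` [set w | X (t k) w = x] `&` [set w | X (t k.+1) w = y])) =
  fine (Pr (inside k `&` [set w | X (t k) w = x])) * P e x y.
Proof.
pose z i := if i == k then x else y.
have := prob_follow_step z (leqnn k).
rewrite {3 4}/z eqxx gtn_eqF//.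
have -> : follow k k.+1 z = [set w | X (t k) w = x] `&` [set w | X (t k.+1) w = y].
  apply/seteqP; split=> w /=.
    move=> h; split; first by rewrite h ?leqnn ?leqnSn// /z eqxx.
    by rewrite h ?leqnn ?leqnSn// /z gtn_eqF.
  move=> [h1 h2] i /andP[ki]; rewrite leq_eqVlt => /predU1P[->|].
    by rewrite /z gtn_eqF.
  rewrite ltnS => ik; have -> : i = k by apply/eqP; rewrite eqn_leq ki ik.
  by rewrite /z eqxx.
have -> : follow k k z = [set w | X (t k) w = x].
  apply/seteqP; split=> w /=; first by move=> -> //; rewrite ?leqnn// /z eqxx.
  move=> h1 i; rewrite -eqn_leq => /eqP <-; by rewrite /z eqxx.
by rewrite setIA.
Qed.

End GridMarkov.

Section StoppedGrid.
Context {R : realType} {S : finType} (q : S -> S -> R).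
Context {d : measure_display} {T : measurableType d} (Pr : probability T R).
Variable X : R -> T -> S.
Hypothesis hX : markov_jump_process q Pr X.
Variables (D : pred S) (e : R).
Hypothesis e0 : 0 < e.
Variable V : nat -> S -> R.

Let t (i : nat) : R := i%:R * e.
Let t_ge0 i : 0 <= t i. Proof. by rewrite mulr_ge0// ltW. Qed.
Let inside (k : nat) : set T := [set w | forall i, (i < k)%N -> D (X (t i) w)].
Let step k x y := inside k `&` [set w | X (t k) w = x] `&` [set w | X (t k.+1) w = y].

Definition grid_value (n : nat) (w : T) : R :=
  V (grid_exit D (X^~ w) e n) (X ((grid_exit D (X^~ w) e n)%:R * e) w).

(** The increment is a finite combination of indicators of one-step events, whose probabilities
    [prob_inside_step] gives. After an exit none of them is active. *)
Lemma grid_valueS n w : grid_value n.+1 w = grid_value n w +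
  \sum_(x | D x) \sum_y (V n.+1 y - V n x) * \1_(step n x y) w.
Proof.
have step0 x y : ~ step n x y w -> (V n.+1 y - V n x) * \1_(step n x y) w = 0.
  by move=> Ns; rewrite indicE memNset// mulr0.
have iotaE : iota 0 n.+1 = iota 0 n ++ [:: n] by rewrite -addn1 iotaD.
rewrite /grid_value /grid_exit iotaE find_cat.
case: ifPn => [hs|nhs].
  rewrite big1 ?addr0// => x _; rewrite big1// => y _; apply: step0 => -[[ins _] _].
  move/hasP: hs => [i]; rewrite mem_iota add0n => /andP[_ i_n] /negP.
  by apply; exact: ins.
have ins : inside n w.
  move=> i i_n; apply: contrapT => /negP ND; move/negP: nhs; apply.
  by apply/hasP; exists i => //; rewrite mem_iota add0n.
rewrite (hasNfind nhs) size_iota /=.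
case: (boolP (D (X (n%:R * e) w))) => /= DX; last first.
  rewrite addn0 big1 ?addr0// => x Dx; rewrite big1// => y _; apply: step0.
  by move=> [[_ /= Xx] _]; move: DX; rewrite /t in Xx; rewrite Xx Dx.
rewrite (bigD1 (X (t n) w))//= (bigD1 (X (t n.+1) w))//=.
rewrite [X in _ + (_ + X + _)]big1 => [|y yX]; last first.
  by apply: step0 => -[_ /= E]; rewrite E eqxx in yX.
rewrite [X in _ + (_ + X)]big1 => [|x /andP[_ xX]]; last first.
  rewrite big1// => y _; apply: step0 => -[[_ /= E] _]; by rewrite E eqxx in xX.
by rewrite indicE mem_set// !addr0 mulr1 addn1 subrKC.
Qed.

Let measurable_step k x y : measurable (step k x y).
Proof.
apply: measurableI; last exact: (mjp_measurable hX).
apply: measurableI; last exact: (mjp_measurable hX).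
rewrite (_ : inside k = \bigcap_(i in [set i | (i < k)%N]) [set w | D (X (t i) w)])//.
by apply: bigcap_measurableType => i _; exact: (measurable_state hX).
Qed.

Let incr_bounded n x y : bounded_rv (fun w => (V n.+1 y - V n x) * \1_(step n x y) w).
Proof. by apply: bounded_rvZ; exact: bounded_rv_indic. Qed.

Lemma grid_value_bounded n : bounded_rv (grid_value n).
Proof.
elim: n => [|n IHn].
  rewrite (_ : grid_value 0 = fun w => \sum_x V 0%N x * \1_[set w | X 0 w = x] w).
    apply: bounded_rv_sum => x _; apply: bounded_rvZ; apply: bounded_rv_indic.
    exact: (mjp_measurable hX).
  apply/funext => w; rewrite /grid_value /grid_exit/= mul0r (bigD1 (X 0 w))//=.
  rewrite big1 => [|x xX]; first by rewrite addr0 indicE mem_set// mulr1.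
  by rewrite indicE memNset ?mulr0//= => E; rewrite E eqxx in xX.
rewrite (_ : grid_value n.+1 = fun w => grid_value n w +
    \sum_(x | D x) \sum_y (V n.+1 y - V n x) * \1_(step n x y) w); last first.
  by apply/funext => w; exact: grid_valueS.
apply: bounded_rvD => //; apply: bounded_rv_sum => x _.
by apply: bounded_rv_sum => y _; exact: incr_bounded.
Qed.

Variable P : R -> S -> S -> R.
Hypothesis tfP : transition_function q P.
Hypothesis HP : forall (n : nat) (t : nat -> R) (x : nat -> S),
  0 <= t 0%N -> (forall i, t i <= t i.+1) ->
  Pr [set w | forall i, (i <= n.+1)%N -> X (t i) w = x i] =
  (Pr [set w | forall i, (i <= n)%N -> X (t i) w = x i]
   * (P (t n.+1 - t n) (x n) (x n.+1))%:E)%E.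

(** A supermartingale inequality with error: each step costs at most [c] times the probability that
    no exit has occurred yet. *)
Lemma expect_grid_value_le n c : 0 <= c ->
  (forall k x, (k < n)%N -> D x -> \sum_y P e x y * V k.+1 y <= V k x + c) ->
  expect Pr (grid_value n) <= expect Pr (grid_value 0) + n%:R * c.
Proof.
move=> c0; elim: n => [_|n IHn H]; first by rewrite mul0r addr0.
have {}IHn := IHn (fun k x kn => H k x (ltnW kn)).
rewrite (_ : grid_value n.+1 = fun w => grid_value n w +
    \sum_(x | D x) \sum_y (V n.+1 y - V n x) * \1_(step n x y) w); last first.
  by apply/funext => w; exact: grid_valueS.
have bs x : bounded_rv (fun w => \sum_y (V n.+1 y - V n x) * \1_(step n x y) w).
  by apply: bounded_rv_sum => y _; exact: incr_bounded.
rewrite expectD; [|exact: grid_value_bounded|exact: bounded_rv_sum].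
rewrite -natr1 mulrDl mul1r addrA lerD// expect_sum//.
have mi : measurable (inside n).
  rewrite (_ : inside n = \bigcap_(i in [set i | (i < n)%N]) [set w | D (X (t i) w)])//.
  by apply: bigcap_measurableType => i _; exact: (measurable_state hX).
have E x : expect Pr (fun w => \sum_y (V n.+1 y - V n x) * \1_(step n x y) w) =
    fine (Pr (inside n `&` [set w | X (t n) w = x])) *
    (\sum_y P e x y * V n.+1 y - V n x).
  rewrite expect_sum; last by move=> y _; exact: incr_bounded.
  transitivity (\sum_y (V n.+1 y - V n x) *
      (fine (Pr (inside n `&` [set w | X (t n) w = x])) * P e x y)).
    apply: eq_bigr => y _; rewrite expectZ; last exact: bounded_rv_indic.
    by rewrite expect_indic// (prob_inside_step hX D e0 HP).
  under eq_bigr do rewrite mulrCA; rewrite -mulr_sumr; congr (_ * _).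
  under eq_bigr do rewrite mulrBl; rewrite sumrB -mulr_sumr.
  rewrite (tf_sum1 tfP) ?mulr1 ?ltW//; congr (_ - _).
  by apply: eq_bigr => y _; rewrite mulrC.
apply: (@le_trans _ _ (\sum_(x | D x)
    fine (Pr (inside n `&` [set w | X (t n) w = x])) * c)).
  apply: ler_sum => x Dx; rewrite E ler_wpM2l ?fine_ge0//.
  by rewrite lerBlDl; exact: H.
rewrite -mulr_suml -(prob_state_split hX)// ler_piMl//.
have mB : measurable (inside n `&` [set w | D (X (t n) w)]).
  by apply: measurableI => //; exact: (measurable_state hX).
by rewrite -lee_fin fineK ?fin_num_measure// probability_le1.
Qed.

End StoppedGrid.

Section StoppedSupermartingale.
Context {R : realType} {S : finType} (q : S -> S -> R).
Context {d : measure_display} {T : measurableType d} (Pr : probability T R).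
Variable X : R -> T -> S.
Hypothesis hX : markov_jump_process q Pr X.
Variables (D : pred S) (U U' : R -> S -> R) (h : R).
Hypothesis h0 : 0 < h.
Hypothesis dU : forall x (t : R), is_derive t 1 (U^~ x) (U' t x).
Hypothesis cU' : forall x, continuous (U'^~ x).

Let cU x : continuous (U^~ x).
Proof. by move=> s; exact: (is_derive_continuous (dU x s)). Qed.

Lemma bounded_uniform : exists C, forall t x, 0 <= t <= h -> `|U t x| <= C.
Proof.
have HC x := continuous_segment_bounded 0 h (@cU x).
pose C x := projT1 (cid2 (HC x)).
exists (\sum_x C x) => t x th; rewrite (bigD1 x)//= -[X in X <= _]addr0 lerD//.
  by rewrite /C; case: cid2 => c /= _; apply.
by apply: sumr_ge0 => y _; rewrite /C; case: cid2.
Qed.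

(** The rates are limits at time 0 only, so the infinitesimal inequality becomes one for a short
    step [e] with error [eps * e]. Uniformity in [t] is essential, as the errors of all the grid
    steps are added. *)
Lemma transition_expansion P eps : transition_function q P -> 0 < eps ->
  (forall t x, 0 <= t <= h -> D x ->
    U' t x + \sum_(y | y != x) q x y * (U t y - U t x) <= 0) ->
  exists2 e0, 0 < e0 & forall e t x, 0 < e < e0 -> 0 <= t <= h -> D x ->
    \sum_y P e x y * U (t + e) y <= U t x + eps * e.
Proof.
move=> tfP eps0 HU.
(* Half of [eps] is kept for the time derivative; the other half is shared among at most [#|S|]
   transitions. The added 1 keeps denominators positive, here and below. *)
pose n1 : R := (2 * (#|S|%:R + 1)); have n1_gt0 : 0 < n1.
  by rewrite mulr_gt0// ltr_wpDl.
have [ep ep0 epE] : exists2 ep, 0 < ep & ep = eps / n1.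
  by exists (eps / n1); rewrite ?divr_gt0.
have near1 x : \forall e \near 0^'+, forall t, 0 <= t <= h ->
    `|U (t + e) x - U t x - e * U' t x| <= eps / 2 * e.
  have [|e1 e10 H] := derive_segment_uniform 0 h (dU x) (@cU' x) (e := eps / 2).
    by rewrite divr_gt0.
  near=> e => t th; apply: H => //; apply/andP; split; near: e.
    exact: nbhs_right_ge.
  exact: nbhs_right_lt.
have near2 x y : \forall e \near 0^'+, forall t, 0 <= t <= h -> y != x ->
    `|P e x y / e * (U (t + e) y - U (t + e) x) - q x y * (U t y - U t x)| <= ep.
  have [yx|yx] := eqVneq y x; first by apply: nearW.
  have cW : continuous (fun s => U s y - U s x).
    by move=> s; apply: cvgB; exact: cU.
  have [B B0 HB] := continuous_segment_bounded 0 (h + 1) cW.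
  have xy : x != y by rewrite eq_sym.
  have /cvgrPdist_le/(_ (ep / (2 * (B + 1)))) := tf_rate tfP xy.
  rewrite divr_gt0 ?mulr_gt0 ?ltr_wpDl// => /(_ isT) nq.
  have ep2 : 0 < ep / (2 * (`|q x y| + 1)).
    by rewrite divr_gt0 ?mulr_gt0 ?ltr_wpDl.
  have [e1 e10 H] := continuous_segment_uniform 0 h cW ep2.
  near=> e => t th _.
  have e_gt0 : 0 < e by near: e; exact: nbhs_right_gt.
  have e_lt1 : e < 1 by near: e; exact: nbhs_right_lt.
  have h1 : `|q x y - P e x y / e| <= ep / (2 * (B + 1)) by near: e.
  have h2 : `|(U (t + e) y - U (t + e) x) - (U t y - U t x)| <=
      ep / (2 * (`|q x y| + 1)).
    apply: H => //; rewrite ltW//=; near: e; exact: nbhs_right_lt.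
  have h3 : `|U (t + e) y - U (t + e) x| <= B.
    apply: HB; case/andP: th => t_ge0 t_h.
    by rewrite addr_ge0 ?(ltW e_gt0)//= lerD// ltW.
  set W := U (t + e) y - _; set W0 := U t y - _; set r := P e x y / e.
  have -> : r * W - q x y * W0 = (r - q x y) * W + q x y * (W - W0) by ring.
  rewrite (le_trans (ler_normD _ _))// !normrM [ep]splitr lerD//.
    rewrite distrC; apply: (le_trans (ler_pM _ _ h1 h3)) => //.
    rewrite -subr_ge0 (_ : _ - _ = ep / (2 * (B + 1))); last by field; lra.
    by rewrite divr_ge0 ?ltW ?mulr_gt0 ?ltr_wpDl.
  apply: (le_trans (ler_wpM2l _ h2)) => //.
  have Q0 := normr_ge0 (q x y).
  rewrite -subr_ge0 (_ : _ - _ = ep / (2 * (`|q x y| + 1))); last by field; lra.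
  by rewrite divr_ge0 ?ltW ?mulr_gt0 ?ltr_wpDl.
have nearall : \forall e \near 0^'+, (forall x t, 0 <= t <= h ->
     `|U (t + e) x - U t x - e * U' t x| <= eps / 2 * e) /\
   (forall x y t, 0 <= t <= h -> y != x ->
    `|P e x y / e * (U (t + e) y - U (t + e) x) - q x y * (U t y - U t x)| <= ep).
  near=> e; split; near: e; first exact: filter_forall.
  apply: filter_forall => x; exact: filter_forall.
have [e1 /= e10 H] := nearall; exists e1 => // e t x /andP[e0 ee1] th Dx.
have [||/(_ x t th) h1 h2] := H e; [|exact: e0|].
  by rewrite /= sub0r normrN gtr0_norm.
(* Rows of [P e] sum to 1, which eliminates the diagonal entry; [tf_rate] describes all the
   others. *)
have -> : \sum_y P e x y * U (t + e) y = U (t + e) x +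
    e * \sum_(y | y != x) P e x y / e * (U (t + e) y - U (t + e) x).
  transitivity (\sum_y P e x y * (U (t + e) y - U (t + e) x) + U (t + e) x).
    under [X in _ = X + _]eq_bigr do rewrite mulrBr.
    by rewrite sumrB -mulr_suml (tf_sum1 tfP) ?(ltW e0)// mul1r subrK.
  rewrite addrC (bigD1 x)//= subrr mulr0 add0r mulr_sumr; congr (_ + _).
  by apply: eq_bigr => y yx; rewrite mulrA mulrCA divff ?mulr1// gt_eqF.
have h3 : \sum_(y | y != x) P e x y / e * (U (t + e) y - U (t + e) x) <=
    \sum_(y | y != x) q x y * (U t y - U t x) + eps / 2.
  apply: (@le_trans _ _ (\sum_(y | y != x) (q x y * (U t y - U t x) + ep))).
    apply: ler_sum => y yx; have := h2 x y t th yx.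
    by rewrite ler_norml => /andP[_]; rewrite lerBlDl.
  rewrite big_split/= lerD2l sumr_const -[_ *+ _]mulr_natr.
  apply: (@le_trans _ _ (ep * #|S|%:R)).
    by rewrite ler_wpM2l ?(ltW ep0)// ler_nat max_card.
  rewrite epE /n1 -subr_ge0.
  rewrite (_ : _ - _ = eps / (2 * (#|S|%:R + 1))); last by field; rewrite lt0r_neq0// ltr_wpDl.
  by rewrite divr_ge0 ?ltW ?mulr_gt0 ?ltr_wpDl.
have := HU t x th Dx; move: h1; rewrite ler_norml => /andP[_].
set A := \sum_(y | y != x) q x y * _ in h3 *; set B := \sum_(y | y != x) _ in h3 *.
move=> h1 h4; have : e * B <= e * (A + eps / 2) by rewrite ler_wpM2l ?(ltW e0).
have : e * (U' t x + A) <= 0 by rewrite mulr_ge0_le0 ?(ltW e0).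
by lra.
Unshelve. all: by end_near. Qed.

Hypothesis HU : forall t x, 0 <= t <= h -> D x ->
  U' t x + \sum_(y | y != x) q x y * (U t y - U t x) <= 0.

Let sigma w := stop_time D (X^~ w) h.

(** Dynkin's inequality at a bounded stopping time, obtained as a limit of grid inequalities.
    Dominated convergence applies because [U] is bounded on [[0, h]], the state space being
    finite. *)
Lemma stopped_supermartingale :
  bounded_rv (fun w => U (sigma w) (X (sigma w) w)) /\
  expect Pr (fun w => U (sigma w) (X (sigma w) w)) <= expect Pr (fun w => U 0 (X 0 w)).
Proof.
have [P tfP HP] := mjp_markov hX.
have [C HC] := bounded_uniform.
pose e n := h / n.+1%:R; have e0 n : 0 < e n by rewrite divr_gt0.
have eh n : n.+1%:R * e n = h by rewrite mulrC divfK// pnatr_eq0.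
pose V n k x := U (k%:R * e n) x.
pose F n := grid_value X D (e n) (V n) n.+1.
have gridh n w : 0 <= (grid_exit D (X^~ w) (e n) n.+1)%:R * e n <= h.
  rewrite mulr_ge0 ?(ltW (e0 n))//= -[leRHS](eh n) ler_pM2r// ler_nat.
  exact: grid_exit_le.
have FC n w : `|F n w| <= C by apply: HC; exact: gridh.
have F0 n w : grid_value X D (e n) (V n) 0 w = U 0 (X 0 w).
  by rewrite /grid_value /grid_exit /V/= mul0r.
have Fcvg w : F n w @[n --> \oo] --> U (sigma w) (X (sigma w) w).
  have rc : forall t, 0 <= t -> \forall s \near t^'+, X s w = X t w.
    by move=> t; exact: (mjp_right_continuous hX).
  have [c1 c2] := grid_stop_near D rc h0.
  have : U ((grid_exit D (X^~ w) (e n) n.+1)%:R * e n) (X (sigma w) w)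
      @[n --> \oo] --> U (sigma w) (X (sigma w) w).
    exact: (cvg_comp _ _ c1 (@cU (X (sigma w) w) _)).
  apply: cvg_trans; apply: near_eq_cvg.
  by apply: filterS c2 => n E; rewrite /F /grid_value /V E.
have [bF EF] := expect_cvg Pr (fun n => (grid_value_bounded hX D (e0 n) (V n) n.+1).1) FC Fcvg.
split=> //; apply/ler_addgt0Pr => eps eps0.
apply: (cvgr_to_le EF).
have [e1 e10 H] := transition_expansion tfP (divr_gt0 eps0 h0) HU.
near=> n.
have en : e n < e1.
  have : `|e n| < e1.
    near: n; apply: (cvgr0Pnorm_lt _).1 => //.
    rewrite -[X in _ --> X](mulr0 h); apply: cvgM; first exact: cvg_cst.
    exact: cvg_harmonic.
  by rewrite gtr0_norm.
have -> : expect Pr (fun w => U 0 (X 0 w)) = expect Pr (grid_value X D (e n) (V n) 0).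
  by congr expect; apply/funext => w; rewrite F0.
(* An error rate [eps / h] over the whole length [h] amounts to [eps], whatever the mesh. *)
have -> : eps = n.+1%:R * (eps / h * e n).
  by rewrite mulrCA eh divfK// gt_eqF.
apply: (expect_grid_value_le hX (e0 n) tfP HP).
  by rewrite mulr_ge0// ltW// divr_gt0.
move=> k x kn Dx; rewrite /V -natr1 mulrDl mul1r; apply: H => //.
  by rewrite e0.
by rewrite mulr_ge0 ?(ltW (e0 n))//= -[leRHS](eh n) ler_pM2r// ler_nat ltnW.
Unshelve. all: by end_near. Qed.

End StoppedSupermartingale.

(** * Measurability of the exit time and of the exit state *)

Section ExitMeasurable.
Context {R : realType} {S : finType} (q : S -> S -> R).
Context {d : measure_display} {T : measurableType d} (Pr : probability T R).
Variable X : R -> T -> S.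
Hypothesis hX : markov_jump_process q Pr X.
Variable D : pred S.

Lemma initial_state_bounded (g : S -> R) : bounded_rv (fun w => g (X 0 w)).
Proof.
have := grid_value_bounded hX D ltr01 (fun=> g) 0; congr bounded_rv.
by apply/funext => w; rewrite /grid_value /grid_exit/= mul0r.
Qed.

Let tau w := inf (exit_set D (X^~ w)).
(** The mesh tends to 0 while the horizon [n k * e k = k.+1] grows, so every exit is eventually
    found; the index [n k] then signals a path that never exits. *)
Let e (k : nat) : R := k.+1%:R^-1.
Let n (k : nat) : nat := (k.+1 ^ 2)%N.
Let e0 k : 0 < e k. Proof. by rewrite invr_gt0. Qed.
Let ne k : (n k)%:R * e k = k.+1%:R.
Proof. by rewrite /n /e natrX expr2 mulfK// pnatr_eq0. Qed.

Let grid_exit_cvg w : exit_set D (X^~ w) !=set0 ->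
  [/\ (grid_exit D (X^~ w) (e k) (n k))%:R * e k @[k --> \oo] --> tau w,
      \forall k \near \oo, X ((grid_exit D (X^~ w) (e k) (n k))%:R * e k) w = X (tau w) w &
      \forall k \near \oo, grid_exit D (X^~ w) (e k) (n k) != n k].
Proof.
move=> E0.
have rc : forall t, 0 <= t -> \forall s \near t^'+, X s w = X t w.
  by move=> t; exact: (mjp_right_continuous hX).
have [||c1 c2] := @grid_exit_near _ _ D _ rc e n e0 _ E0.
- exact: cvg_harmonic.
- near=> k; rewrite ne -natr1 ler_wpDr//.
  near: k; exact: nbhs_infty_ger.
split=> //; near=> k; apply/negP => /eqP gE.
have h1 : (grid_exit D (X^~ w) (e k) (n k))%:R * e k < tau w + 1.
  by near: k; apply: (cvgr_lt _ c1); rewrite ltrDl.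
have h2 : tau w <= k%:R by near: k; exact: nbhs_infty_ger.
by move: h1; rewrite gE ne -natr1 ltrD2r ltNge h2.
Unshelve. all: by end_near. Qed.

Let grid_exit_empty w k : ~ (exit_set D (X^~ w) !=set0) ->
  grid_exit D (X^~ w) (e k) (n k) = n k.
Proof. by move=> E0; apply: grid_exit_none => // -[t Et _]; apply: E0; exists t. Qed.

Let exit_empty w : ~ (exit_set D (X^~ w) !=set0) -> tau w = 0.
Proof. by move=> E0; apply: inf_out => -[]. Qed.

Lemma measurable_exit_inf : measurable_fun setT tau.
Proof.
(* The value 0 at index [n k] reproduces the value of [inf] on the empty set. *)
pose V k i (_ : S) := if i == n k then 0 else i%:R * e k.
apply: (measurable_fun_cvg (h := fun k => grid_value X D (e k) (V k) (n k))).
  by move=> k; exact: (grid_value_bounded hX D (e0 k) (V k) (n k)).1.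
move=> w _; rewrite /grid_value /V.
have [E0|E0] := pselect (exit_set D (X^~ w) !=set0); last first.
  rewrite (exit_empty E0); apply: cvg_near_cst; apply: nearW => k.
  by rewrite grid_exit_empty// eqxx.
have [c1 _ c3] := grid_exit_cvg E0; apply: cvg_trans c1; apply: near_eq_cvg.
by apply: filterS c3 => k /negbTE ->.
Qed.

Lemma measurable_exit_state (g : S -> R) : measurable_fun setT (fun w => g (X (tau w) w)).
Proof.
pose V k i (x : S) := if i == n k then 0 else g x.
pose V' k i (_ : S) : R := (i == n k)%:R.
pose G := grid_value X D 1 (fun=> g) 0.
have GE w : G w = g (X 0 w) by rewrite /G /grid_value /grid_exit/= mul0r.
(* A path that never exits has [tau] equal to 0 by convention, and its exit state is the initial
   one; the second summand supplies it. *)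
apply: (measurable_fun_cvg (h := fun k w => grid_value X D (e k) (V k) (n k) w +
    grid_value X D (e k) (V' k) (n k) w * G w)).
  move=> k; have m1 := (grid_value_bounded hX D (e0 k) (V k) (n k)).1.
  have m2 := (grid_value_bounded hX D (e0 k) (V' k) (n k)).1.
  have m3 := (grid_value_bounded hX D ltr01 (fun=> g) 0).1.
  by apply: measurable_funD => //; exact: measurable_funM.
move=> w _; rewrite GE /grid_value /V /V'.
have [E0|E0] := pselect (exit_set D (X^~ w) !=set0); last first.
  rewrite (exit_empty E0); apply: cvg_near_cst; apply: nearW => k.
  by rewrite grid_exit_empty// eqxx mul1r add0r.
have [_ c2 c3] := grid_exit_cvg E0; apply: cvg_near_cst.
by apply: filterS2 c2 c3 => k -> /negbTE ->; rewrite mul0r addr0.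
Qed.

End ExitMeasurable.

(** * The drift and its linearizing coordinate *)

Section Drift.
Context {R : realType} (beta : R).
Hypothesis hbeta : 1 < beta.

Local Notation a := (growth beta).
Local Notation b := (drift beta).
Local Notation Q := (remainder beta).

Lemma growth_gt0 : 0 < a.
Proof. by rewrite /growth subr_gt0 ltr_pMr. Qed.

Definition drift1 (m : R) : R := (beta * (1 - m) - 1) * expR (beta * m)
  + (beta * (1 + m) - 1) * expR (- beta * m).
Definition drift2 (m : R) : R := (beta ^+ 2 * (1 - m) - 2 * beta) * expR (beta * m)
  - (beta ^+ 2 * (1 + m) - 2 * beta) * expR (- beta * m).
Definition drift3 (m : R) : R := (beta ^+ 3 * (1 - m) - 3 * beta ^+ 2) * expR (beta * m)
  + (beta ^+ 3 * (1 + m) - 3 * beta ^+ 2) * expR (- beta * m).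

(** The drift and its derivatives are combinations of functions [(A x + B) exp (c x)], a class
    closed under differentiation. *)
Lemma is_derive_affine_exp (A B c m : R) :
  is_derive m 1 (fun x => (A * x + B) * expR (c * x)) ((A + c * (A * m + B)) * expR (c * m)).
Proof.
have dl (k x : R) : is_derive x 1 (fun y : R => k * y) k.
  by apply: (is_deriveE (is_deriveZf k (is_derive_idf x))); ring.
apply: (is_deriveE (is_deriveMf (is_deriveDf (dl A m) (is_derive_cstf B m))
  (is_derive_expf (dl c m)))).
by ring.
Qed.

Lemma is_derive_drift (m : R) : is_derive m 1 b (drift1 m).
Proof.
have -> : b = fun x => ((-1) * x + 1) * expR (beta * x) - (1 * x + 1) * expR (- beta * x).
  by apply/funext => x; rewrite /drift; ring.
apply: (is_deriveE (is_deriveBf (is_derive_affine_exp _ _ _ m) (is_derive_affine_exp _ _ _ m))).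
by rewrite /drift1; ring.
Qed.

Lemma is_derive_drift1 (m : R) : is_derive m 1 drift1 (drift2 m).
Proof.
have -> : drift1 = fun x => ((- beta) * x + (beta - 1)) * expR (beta * x)
    + (beta * x + (beta - 1)) * expR (- beta * x).
  by apply/funext => x; rewrite /drift1; ring.
apply: (is_deriveE (is_deriveDf (is_derive_affine_exp _ _ _ m) (is_derive_affine_exp _ _ _ m))).
by rewrite /drift2; ring.
Qed.

Lemma is_derive_drift2 (m : R) : is_derive m 1 drift2 (drift3 m).
Proof.
have -> : drift2 = fun x => ((- beta ^+ 2) * x + (beta ^+ 2 - 2 * beta)) * expR (beta * x)
    - (beta ^+ 2 * x + (beta ^+ 2 - 2 * beta)) * expR (- beta * x).
  by apply/funext => x; rewrite /drift2; ring.
apply: (is_deriveE (is_deriveBf (is_derive_affine_exp _ _ _ m) (is_derive_affine_exp _ _ _ m))).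
by rewrite /drift3; ring.
Qed.

Lemma continuous_drift : continuous b.
Proof. by move=> m; exact: (is_derive_continuous (is_derive_drift m)). Qed.

Lemma drift0 : b 0 = 0.
Proof. by rewrite /drift !mulr0 expR0; ring. Qed.

Lemma driftN m : b (- m) = - b m.
Proof. by rewrite /drift !mulrNN mulrN mulNr opprK; ring. Qed.

(** The drift is odd, so its second derivative vanishes at 0, and bounding the third one yields a
    cubic remainder. This order makes the integrand of [Kconst] vanish linearly at 0. *)
Lemma remainder_cubic : exists2 C, 0 < C & forall m, `|m| <= 1 ->
  `|Q m| <= C * `|m| ^+ 3 /\ `|drift1 m - a| <= C * `|m| ^+ 2.
Proof.
have cd3 : continuous drift3.
  move=> m; have -> : drift3 = fun x =>
      ((- beta ^+ 3) * x + (beta ^+ 3 - 3 * beta ^+ 2)) * expR (beta * x)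
    + (beta ^+ 3 * x + (beta ^+ 3 - 3 * beta ^+ 2)) * expR (- beta * x).
    by apply/funext => x; rewrite /drift3; ring.
  exact: (is_derive_continuous (is_deriveDf (is_derive_affine_exp _ _ _ m)
    (is_derive_affine_exp _ _ _ m))).
have [C C0 HC] := continuous_segment_bounded (-1) 1 cd3.
have C1 : 0 < C + 1 by rewrite ltr_wpDl.
exists (C + 1) => // m m1.
have btw u : Num.min 0 m <= u <= Num.max 0 m -> `|u| <= `|m|.
  have [m0|m0] := leP 0 m => /andP[u1 u2].
    by rewrite !ger0_norm// (le_trans u1).
  by rewrite !ler0_norm ?lerN2// ltW.
have sub u v : Num.min 0 m <= u <= Num.max 0 m -> Num.min 0 u <= v <= Num.max 0 u ->
    Num.min 0 m <= v <= Num.max 0 m.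
  move=> /andP[u1 u2] /andP[v1 v2]; apply/andP; split.
    by rewrite (le_trans _ v1)// le_min ge_min lexx/=.
  by rewrite (le_trans v2)// ge_max le_max lexx/=.
have d20 : drift2 0 = 0 by rewrite /drift2 !mulr0 expR0; ring.
have d10 : drift1 0 = a by rewrite /drift1 /growth !mulr0 expR0; ring.
have b2 u : Num.min 0 m <= u <= Num.max 0 m -> `|drift2 u| <= (C + 1) * `|m|.
  move=> um; have := @mean_value_bound R drift2 drift3 0 u (C + 1).
  rewrite d20 !subr0 => H; apply: le_trans (H _ _) _.
  - by move=> v _; exact: is_derive_drift2.
  - move=> v /(sub _ _ um)/btw vm; apply: (@le_trans _ _ C); last by rewrite lerDl.
    by apply: HC; rewrite -ler_norml (le_trans vm).
  - by rewrite ler_wpM2l ?(ltW C1)// btw.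
have b1 u : Num.min 0 m <= u <= Num.max 0 m -> `|drift1 u - a| <= (C + 1) * `|m| ^+ 2.
  move=> um; have := @mean_value_bound R drift1 drift2 0 u ((C + 1) * `|m|).
  rewrite d10 !subr0 => H; apply: le_trans (H _ _) _.
  - by move=> v _; exact: is_derive_drift1.
  - by move=> v /(sub _ _ um); exact: b2.
  - by rewrite expr2 mulrA ler_wpM2l ?btw// mulr_ge0 ?(ltW C1).
have mm : Num.min 0 m <= m <= Num.max 0 m by rewrite ge_min le_max lexx !orbT.
split; last exact: b1.
have := @mean_value_bound R Q (fun u => drift1 u - a) 0 m ((C + 1) * `|m| ^+ 2).
have -> : Q 0 = 0 by rewrite /remainder drift0 mulr0 subr0.
rewrite !subr0 => H; apply: le_trans (H _ _) _.
- move=> v _; apply: (is_deriveE (is_deriveBf (is_derive_drift v)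
    (is_deriveZf a (is_derive_idf v)))).
  by ring.
- exact: b1.
- by rewrite -mulrA -exprSr.
Qed.

Variable mstar : R.
Hypothesis hmstar : is_mstar beta mstar.

(* Taking logarithms, the sign of the drift is that of 2 beta m + ln (1 - m) -
   ln (1 + m), which is strictly concave and vanishes at 0 and mstar. *)
Lemma drift_gt0 m : 0 < m < mstar -> 0 < b m.
Proof.
have [/andP[ms0 ms1] msE] := hmstar => /andP[m0 mms].
pose g (x : R) : R := 2 * beta * x + ln (1 - x) - ln (1 + x).
pose g' (x : R) : R := 2 * beta - (1 - x)^-1 - (1 + x)^-1.
have dg (x : R) : 0 <= x < 1 -> is_derive x 1 g (g' x).
  move=> /andP[x0 x1].
  have h1 : 0 < 1 - x by rewrite subr_gt0.
  have h2 : 0 < 1 + x by rewrite ltr_pwDl.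
  have d1 : is_derive x 1 (fun y : R => 1 - y) (- 1).
    by apply: (is_deriveE (is_deriveBf (is_derive_cstf 1 x) (is_derive_idf x))); ring.
  have d2 : is_derive x 1 (fun y : R => 1 + y) 1.
    by apply: (is_deriveE (is_deriveDf (is_derive_cstf 1 x) (is_derive_idf x))); ring.
  have l1 := is_derive1_ln h1; have l2 := is_derive1_ln h2.
  apply: (is_deriveE (is_deriveBf (is_deriveDf (is_deriveZf (2 * beta) (is_derive_idf x))
    (is_derive_compf (g := fun y : R => 1 - y) l1 d1))
    (is_derive_compf (g := fun y : R => 1 + y) l2 d2))).
  by rewrite /g'; ring.
have mvt u v : 0 <= u -> u < v -> v < 1 -> exists2 c, u < c < v & g v - g u = g' c * (v - u).
  move=> u0 uv v1.
  have [||c cuv ->] := @MVT R g g' u v uv.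
  - move=> x; rewrite in_itv/= => /andP[x1 x2]; apply: dg.
    by rewrite (le_trans u0 (ltW x1)) (lt_trans x2).
  - apply: derivable_within_continuous => x; rewrite in_itv/= => /andP[x1 x2].
    apply: ex_derive; apply: dg.
    by rewrite (le_trans u0 x1) (le_lt_trans x2).
  by exists c => //; move: cuv; rewrite in_itv.
have g0 : g 0 = 0 by rewrite /g mulr0 subr0 addr0 ln1; ring.
have gms : g mstar = 0.
  rewrite /g -mulrA msE ln_div ?posrE ?subr_gt0// ?ltr_pwDl// ?(ltW ms0)//.
  by field.
have gm : 0 < g m.
  rewrite ltNge; apply/negP => gm0.
  have [c /andP[c0 cm] Ec] := mvt 0 m (lexx _) m0 (lt_trans mms ms1).
  have [e /andP[me ems] Ee] := mvt m mstar (ltW m0) mms ms1.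
  have : g' e < g' c.
    rewrite /g' -subr_gt0.
    have c1 : c < 1 by apply: lt_trans ms1; apply: lt_trans mms.
    have e1 : e < 1 by apply: lt_trans ms1.
    have ce : c < e by apply: lt_trans me.
    have -> : 2 * beta - (1 - c)^-1 - (1 + c)^-1 - (2 * beta - (1 - e)^-1 - (1 + e)^-1) =
       2 * (e - c) * (e + c) / ((1 - c) * (1 + c) * (1 - e) * (1 + e)).
      by field; do !(apply/andP; split); rewrite gt_eqF//; lra.
    by rewrite divr_gt0 ?mulr_gt0//; lra.
  have c_le0 : g' c <= 0.
    have : g' c * (m - 0) <= 0 by rewrite -Ec g0 subr0.
    by rewrite subr0 pmulr_lle0.
  have e_ge0 : 0 <= g' e.
    have : 0 <= g' e * (mstar - m) by rewrite -Ee gms sub0r oppr_ge0.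
    by rewrite pmulr_lge0// subr_gt0.
  by lra.
have m1 : m < 1 by exact: lt_trans ms1.
have h1 : 0 < 1 - m by rewrite subr_gt0.
have h2 : 0 < 1 + m by rewrite ltr_pwDl// ltW.
rewrite /drift subr_gt0 -(lnK h2) -(lnK h1) -!expRD ltr_expR.
by move: gm; rewrite /g; lra.
Qed.

(** Near 0 the linear part dominates the cubic remainder; on the rest of the segment the drift is
    positive and attains its minimum. Quotients by the drift are controlled through this bound. *)
Lemma drift_lower x1 : 0 < x1 < mstar ->
  exists2 c, 0 < c & forall x, 0 <= x <= x1 -> c * x <= b x.
Proof.
move=> /andP[x10 x1ms]; have [C C0 HC] := remainder_cubic.
have a0 := growth_gt0.
have [/andP[ms0 ms1] _] := hmstar.
(* For [x <= 1] and [x <= a / (2 C)] the remainder [C x ^ 3] is at most half of [a x]. *)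
pose x0 := Num.min x1 (Num.min 1 (a / (2 * C))).
have x00 : 0 < x0 by rewrite !lt_min x10 ltr01 divr_gt0// mulr_gt0.
have [||y /andP[y1 y2] Hy] := @EVT_min R b x0 x1.
- by rewrite ge_min lexx.
- by apply: continuous_subspaceT; exact: continuous_drift.
have by0 : 0 < b y.
  apply: drift_gt0; rewrite (lt_le_trans x00)//=.
  by rewrite (le_lt_trans _ x1ms).
exists (Num.min (a / 2) (b y)) => [|x /andP[x_ge0 xx1]].
  by rewrite lt_min divr_gt0.
have [xx0|x0x] := leP x x0; last first.
  apply: (@le_trans _ _ (b y)); last by apply: Hy; rewrite in_itv/= ltW.
  apply: (@le_trans _ _ (b y * x)); first by rewrite ler_wpM2r// ge_min lexx orbT.
  rewrite ler_piMr ?(ltW by0)// (le_trans xx1)// ltW// (lt_trans x1ms)//.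
have x_le1 : x <= 1 by apply: (le_trans xx0); rewrite /x0 !ge_min lexx !orbT.
have xC : x <= a / (2 * C) by apply: (le_trans xx0); rewrite /x0 !ge_min lexx !orbT.
apply: (@le_trans _ _ (a / 2 * x)); first by rewrite ler_wpM2r// ge_min lexx.
have [|+ _] := HC x; first by rewrite ger0_norm.
rewrite /remainder ler_norml => /andP[+ _]; rewrite ger0_norm//.
have : C * x ^+ 3 <= a / 2 * x.
  have -> : C * x ^+ 3 = (C * x) * x * x by ring.
  rewrite ler_wpM2r//; apply: (@le_trans _ _ (C * x)).
    by rewrite ler_piMr// mulr_ge0// ltW.
  rewrite mulrC -ler_pdivlMr// (le_trans xC)//.
  by rewrite invfM mulrA.
by lra.
Qed.

End Drift.

Section LinearizingCoordinate.
Context {R : realType} (beta mstar x1 : R).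
Hypothesis hbeta : 1 < beta.
Hypothesis hmstar : is_mstar beta mstar.
Hypothesis hx1 : 0 < x1 < mstar.

Local Notation a := (growth beta).
Local Notation b := (drift beta).
Local Notation Q := (remainder beta).
Local Notation mu := (@lebesgue_measure R).

Let k (x : R) : R := Q x / (a * x * b x).
Let K := Kconst beta.
Let a0 : 0 < a := growth_gt0 hbeta.

Let x1_gt0 : 0 < x1. Proof. by case/andP: hx1. Qed.
Let x1_lt1 : x1 < 1.
Proof. by have [/andP[_ ms1] _] := hmstar; case/andP: hx1 => _ /lt_trans; apply. Qed.

(** Division by zero gives 0, which is also the limit of the integrand at 0; the formula is thus
    continuous there as it stands. *)
Let k0 : k 0 = 0. Proof. by rewrite /k mulr0 mul0r invr0 mulr0. Qed.

Let cubic := remainder_cubic beta.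
Let lower := drift_lower hbeta hmstar hx1.

Lemma integrand_linear_bound : exists2 C, 0 < C & forall x, 0 <= x <= x1 -> `|k x| <= C * x.
Proof.
have [C C0 HC] := cubic; have [c c0 Hc] := lower.
have C'0 : 0 < C / (a * c) by rewrite divr_gt0// mulr_gt0.
exists (C / (a * c)) => // x /andP[x_ge0 xx1].
have [->|xN0] := eqVneq x 0; first by rewrite k0 normr0 mulr0.
have x0 : 0 < x by rewrite lt_def xN0.
have b0 : 0 < b x by apply: lt_le_trans (Hc x _); rewrite ?mulr_gt0 ?x_ge0.
have [|HQ _] := HC x; first by rewrite ger0_norm// (le_trans xx1)// ltW.
rewrite /k normrM normfV [X in _ / X]ger0_norm ?mulr_ge0 ?(ltW a0) ?(ltW b0)//.
rewrite ler_pdivrMr ?mulr_gt0//; apply: (le_trans HQ); rewrite ger0_norm//.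
have -> : C * x ^+ 3 = C / (a * c) * x * (a * x * (c * x)).
  by field; rewrite !gt_eqF.
rewrite ler_wpM2l ?(mulr_ge0 (ltW C'0))//.
by rewrite ler_wpM2l ?mulr_ge0 ?(ltW a0)// Hc// x_ge0.
Qed.

(** Continuity at 0 is two-sided, whereas [drift_lower] covers only nonnegative arguments; there the
    drift is bounded below directly from the cubic remainder. *)
Lemma continuous_integrand x : 0 <= x <= x1 -> {for x, continuous k}.
Proof.
move=> /andP[x_ge0 xx1]; have [->|xN0] := eqVneq x 0; last first.
  have x0 : 0 < x by rewrite lt_def xN0.
  have [c c0 Hc] := lower.
  have b0 : 0 < b x by apply: lt_le_trans (Hc x _); rewrite ?mulr_gt0 ?x_ge0.
  have db := is_derive_drift beta x.
  have dax := is_deriveZf a (is_derive_idf x).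
  have den : a * x * b x != 0 by rewrite !mulf_neq0// gt_eqF.
  exact: (is_derive_continuous (is_deriveMf (is_deriveBf db dax)
    (is_deriveVf (g := fun y => a * y * b y) den (is_deriveMf dax db)))).
have [C C0 HC] := cubic.
pose C' := C / (a * (a / 2)); have C'0 : 0 < C'.
  by rewrite divr_gt0// mulr_gt0// divr_gt0.
apply/cvgrPdist_le => eps eps0; rewrite k0; near=> y.
rewrite sub0r normrN.
have [->|yN0] := eqVneq y 0; first by rewrite k0 normr0 ltW.
have y1 : `|y| <= 1 by near: y; apply: (cvgr0Pnorm_le _).1 => //; exact: cvg_id.
have yC : `|y| <= a / (2 * C).
  near: y; apply: (cvgr0Pnorm_le _).1; first exact: cvg_id.
  by rewrite divr_gt0// mulr_gt0.
have ye : `|y| <= eps / C'.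
  near: y; apply: (cvgr0Pnorm_le _).1; first exact: cvg_id.
  by rewrite divr_gt0.
have ny0 : 0 < `|y| by rewrite normr_gt0.
have [HQ _] := HC y y1.
have blow : a / 2 * `|y| <= `|b y|.
  have : `|a * y| - `|b y| <= `|Q y|.
    rewrite -[leRHS]normrN (_ : - Q y = a * y - b y); last by rewrite /remainder; ring.
    exact: lerB_dist.
  rewrite normrM (gtr0_norm a0).
  have : C * `|y| ^+ 3 <= a / 2 * `|y|.
    have -> : C * `|y| ^+ 3 = (C * `|y|) * `|y| * `|y| by ring.
    rewrite ler_wpM2r//; apply: (@le_trans _ _ (C * `|y|)).
      by rewrite ler_piMr// mulr_ge0// ltW.
    by rewrite mulrC -ler_pdivlMr// (le_trans yC)// invfM mulrA.
  by lra.
have b0 : 0 < `|b y| by apply: lt_le_trans blow; rewrite mulr_gt0// divr_gt0.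
apply: (@le_trans _ _ (C' * `|y|)); last by rewrite mulrC -ler_pdivlMr.
rewrite /k normrM normfV !normrM (gtr0_norm a0).
rewrite ler_pdivrMr ?mulr_gt0//; apply: (le_trans HQ).
have -> : C * `|y| ^+ 3 = C' * `|y| * (a * `|y| * (a / 2 * `|y|)).
  by rewrite /C'; field; rewrite gt_eqF.
rewrite ler_wpM2l ?(mulr_ge0 (ltW C'0))//.
by rewrite ler_wpM2l ?mulr_ge0 ?(ltW a0).
Unshelve. all: by end_near. Qed.

Let integrable_k x : 0 <= x <= x1 -> mu.-integrable `[0, x] (EFin \o k).
Proof.
move=> /andP[x0 xx1]; apply: continuous_compact_integrable; first exact: segment_compact.
apply: continuous_in_subspaceT => y; rewrite inE/= in_itv/= => /andP[y0 yx].
by apply: continuous_integrand; rewrite y0 (le_trans yx).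
Qed.

Lemma is_derive_Kconst x : 0 < x < x1 -> is_derive x 1 K (- k x).
Proof.
move=> /andP[x0 xx1].
have [||dF F'] := @continuous_FTC1_closed R k 0 x x1 xx1 _ x0.
- by apply: integrable_k; rewrite lexx (ltW x1_gt0).
- by apply: continuous_integrand; rewrite !ltW.
have dF' : is_derive x 1 (fun x => \int[mu]_(t in `[0, x]) k t)%R (k x).
  by apply: DeriveDef; [exact: dF|rewrite -derive1E; exact: F'].
exact: (is_deriveNf dF').
Qed.

Lemma Kconst_linear_bound : exists2 C, 0 < C & forall x, 0 <= x <= x1 ->
  `|K x| <= C * x.
Proof.
have [C C0 HC] := integrand_linear_bound.
exists C => // x /andP[x0 xx1].
rewrite /K /Kconst normrN.
have ik : mu.-integrable `[0, x] (EFin \o k) by apply: integrable_k; rewrite x0.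
apply: (le_trans (@le_normr_Rintegral _ _ _ mu _ k _ _)) => //.
apply: (@le_trans _ _ (\int[mu]_(t in `[0, x]) (cst C t))).
  apply: le_Rintegral => //.
  - have := integrable_norm ik; exact.
  - apply: continuous_compact_integrable; first exact: segment_compact.
    by apply: continuous_subspaceT => y; exact: cvg_cst.
  - move=> t; rewrite /= in_itv/= => /andP[t0 tx].
    apply: (le_trans (HC t _)); first by rewrite t0 (le_trans tx).
    by rewrite ler_piMr ?(ltW C0)// (le_trans tx)// (le_trans xx1)// ltW.
rewrite /cst Rintegral_cst//= lebesgue_measure_itv/= lte_fin.
case: ltP => [_|]; first by rewrite oppr0 addr0.
by move=> x_le0; rewrite mulr0 mulr_ge0 ?(ltW C0).
Qed.

End LinearizingCoordinate.

Section Psi.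
Context {R : realType} (beta : R).
Local Notation a := (growth beta).
Local Notation b := (drift beta).
Local Notation Q := (remainder beta).
Local Notation K := (Kconst beta).

(* The coordinate in which the flow of the drift is exactly linear:
   psi' * drift = growth * psi, with psi' = psi1. *)
Definition psi (x : R) : R := x * expR (a * K `|x|).
Definition psi1 (x : R) : R :=
  if x == 0 then 1 else expR (a * K `|x|) * (a * x / b x).

Lemma psiN x : psi (- x) = - psi x.
Proof. by rewrite /psi normrN mulNr. Qed.

Lemma psi0 : psi 0 = 0.
Proof. by rewrite /psi mul0r. Qed.

Lemma psi1_norm x : psi1 `|x| = psi1 x.
Proof.
rewrite /psi1 normr_eq0 normr_id; case: ifPn => // x0; congr (_ * _).
have [x_ge0|x_lt0] := leP 0 x; first by rewrite ger0_norm.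
by rewrite ltr0_norm// driftN mulrN invrN mulrNN.
Qed.

Hypothesis hbeta : 1 < beta.
Variables (mstar x1 : R).
Hypothesis hmstar : is_mstar beta mstar.
Hypothesis hx1 : 0 < x1 < mstar.

Let a0 : 0 < a := growth_gt0 hbeta.
Let x1_gt0 : 0 < x1. Proof. by case/andP: hx1. Qed.
Let x1_lt1 : x1 < 1.
Proof. by have [/andP[_ ms1] _] := hmstar; case/andP: hx1 => _ /lt_trans; apply. Qed.
Let E (x : R) : R := expR (a * K x).

Let b_gt0 x : 0 < x <= x1 -> 0 < b x.
Proof.
move=> /andP[x0 xx1]; apply: (drift_gt0 hmstar); rewrite x0 (le_lt_trans xx1)//.
by case/andP: hx1.
Qed.

Lemma drift_psi1 x : `|x| <= x1 -> b x * psi1 x = a * psi x.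
Proof.
move=> xx1; rewrite /psi1 /psi; case: eqVneq => [->|xN0].
  by rewrite drift0 !mul0r mulr0.
have bN0 : b x != 0.
  have : b `|x| != 0 by rewrite gt_eqF// b_gt0// xx1 normr_gt0 xN0.
  have [x_ge0|x_lt0] := leP 0 x; first by rewrite ger0_norm.
  by rewrite ltr0_norm// driftN oppr_eq0.
by field.
Qed.

Lemma Kexp_bound : exists2 C, 1 <= C & forall x, 0 <= x <= x1 ->
  [/\ C^-1 <= E x, E x <= C & `|E x - 1| <= C * x].
Proof.
have [C C0 HC] := Kconst_linear_bound hbeta hmstar hx1.
(* One constant for the three bounds: [exp (a C)] for the first two, and [a C exp (a C)] from the
   mean value estimate for the last. *)
pose C' := (a * C + 1) * expR (a * C).
have aC0 : 0 < a * C by rewrite mulr_gt0.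
have C'1 : expR (a * C) <= C' by rewrite ler_peMl ?expR_ge0// lerDr ltW.
exists C' => [|x xx1]; first by apply: le_trans C'1; rewrite -expR0 ler_expR ltW.
have /andP[x_ge0 x_le] := xx1.
have aK : `|a * K x| <= a * C * x.
  by rewrite normrM (gtr0_norm a0) -mulrA ler_wpM2l ?(ltW a0)// HC.
have aK' : `|a * K x| <= a * C.
  by rewrite (le_trans aK)// ler_piMr ?(ltW aC0)// (le_trans x_le)// ltW.
have /andP[aK1 aK2] : - (a * C) <= a * K x <= a * C by rewrite -ler_norml.
have C'0 : 0 < C' by rewrite mulr_gt0 ?expR_gt0// ltr_wpDl// ltW.
split.
- apply: (@le_trans _ _ (expR (a * C))^-1); last by rewrite -expRN ler_expR.
  by rewrite lef_pV2 ?posrE ?expR_gt0.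
- by apply: le_trans C'1; rewrite ler_expR.
- have := @mean_value_bound R expR expR 0 (a * K x) (expR (a * C)).
  rewrite expR0 subr0 => H; apply: le_trans (H _ _) _ => [u|].
  + rewrite ger0_norm ?expR_ge0// ler_expR => /andP[_ /le_trans]; apply.
    by rewrite ge_max aK2 ltW.
  + apply: (@le_trans _ _ (expR (a * C) * (a * C * x))).
      by rewrite ler_wpM2l ?expR_ge0.
    rewrite /C' mulrA [_ * (a * C)]mulrC ler_wpM2r// ler_wpM2r ?expR_ge0//.
    by rewrite lerDl.
Qed.

Let psi1E x : 0 < x -> psi1 x = E x * (a * x / b x).
Proof. by move=> x0; rewrite /psi1 (gt_eqF x0) (gtr0_norm x0). Qed.

(** On positive arguments [psi1] is [E] times [g = a x / b], with bounded derivative. The point 0,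
    where the value 1 is the limit of this product, is compared separately, and evenness extends the
    bound to all signs. *)
Lemma psi1_lipschitz : exists2 C, 0 < C & forall x y,
  `|x| < x1 -> `|y| < x1 -> `|psi1 x - psi1 y| <= C * `|x - y|.
Proof.
have [Ce Ce1 HE] := Kexp_bound.
have [Ck Ck0 Hk] := integrand_linear_bound hbeta hmstar hx1.
have [Cq Cq0 Hq] := remainder_cubic beta.
have [c c0 Hc] := drift_lower hbeta hmstar hx1.
have Ce0 : 0 < Ce by exact: lt_le_trans Ce1.
pose k x := Q x / (a * x * b x).
pose g x := a * x / b x.
pose g1 x := a * (b x - x * drift1 beta x) / b x ^+ 2.
have bpos x : 0 < x < x1 -> 0 < b x by move=> /andP[? ?]; apply: b_gt0; rewrite ltW// andbT.
have x_le1 x : 0 < x < x1 -> `|x| <= 1.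
  by move=> /andP[? ?]; rewrite gtr0_norm// ltW// (lt_trans _ x1_lt1).
have g_le x : 0 < x < x1 -> 0 <= g x <= a / c.
  move=> xx1; have /andP[x0 xlt] := xx1; have := bpos x xx1 => bx.
  rewrite /g divr_ge0 ?mulr_ge0 ?(ltW a0) ?(ltW x0) ?(ltW bx)//=.
  rewrite ler_pdivrMr// mulrAC ler_pdivlMr// -mulrA ler_wpM2l ?(ltW a0)// mulrC.
  by rewrite Hc// !ltW.
have g_near1 x : 0 < x < x1 -> `|g x - 1| <= Cq / c * x.
  move=> xx1; have /andP[x0 xlt] := xx1; have := bpos x xx1 => bx.
  have [HQ _] := Hq x (x_le1 _ xx1).
  have -> : g x - 1 = - Q x / b x by rewrite /g /remainder; field; rewrite gt_eqF.
  rewrite normrM normfV normrN (gtr0_norm bx) ler_pdivrMr// (le_trans HQ)//.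
  rewrite (gtr0_norm x0); apply: (@le_trans _ _ (Cq / c * x * (c * x))).
    have -> : Cq / c * x * (c * x) = Cq * x ^+ 2 by field; rewrite gt_eqF.
    rewrite ler_wpM2l ?(ltW Cq0)// exprSr ler_piMr ?exprn_ge0 ?(ltW x0)//.
    by have := x_le1 _ xx1; rewrite gtr0_norm.
  rewrite ler_wpM2l ?Hc ?(ltW x0) ?(ltW xlt)//.
  by rewrite mulr_ge0 ?(ltW x0)// divr_ge0 ?(ltW Cq0) ?(ltW c0).
have g1_le x : 0 < x < x1 -> `|g1 x| <= a * (2 * Cq) / c ^+ 2.
  move=> xx1; have /andP[x0 xlt] := xx1; have := bpos x xx1 => bx.
  have [HQ Hd] := Hq x (x_le1 _ xx1).
  rewrite /g1 normrM normfV (gtr0_norm (exprn_gt0 2 bx)) ler_pdivrMr ?exprn_gt0//.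
  rewrite normrM (gtr0_norm a0).
  (* The linear terms cancel. Both remaining ones are cubic, more than enough against the
     denominator [b x ^ 2], which is at least [(c x) ^ 2]. *)
  have -> : b x - x * drift1 beta x = Q x - x * (drift1 beta x - a).
    by rewrite /remainder; ring.
  have : `|Q x - x * (drift1 beta x - a)| <= 2 * Cq * x ^+ 2.
    apply: (le_trans (ler_normB _ _)); rewrite normrM (gtr0_norm x0).
    rewrite (gtr0_norm x0) in HQ Hd.
    have x3 : x ^+ 3 <= x ^+ 2.
      rewrite exprSr ler_piMr ?exprn_ge0 ?(ltW x0)//.
      by have := x_le1 _ xx1; rewrite gtr0_norm.
    have : x * `|drift1 beta x - a| <= x * (Cq * x ^+ 2) by rewrite ler_wpM2l ?(ltW x0).
    have -> : x * (Cq * x ^+ 2) = Cq * x ^+ 3 by ring.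
    have : Cq * x ^+ 3 <= Cq * x ^+ 2 by rewrite ler_wpM2l ?(ltW Cq0).
    by lra.
  move=> H; apply: (@le_trans _ _ (a * (2 * Cq * x ^+ 2))).
    by rewrite ler_wpM2l ?(ltW a0).
  have -> : a * (2 * Cq * x ^+ 2) = a * (2 * Cq) / c ^+ 2 * (c * x) ^+ 2.
    by field; rewrite gt_eqF.
  rewrite ler_wpM2l ?divr_ge0 ?mulr_ge0 ?exprn_ge0 ?(ltW a0) ?(ltW Cq0) ?(ltW c0)//.
  by rewrite ler_sqr ?nnegrE ?mulr_ge0 ?(ltW x0) ?(ltW c0) ?(ltW bx)// Hc// !ltW.
have dpsi1 x : 0 < x < x1 ->
    is_derive x 1 (fun y => E y * g y) (a * (- k x) * E x * g x + E x * g1 x).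
  move=> xx1; have /andP[x0 xlt] := xx1; have := bpos x xx1 => bx.
  have dK := is_derive_Kconst hbeta hmstar hx1 xx1.
  have db := is_derive_drift beta x.
  have bN0 : b x != 0 by rewrite gt_eqF.
  apply: (is_deriveE (is_deriveMf (is_derive_expf (is_deriveZf a dK))
     (is_deriveMf (is_deriveZf a (is_derive_idf x)) (is_deriveVf bN0 db)))).
  by rewrite /g /g1 /E /k; field; rewrite bN0 !gt_eqF.
pose C1 := a * Ck * Ce * (a / c) + Ce * (a * (2 * Cq) / c ^+ 2).
have C10 : 0 < C1 by rewrite addr_gt0 ?mulr_gt0 ?invr_gt0 ?mulr_gt0 ?exprn_gt0.
have posC x y : 0 < x < x1 -> 0 < y < x1 -> `|psi1 x - psi1 y| <= C1 * `|x - y|.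
  move=> xx1 yx1; rewrite !psi1E; [|by case/andP: yx1|by case/andP: xx1].
  have sub u : Num.min y x <= u <= Num.max y x -> 0 < u < x1.
    move=> /andP[u1 u2]; case/andP: xx1 => ? ?; case/andP: yx1 => ? ?.
    apply/andP; split; first by rewrite (lt_le_trans _ u1)// lt_min; apply/andP.
    by rewrite (le_lt_trans u2)// gt_max; apply/andP.
  apply: (@mean_value_bound R (fun y => E y * g y)
      (fun x => a * (- k x) * E x * g x + E x * g1 x)) => u /sub ux1.
    exact: dpsi1.
  have u01 : 0 <= u <= x1 by case/andP: ux1 => ? ?; rewrite !ltW.
  have [_ HE2 _] := HE u u01.
  rewrite (le_trans (ler_normD _ _))// lerD//.
    have /andP[g_ge0 gle] := g_le u ux1.
    rewrite normrM (ger0_norm g_ge0) normrM (ger0_norm (expR_ge0 _)) normrM.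
    rewrite (gtr0_norm a0) normrN.
    have Eu0 : 0 <= E u by exact: expR_ge0.
    have ak0 : 0 <= a * `|k u| by rewrite mulr_ge0// ltW.
    apply: ler_pM => //; first by rewrite mulr_ge0.
    apply: ler_pM => //; rewrite ler_wpM2l ?(ltW a0)//.
    apply: (le_trans (Hk u u01)); rewrite ler_piMr ?(ltW Ck0)//.
    by have := x_le1 _ ux1; case/andP: ux1 => u0 _; rewrite gtr0_norm.
  by rewrite normrM (ger0_norm (expR_ge0 _)) ler_pM ?expR_ge0// g1_le.
pose C2 := Ce * (Cq / c) + Ce.
have C20 : 0 < C2 by rewrite addr_gt0 ?mulr_gt0 ?invr_gt0.
have zeroC x : 0 < x < x1 -> `|psi1 x - 1| <= C2 * x.
  move=> xx1; have /andP[x0 xlt] := xx1; rewrite psi1E//.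
  have x01 : 0 <= x <= x1 by rewrite !ltW.
  have [_ HE2 HE3] := HE x x01.
  have -> : E x * (a * x / b x) - 1 = E x * (g x - 1) + (E x - 1) by rewrite /g; ring.
  rewrite (le_trans (ler_normD _ _))// mulrDl lerD// normrM (ger0_norm (expR_ge0 _)).
  by rewrite -mulrA ler_pM ?expR_ge0// g_near1.
exists (C1 + C2); first by rewrite addr_gt0.
move=> x y xx1 yx1; rewrite -(psi1_norm x) -(psi1_norm y).
apply: (@le_trans _ _ ((C1 + C2) * `| `|x| - `|y| |)); last first.
  by rewrite ler_wpM2l ?(addr_ge0 (ltW C10) (ltW C20))// ler_dist_dist.
move: xx1 yx1 (normr_ge0 x) (normr_ge0 y); move: `|x| `|y| => u v ux1 vx1 u0 v0.
have psi10 : psi1 0 = 1 by rewrite /psi1 eqxx.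
have [->|uN0] := eqVneq u 0; have [->|vN0] := eqVneq v 0.
- by rewrite !subrr normr0 mulr0.
- have v_gt0 : 0 < v by rewrite lt_def vN0.
  rewrite psi10 sub0r normrN distrC (le_trans (zeroC v _)) ?v_gt0//.
  by rewrite (gtr0_norm v_gt0) ler_wpM2r// lerDr ltW.
- have u_gt0 : 0 < u by rewrite lt_def uN0.
  rewrite psi10 subr0 (le_trans (zeroC u _)) ?u_gt0//.
  by rewrite (gtr0_norm u_gt0) ler_wpM2r// lerDr ltW.
- have u_gt0 : 0 < u by rewrite lt_def uN0.
  have v_gt0 : 0 < v by rewrite lt_def vN0.
  rewrite (le_trans (posC u v _ _)) ?u_gt0 ?v_gt0//.
  by rewrite ler_wpM2r// lerDl ltW.
Qed.

(** A Lipschitz derivative suffices for a quadratic remainder. Differentiability is available only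
    away from 0, so pairs involving 0 or of opposite signs go through explicit estimates at 0.
    Multiplied by the rate [N] and the scale [sqrt N], a remainder of order [N ^ -2] leaves
    [1 / sqrt N]. *)
Lemma psi_taylor : exists2 C, 0 < C & forall x y,
  `|x| < x1 -> `|y| < x1 -> `|psi y - psi x - (y - x) * psi1 x| <= C * (y - x) ^+ 2.
Proof.
have [Cl Cl0 Hl] := psi1_lipschitz.
have [Ce Ce1 HE] := Kexp_bound.
have psi10 : psi1 0 = 1 by rewrite /psi1 eqxx.
pose C := 2 * (Cl + Ce).
have Ce0 : 0 < Ce by exact: lt_le_trans Ce1.
have C0 : 0 < C by rewrite mulr_gt0 ?addr_gt0.
have ClC : Cl <= C by rewrite /C; lra.
have CeC : Ce <= C by rewrite /C; lra.
have CC : Cl + Ce <= C by rewrite /C; lra.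
have psiE x : 0 <= x -> psi x = x * E x by move=> x0; rewrite /psi ger0_norm.
have near0 x : 0 <= x < x1 -> `|psi x - x| <= Ce * x ^+ 2.
  move=> /andP[x0 xx1]; have [|_ _ HE3] := HE x; first by rewrite x0 ltW.
  rewrite psiE// (_ : x * E x - x = x * (E x - 1)); last by ring.
  by rewrite normrM (ger0_norm x0) expr2 mulrCA ler_wpM2l.
have pos x y : 0 <= x < x1 -> 0 <= y < x1 ->
    `|psi y - psi x - (y - x) * psi1 x| <= (Cl + Ce) * (y - x) ^+ 2.
  move=> /andP[x0 xx1] /andP[y0 yx1].
  have [xE|xN0] := eqVneq x 0.
    rewrite xE psi10 psi0 !subr0 mulr1 (le_trans (near0 y _)) ?y0//.
    by rewrite ler_wpM2r ?sqr_ge0// lerDr ltW.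
  have xgt0 : 0 < x by rewrite lt_def xN0.
  have [yE|yN0] := eqVneq y 0.
    rewrite yE psi0 !sub0r mulNr opprK sqrrN.
    rewrite (_ : - psi x + x * psi1 x = - (psi x - x) + x * (psi1 x - psi1 0)); last first.
      by rewrite psi10; ring.
    rewrite (le_trans (ler_normD _ _))// normrN addrC [(Cl + Ce) * _]mulrDl lerD//.
      rewrite normrM (ger0_norm x0) expr2 mulrCA ler_wpM2l//.
      have := Hl x 0; rewrite subr0 (ger0_norm x0) normr0; apply=> //.
    by rewrite near0// x0.
  have ygt0 : 0 < y by rewrite lt_def yN0.
  have sub u : Num.min x y <= u <= Num.max x y -> 0 < u < x1.
    move=> /andP[u1 u2]; apply/andP; split.
      by rewrite (lt_le_trans _ u1)// lt_min xgt0.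
    by rewrite (le_lt_trans u2)// gt_max xx1.
  have btw u : Num.min x y <= u <= Num.max x y -> `|u - x| <= `|y - x|.
    have [xy|yx] := leP x y => /andP[u1 u2].
      by rewrite !ger0_norm ?subr_ge0// lerB.
    by rewrite distrC [leRHS]distrC !ger0_norm ?subr_ge0// ?lerB// ltW.
  pose f u := u * E u - (u - x) * psi1 x.
  have -> : psi y - psi x - (y - x) * psi1 x = f y - f x.
    by rewrite (psiE x)// (psiE y)// /f; move: (E x) (E y) (psi1 x) => *; ring.
  apply: (@le_trans _ _ (Cl * `|y - x| * `|y - x|)); last first.
    by rewrite -mulrA -expr2 real_normK ?num_real// ler_wpM2r ?sqr_ge0// lerDl ltW.
  apply: (@mean_value_bound R f (fun u => psi1 u - psi1 x)) => u um.
    have /andP[u0 ux1] := sub u um.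
    have dK := is_derive_Kconst hbeta hmstar hx1 (sub u um).
    have bN0 : b u != 0 by rewrite gt_eqF// b_gt0// u0 ltW.
    apply: (is_deriveE (is_deriveBf (is_deriveMf (is_derive_idf u)
       (is_derive_expf (is_deriveZf a dK)))
       (is_deriveMf (is_deriveBf (is_derive_idf u) (is_derive_cstf x u))
          (is_derive_cstf (psi1 x) u)))).
    by rewrite (psi1E u0) /E /remainder; field; rewrite bN0 !gt_eqF.
  have /andP[u0 ux1] := sub u um.
  have := Hl u x; rewrite (gtr0_norm u0) (gtr0_norm xgt0) => /(_ ux1 xx1)/le_trans.
  by apply; rewrite ler_wpM2l ?(ltW Cl0)// btw.
have psi1N u : psi1 (- u) = psi1 u by rewrite -psi1_norm normrN psi1_norm.
have mixed x y : 0 <= x < x1 -> 0 <= - y < x1 ->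
    `|psi y - psi x - (y - x) * psi1 x| <= C * (y - x) ^+ 2.
  move=> xx y_; have /andP[x0 xlt] := xx; have /andP[y0 ylt] := y_.
  have h1 := pos 0 (- y) _ y_; rewrite lexx x1_gt0 psi0 psi10 !subr0 mulr1 in h1.
  have {}h1 := h1 isT; rewrite psiN sqrrN -opprD normrN in h1.
  have h2 := pos x 0 xx; rewrite lexx x1_gt0 psi0 !sub0r mulNr opprK sqrrN in h2.
  have {}h2 := h2 isT.
  have h3 : `|psi1 0 - psi1 x| <= Cl * x.
    by have := Hl 0 x; rewrite sub0r normrN normr0 (ger0_norm x0); apply.
  have -> : psi y - psi x - (y - x) * psi1 x =
     (psi y - y) + (- psi x + x * psi1 x) + y * (psi1 0 - psi1 x).
    by rewrite psi10; move: (psi x) (psi y) (psi1 x) => *; ring.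
  rewrite (le_trans (ler_normD _ _))//.
  have h4 : `|y * (psi1 0 - psi1 x)| <= (- y) * (Cl * x).
    by rewrite normrM -normrN (ger0_norm y0) ler_wpM2l.
  have h5 : (Cl + Ce) * (- y * x) >= Cl * (- y * x).
    by rewrite ler_wpM2r ?mulr_ge0// lerDl ltW.
  apply: (@le_trans _ _ ((Cl + Ce) * y ^+ 2 + (Cl + Ce) * x ^+ 2 + (Cl + Ce) * (- y * x))).
    apply: lerD; first by apply: (le_trans (ler_normD _ _)); exact: lerD.
    by apply: (le_trans h4); apply: le_trans h5; rewrite mulrCA.
  (* For opposite signs [- y * x] is nonnegative, so [(y - x) ^ 2] dominates the two squares and the
     mixed product together. *)
  rewrite -!mulrDr; apply: (@le_trans _ _ ((Cl + Ce) * (y - x) ^+ 2)).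
    rewrite ler_wpM2l ?addr_ge0 ?(ltW Cl0) ?(ltW Ce0)//.
    have := mulr_ge0 y0 x0; rewrite sqrrB; lra.
  by rewrite ler_wpM2r ?sqr_ge0.
exists C => // x y xx1 yx1.
have [x0|x0] := leP 0 x; have [y0|y0] := leP 0 y.
- rewrite ger0_norm// in xx1; rewrite ger0_norm// in yx1.
  apply: (le_trans (pos x y _ _)); rewrite ?x0 ?y0//.
  by rewrite ler_wpM2r ?sqr_ge0.
- rewrite ger0_norm// in xx1; rewrite ltr0_norm// in yx1.
  by apply: mixed; rewrite ?x0 ?xx1// yx1 andbT oppr_ge0 ltW.
- rewrite ltr0_norm// in xx1; rewrite ger0_norm// in yx1.
  have := mixed (- x) (- y); rewrite !psiN psi1N [- - y]opprK => H.
  rewrite -normrN -[(y - x) ^+ 2]sqrrN.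
  rewrite (_ : - (_ - _) = - psi y - - psi x - (- y - - x) * psi1 x); last first.
    by move: (psi x) (psi y) (psi1 x) => *; ring.
  rewrite (_ : - (y - x) = - y - - x); last by ring.
  by apply: H; rewrite ?y0 ?yx1// xx1 andbT oppr_ge0 ltW.
- rewrite ltr0_norm// in xx1; rewrite ltr0_norm// in yx1.
  have := pos (- x) (- y); rewrite !psiN psi1N => H.
  rewrite -normrN -[(y - x) ^+ 2]sqrrN.
  rewrite (_ : - (_ - _) = - psi y - - psi x - (- y - - x) * psi1 x); last first.
    by move: (psi x) (psi y) (psi1 x) => *; ring.
  rewrite (_ : - (y - x) = - y - - x); last by ring.
  apply: le_trans (H _ _) _; rewrite ?oppr_ge0 ?(ltW x0) ?(ltW y0)//.
  by rewrite ler_wpM2r ?sqr_ge0.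
Qed.

Lemma psi_facts : exists2 C, 1 <= C &
  [/\ forall x, `|x| < x1 -> `|psi1 x| <= C /\ `|psi1 x - 1| <= C * `|x|,
      forall x y, `|x| < x1 -> `|y| < x1 ->
        `|psi y - psi x - (y - x) * psi1 x| <= C * (y - x) ^+ 2,
      forall x, `|x| < x1 -> `|x| <= C * `|psi x| &
      forall x, `|x| < x1 -> `|psi x| <= C].
Proof.
have [C1 C10 H1] := psi1_lipschitz.
have [C2 C20 H2] := psi_taylor.
have [C3 C31 H3] := Kexp_bound.
have C30 : 0 < C3 by exact: lt_le_trans C31.
have psi10 : psi1 0 = 1 by rewrite /psi1 eqxx.
have N1 x : `|x| < x1 -> `|psi1 x - 1| <= C1 * `|x|.
  by move=> xx1; have := H1 x 0; rewrite psi10 subr0 normr0; apply.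
have psi_norm x : `|psi x| = `|x| * E `|x|.
  by rewrite /psi normrM [X in _ * X]ger0_norm ?expR_ge0.
exists (1 + C1 + C2 + C3); first by lra.
split.
- move=> x xx1; have := N1 x xx1; have := normr_ge0 x => x0 H; split.
    have : `|psi1 x| <= `|psi1 x - 1| + `|1| by rewrite -{1}[psi1 x](subrK 1) ler_normD.
    rewrite normr1.
    have : C1 * `|x| <= C1 by rewrite ler_piMr ?(ltW C10)// ltW// (lt_trans xx1).
    by lra.
  by apply: (le_trans H); rewrite ler_wpM2r//; lra.
- move=> x y xx1 yx1; apply: (le_trans (H2 x y xx1 yx1)).
  by rewrite ler_wpM2r ?sqr_ge0//; lra.
- move=> x xx1; rewrite psi_norm.
  have [|h1 _ _] := H3 `|x|; first by rewrite normr_ge0 ltW.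
  rewrite mulrCA ler_peMr//; apply: (@le_trans _ _ (C3 * E `|x|)).
    by rewrite mulrC -ler_pdivrMr// div1r.
  by rewrite ler_wpM2r ?expR_ge0//; lra.
- move=> x xx1; rewrite psi_norm.
  have [|_ h1 _] := H3 `|x|; first by rewrite normr_ge0 ltW.
  apply: (@le_trans _ _ (1 * C3)); last by lra.
  by apply: ler_pM => //; [exact: expR_ge0|rewrite ltW// (lt_trans xx1)].
Qed.

End Psi.

(** * The normal distribution function *)

Section NormalCdf.
Context {R : realType}.
Local Notation mu := (@lebesgue_measure R).

Definition ncdf (x : R) : R := fine (normal_prob 0 1 `]-oo, x]).
Definition npdf (x : R) : R := normal_peak 1 * expR (- (x ^+ 2 / 2)).

Lemma normal_pdfE01 : normal_pdf 0 1 = npdf.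
Proof.
apply/funext => x; rewrite normal_pdfE ?oner_neq0// /npdf /normal_fun subr0 expr1n.
by rewrite mulNr.
Qed.

Lemma ncdf_EFin x : (ncdf x)%:E = normal_prob 0 1 `]-oo, x].
Proof. by rewrite /ncdf fineK// fin_num_measure. Qed.

Lemma ncdf_ge0 x : 0 <= ncdf x.
Proof. by rewrite fine_ge0. Qed.

Lemma ncdf_le1 x : ncdf x <= 1.
Proof. by rewrite -lee_fin ncdf_EFin probability_le1. Qed.

Lemma npdf_ge0 x : 0 <= npdf x.
Proof. by rewrite mulr_ge0 ?normal_peak_ge0 ?expR_ge0. Qed.

Lemma is_derive_ncdf (x : R) : is_derive x 1 ncdf (npdf x).
Proof.
have intf : mu.-integrable `]-oo, x + 1] (EFin \o npdf).
  rewrite -normal_pdfE01; apply: (integrableS _ _ (@subsetT _ _)) => //.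
  exact: integrable_normal_pdf.
have lt1 : x < x + 1 by rewrite ltrDl.
have cpdf : continuous npdf.
  by rewrite -normal_pdfE01; apply: continuous_normal_pdf; exact: oner_neq0.
have [dF F'] := @continuous_FTC1 R npdf -oo%O x (x + 1) lt1 intf (ltNyr _) (cpdf x).
have -> : ncdf = fun y => \int[mu]_(t in `]-oo, y]) npdf t.
  by apply/funext => y; rewrite /ncdf /normal_prob normal_pdfE01.
by apply: DeriveDef; [exact: dF|rewrite -derive1E; exact: F'].
Qed.

Lemma is_derive_npdf (x : R) : is_derive x 1 npdf (- x * npdf x).
Proof.
apply: (is_deriveE (is_deriveZf (normal_peak 1) (is_derive_expf (is_deriveNf
  (is_deriveMf (is_derive_sqrf (is_derive_idf x)) (is_derive_cstf 2^-1 x)))))).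
by rewrite /npdf; field.
Qed.

Lemma is_derive_npdf1 (x : R) :
  is_derive x 1 (fun y => - y * npdf y) ((x ^+ 2 - 1) * npdf x).
Proof.
apply: (is_deriveE (is_deriveMf (is_deriveNf (is_derive_idf x)) (is_derive_npdf x))).
by ring.
Qed.

Lemma normal_peak1_le1 : normal_peak 1 <= 1 :> R.
Proof.
have h : 1 <= pi *+ 2 :> R by have := @pi_ge2 R; rewrite -mulr_natr; lra.
have h0 : 0 < pi *+ 2 :> R by exact: lt_le_trans h.
rewrite /normal_peak expr1n mul1r invf_le1 ?sqrtr_gt0//.
by rewrite -[leLHS]sqrtr1 ler_sqrt ?(ltW h0).
Qed.

(** From [1 + u <= exp u] at [u = x ^ 2 / 2]. The first two derivatives of [npdf] are [npdf] times
    polynomials dominated by [1 + x ^ 2], so this single bound, whose constant is not sharp, serves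
    for all three. *)
Lemma npdf_quad_bound x : (1 + x ^+ 2) * npdf x <= 3.
Proof.
have e0 := expR_ge0 (- (x ^+ 2 / 2)).
have x0 := sqr_ge0 x.
have : 1 + x ^+ 2 / 2 <= expR (x ^+ 2 / 2) by exact: expR_ge1Dx.
rewrite -[expR (x ^+ 2 / 2)]invrK -expRN => H.
have epos := expR_gt0 (- (x ^+ 2 / 2)).
have {}H : (1 + x ^+ 2 / 2) * expR (- (x ^+ 2 / 2)) <= 1.
  by rewrite -ler_pdivlMr// div1r.
apply: (@le_trans _ _ ((1 + x ^+ 2) * expR (- (x ^+ 2 / 2)))).
  rewrite /npdf ler_wpM2l ?addr_ge0// ler_piMl//; exact: normal_peak1_le1.
have : (1 + x ^+ 2) * expR (- (x ^+ 2 / 2)) <= 2 * ((1 + x ^+ 2 / 2) * expR (- (x ^+ 2 / 2))).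
  rewrite mulrA ler_wpM2r//; lra.
by lra.
Qed.

Lemma npdf_le3 x : npdf x <= 3.
Proof.
apply: le_trans (npdf_quad_bound x); rewrite ler_peMl ?npdf_ge0// lerDl.
exact: sqr_ge0.
Qed.

Lemma npdf1_bound x : `|- x * npdf x| <= 3.
Proof.
rewrite normrM normrN (ger0_norm (npdf_ge0 _)); apply: le_trans (npdf_quad_bound x).
rewrite ler_wpM2r ?npdf_ge0// -real_normK ?num_real//.
have := sqr_ge0 (`|x| - 1); rewrite sqrrB expr1n mulr1; have := sqr_ge0 `|x|; lra.
Qed.

Lemma npdf2_bound x : `|(x ^+ 2 - 1) * npdf x| <= 3.
Proof.
rewrite normrM (ger0_norm (npdf_ge0 _)); apply: le_trans (npdf_quad_bound x).
rewrite ler_wpM2r ?npdf_ge0//; have x0 := sqr_ge0 x.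
by rewrite ler_norml; lra.
Qed.

Lemma ncdf_taylor x h :
  `|ncdf (x + h) - ncdf x - h * npdf x - h ^+ 2 / 2 * (- x * npdf x)| <= 3 * `|h| ^+ 3.
Proof.
exact: (taylor3_bound _ _ is_derive_ncdf is_derive_npdf is_derive_npdf1 npdf2_bound).
Qed.

Lemma ncdf_lipschitz x y : `|ncdf y - ncdf x| <= 3 * `|y - x|.
Proof.
apply: (@mean_value_bound R ncdf npdf) => u _; first exact: is_derive_ncdf.
by rewrite ger0_norm ?npdf_ge0// npdf_le3.
Qed.

Lemma ncdf_nondecreasing x y : x <= y -> ncdf x <= ncdf y.
Proof.
move=> xy; rewrite -lee_fin !ncdf_EFin le_measure ?inE//.
exact: subset_itvl.
Qed.

End NormalCdf.

(** * The generator in the scaled coordinate *)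

Section GeneratorEstimates.
Context {R : realType} (beta : R).
Hypothesis hbeta : 1 < beta.

Definition rate_up (n m : R) : R := n * ((1 - m) / 2) * expR (beta * m).
Definition rate_down (n m : R) : R := n * ((1 + m) / 2) * expR (- beta * m).

Lemma rate_bounds (n m : R) : 0 <= n -> `|m| <= 1 ->
  0 <= rate_up n m <= n * expR beta /\ 0 <= rate_down n m <= n * expR beta.
Proof.
move=> n0; rewrite ler_norml => /andP[m1 m2].
have b0 : 0 < beta by exact: lt_trans hbeta.
have e1 : expR (beta * m) <= expR beta by rewrite ler_expR ler_piMr// ltW.
have e2 : expR (- beta * m) <= expR beta.
  by rewrite ler_expR mulNr -mulrN ler_piMr ?(ltW b0)//; lra.
have q1 : 0 <= (1 - m) / 2 <= 1 by lra.
have q2 : 0 <= (1 + m) / 2 <= 1 by lra.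
case/andP: q1 => q10 q11; case/andP: q2 => q20 q21.
rewrite /rate_up /rate_down (mulr_ge0 (mulr_ge0 n0 q10) (expR_ge0 _)).
rewrite (mulr_ge0 (mulr_ge0 n0 q20) (expR_ge0 _)) /=.
by split; rewrite -mulrA ler_wpM2l// -[leRHS]mul1r ler_pM ?expR_ge0.
Qed.

(** The total jump rate is [n / 2] times this sum, whose value at [m = 0] is 2. The quadratic
    variation thus departs from its rate at 0 by a term of order [|m|]. *)
Lemma noise_lipschitz : exists2 C, 0 < C & forall m, `|m| <= 1 ->
  `|(1 - m) * expR (beta * m) + (1 + m) * expR (- beta * m) - 2| <= C * `|m|.
Proof.
pose S (m : R) : R := (-1 * m + 1) * expR (beta * m) + (1 * m + 1) * expR (- beta * m).
pose S1 (m : R) : R := (-1 + beta * (-1 * m + 1)) * expR (beta * m)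
  + (1 + - beta * (1 * m + 1)) * expR (- beta * m).
have dS (m : R) : is_derive m 1 S (S1 m).
  exact: (is_deriveDf (is_derive_affine_exp _ _ _ m) (is_derive_affine_exp _ _ _ m)).
have cS1 : continuous S1.
  move=> m.
  have -> : S1 = fun m => ((- beta) * m + (beta - 1)) * expR (beta * m)
     + ((- beta) * m + (1 - beta)) * expR (- beta * m).
    by apply/funext => u; rewrite /S1; ring.
  exact: (is_derive_continuous (is_deriveDf (is_derive_affine_exp _ _ _ m)
    (is_derive_affine_exp _ _ _ m))).
have [C C0 HC] := continuous_segment_bounded (-1) 1 cS1.
exists (C + 1) => [|m m1]; first by rewrite ltr_wpDl.
have -> : (1 - m) * expR (beta * m) + (1 + m) * expR (- beta * m) - 2 = S m - S 0.
  by rewrite /S !mulr0 expR0; ring.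
have := @mean_value_bound R S S1 0 m (C + 1); rewrite !subr0; apply=> u.
move=> /andP[u1 u2]; apply: (@le_trans _ _ C); last by rewrite lerDl.
apply: HC; move: m1; rewrite ler_norml => /andP[m1 m2].
apply/andP; split; [apply: le_trans u1|apply: (le_trans u2)].
  by rewrite le_min m1 andbT; lra.
by rewrite ge_max m2 andbT.
Qed.

End GeneratorEstimates.

(* [s] stands for the square root of the number of spins and [th] for
   exp (- a t); the increments of the scaled coordinate over the two
   transitions are [J (2 / s ^+ 2)] and [J (- (2 / s ^+ 2))]. *)
Lemma generator_moments (R : realType) (beta mstar x1 r : R) :
  1 < beta -> is_mstar beta mstar -> 0 < x1 < mstar -> 0 < r < x1 ->
  let a := growth beta in
  exists C s0, [/\ 0 < C, 1 <= s0 & forall s m th,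
  s0 <= s -> `|m| < r -> 0 < th <= 1 ->
  let z := th * s * Num.sqrt (a / 2) * psi beta m in
  let J h := th * s * Num.sqrt (a / 2) * (psi beta (m + h) - psi beta m) in
  let Jp := J (2 / s ^+ 2) in let Jm := J (- (2 / s ^+ 2)) in
  let Pp := rate_up beta (s ^+ 2) m in let Pm := rate_down beta (s ^+ 2) m in
  [/\ `|Pp * Jp + Pm * Jm - a * z| <= C * th / s,
      `|Pp * Jp ^+ 2 + Pm * Jm ^+ 2 - 2 * a * th ^+ 2| <= C * th / s * (1 + z ^+ 2) &
      Pp * `|Jp| ^+ 3 + Pm * `|Jm| ^+ 3 <= C * th / s]].
Proof.
move=> hbeta hmstar hx1 hr a.
have a0 : 0 < a by exact: growth_gt0.
have x1_lt1 : x1 < 1.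
  by have [/andP[_ ms1] _] := hmstar; case/andP: hx1 => _ /lt_trans; apply.
have [C C1 [Hp1 Hp2 Hp3 _]] := psi_facts hbeta hmstar hx1.
have [Cs Cs0 HS] := noise_lipschitz beta.
have C0 : 0 < C by exact: lt_le_trans C1.
pose kap := Num.sqrt (a / 2); rewrite -/kap.
have kap2 : kap ^+ 2 = a / 2 by rewrite sqr_sqrtr// divr_ge0// ltW.
have kap0 : 0 < kap by rewrite sqrtr_gt0 divr_gt0.
have [Eb EbE] : {y : R | y = expR beta} by exists (expR beta).
have Eb0 : 0 < Eb by rewrite EbE expR_gt0.
have [A1 A1E] : {y : R | y = 8 * kap * Eb * C} by eexists.
have [A2 A2E] : {y : R | y = 8 * 8 * kap ^+ 2 * Eb * C ^+ 2} by eexists.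
have [B BE] : {y : R | y = Cs * C ^+ 2 + 2 * (C * (C + 1))} by eexists.
have [A3 A3E] : {y : R | y = a * B * C / kap} by eexists.
have [A4 A4E] : {y : R | y = 2 * 27 * 8 * kap ^+ 3 * Eb * C ^+ 3} by eexists.
have A10 : 0 < A1 by rewrite A1E !mulr_gt0.
have A20 : 0 < A2 by rewrite A2E !mulr_gt0 ?exprn_gt0.
have B0 : 0 < B by rewrite BE addr_gt0 ?mulr_gt0 ?exprn_gt0 ?addr_gt0.
have A30 : 0 < A3 by rewrite A3E divr_gt0 ?mulr_gt0.
have A40 : 0 < A4 by rewrite A4E !mulr_gt0 ?exprn_gt0.
clearbody kap.
have xr0 : 0 < x1 - r by rewrite subr_gt0; case/andP: hr.
(* [A1] and [A4] bound the first and third moments; for the second, [A2] is the Taylor error and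
   [A3] the variation of the noise. The threshold on [s] makes a jump [2 / s ^ 2] shorter than
   [x1 - r], so both neighbours of [m] stay where [psi] is controlled. *)
exists (A1 + (A2 + A3) + A4), (1 + 2 / (x1 - r)); split.
- by rewrite !addr_gt0.
- by rewrite lerDl divr_ge0// ltW.
move=> s m th s_ge mr /andP[th0 th1] z J Jp Jm Pp Pm.
have s1 : 1 <= s by apply: le_trans s_ge; rewrite lerDl divr_ge0// ltW.
have s_gt0 : 0 < s by exact: lt_le_trans s1.
have sN0 : s != 0 by rewrite gt_eqF.
have [h hE] : {h | h = 2 / s ^+ 2} by eexists.
have s2_ge : s <= s ^+ 2 by rewrite expr2 ler_peMr// ltW.
have h0 : 0 < h by rewrite hE divr_gt0 ?exprn_gt0.
have h_lt : h < x1 - r.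
  rewrite hE ltr_pdivrMr ?exprn_gt0// mulrC -ltr_pdivrMr//.
  by apply: lt_le_trans s2_ge; apply: lt_le_trans s_ge; rewrite ltrDr.
have m_x1 : `|m| < x1 by apply: lt_trans mr _; case/andP: hr.
have m_1 : `|m| <= 1 by rewrite ltW// (lt_trans m_x1).
have mh e : `|e| = h -> `|m + e| < x1.
  move=> eh; apply: (le_lt_trans (ler_normD _ _)); rewrite eh.
  by move: mr h_lt; clear; lra.
have h2 : h <= 2 by rewrite hE ler_pdivrMr ?exprn_gt0// ler_peMr// exprn_ege1.
have [Hp Hpm] := Hp1 m m_x1.
pose p := psi1 beta m.
have n0 : 0 <= s ^+ 2 by rewrite exprn_ge0// ltW.
have [/andP[Pp0 Ppl] /andP[Pm0 Pml]] := rate_bounds hbeta n0 m_1.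
have PpE : Pp = rate_up beta (s ^+ 2) m by [].
have PmE : Pm = rate_down beta (s ^+ 2) m by [].
rewrite -PpE -EbE in Pp0 Ppl; rewrite -PmE -EbE in Pm0 Pml.
have Hrho e : `|e| = h -> `|psi beta (m + e) - psi beta m - e * p| <= C * h ^+ 2.
  move=> eh; have := Hp2 m (m + e) m_x1 (mh e eh).
  have -> : m + e - m = e by ring.
  by rewrite -[e ^+ 2]real_normK ?num_real// eh.
have hh : `|h| = h by rewrite gtr0_norm.
have hN : `|- h| = h by rewrite normrN.
have [s0 s0E] : {y : R | y = th * s * kap} by eexists.
have s00 : 0 < s0 by rewrite s0E !mulr_gt0.
have [Dp DpE] : {y : R | y = psi beta (m + h) - psi beta m} by eexists.
have [Dm DmE] : {y : R | y = psi beta (m + - h) - psi beta m} by exact: exist _ _ erefl.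
have Rp : `|Dp - h * p| <= C * h ^+ 2 by rewrite DpE; apply: Hrho.
have Rm : `|Dm - (- h) * p| <= C * h ^+ 2 by rewrite DmE; apply: Hrho.
have JpE : Jp = s0 * Dp by rewrite /Jp /J -hE -s0E -DpE.
have JmE : Jm = s0 * Dm by rewrite /Jm /J -hE -s0E -DmE.
have zE : z = s0 * psi beta m by rewrite /z -s0E.
have [q qE] : {y : R | y = p} by eexists.
have Hq : `|q| <= C by rewrite qE.
have Hqm : `|q - 1| <= C * `|m| by rewrite qE.
rewrite -qE in Rp Rm.
(* The linear Taylor terms therefore add up to exactly [a z], by [drift_psi1]; the first moment only
   retains Taylor remainders. *)
have Pdiff : h * (Pp - Pm) = drift beta m.
  by rewrite PpE PmE hE /rate_up /rate_down /drift; field.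
have bp : drift beta m * q = a * psi beta m by rewrite qE; apply: (drift_psi1 hmstar hx1); exact: ltW.
clearbody Jp Jm z Pp Pm; clear J Hrho Hp1 Hp2.
have hC e D : `|e| = h -> `|D - e * q| <= C * h ^+ 2 ->
    `|D| <= 3 * C * h /\ `|D ^+ 2 - h ^+ 2 * q ^+ 2| <= 4 * C ^+ 2 * h ^+ 3.
  move=> eh HD.
  have hCC : C * h ^+ 2 <= 2 * C * h.
    have -> : 2 * C * h = C * h * 2 by ring.
    by rewrite expr2 mulrA ler_wpM2l ?(mulr_ge0 (ltW C0) (ltW h0)).
  have ep : `|e * q| <= C * h by rewrite normrM eh mulrC ler_wpM2r ?(ltW h0).
  split.
    have : `|D| <= `|D - e * q| + `|e * q| by rewrite -{1}[D](subrK (e * q)) ler_normD.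
    by move: HD ep hCC; clear; lra.
  have -> : D ^+ 2 - h ^+ 2 * q ^+ 2 = (D - e * q) * (D - e * q + 2 * (e * q)).
    by rewrite -eh real_normK ?num_real//; ring.
  rewrite normrM.
  have -> : 4 * C ^+ 2 * h ^+ 3 = C * h ^+ 2 * (4 * C * h) by ring.
  rewrite ler_pM// (le_trans (ler_normD _ _))// [`|2 * _|]normrM normr_nat.
  by move: HD ep hCC; clear; lra.
have [Dp3 Dp2] := hC h Dp hh Rp.
have [Dm3 Dm2] := hC (- h) Dm hN Rm.
have thE : th ^+ 2 <= th by rewrite expr2 ler_piMr// ltW.
have wsum (u v K : R) : `|u| <= K -> `|v| <= K ->
    `|Pp * u + Pm * v| <= 2 * (s ^+ 2 * Eb * K).
  move=> uK vK; apply: (le_trans (ler_normD _ _)).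
  rewrite [`|Pp * u|]normrM [`|Pm * v|]normrM (ger0_norm (Pp0 : 0 <= Pp)).
  rewrite (ger0_norm (Pm0 : 0 <= Pm)) mulr_natl mulr2n.
  by apply: lerD; apply: ler_pM.
have C_ge : A1 <= A1 + (A2 + A3) + A4 /\ A2 + A3 <= A1 + (A2 + A3) + A4 /\
  A4 <= A1 + (A2 + A3) + A4.
  by move: A10 A20 A30 A40; clear=> *; split; [|split]; lra.
case: C_ge => CA1 [CA2 CA4].
have ths0 : 0 <= th / s by rewrite divr_ge0 ?(ltW th0) ?(ltW s_gt0).
have fin A (y : R) : A <= A1 + (A2 + A3) + A4 -> y <= A * (th / s) ->
    y <= (A1 + (A2 + A3) + A4) * th / s.
  by move=> AC yA; rewrite -mulrA (le_trans yA)// ler_wpM2r.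
split.
- apply: (fin A1) => //.
  have -> : Pp * Jp + Pm * Jm - a * z =
      s0 * (Pp * (Dp - h * q) + Pm * (Dm - (- h) * q)).
    have -> : a * z = s0 * (h * (Pp - Pm) * q) by rewrite zE Pdiff bp; ring.
    by rewrite JpE JmE; ring.
  rewrite normrM (gtr0_norm s00).
  have -> : A1 * (th / s) = s0 * (2 * (s ^+ 2 * Eb * (C * h ^+ 2))).
    by rewrite A1E s0E hE; field.
  by rewrite ler_wpM2l ?(ltW s00)// wsum.
- have z2 : 0 <= z ^+ 2 by exact: sqr_ge0.
  have -> : (A1 + (A2 + A3) + A4) * th / s * (1 + z ^+ 2) =
     (A1 + (A2 + A3) + A4) * (th * (1 + z ^+ 2) / s) by ring.
  apply: (@le_trans _ _ ((A2 + A3) * (th * (1 + z ^+ 2) / s))); last first.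
    rewrite ler_wpM2r// divr_ge0 ?mulr_ge0 ?addr_ge0 ?(ltW th0) ?(ltW s_gt0)//.
  pose S := (1 - m) * expR (beta * m) + (1 + m) * expR (- beta * m).
  (* The squared increments are compared with [h ^ 2 * q ^ 2]; what is left is [a * th ^ 2] times
     the deviation of [S * q ^ 2] from its value 2 at [m = 0]. *)
  have -> : Pp * Jp ^+ 2 + Pm * Jm ^+ 2 - 2 * a * th ^+ 2 =
      s0 ^+ 2 * (Pp * (Dp ^+ 2 - h ^+ 2 * q ^+ 2) + Pm * (Dm ^+ 2 - h ^+ 2 * q ^+ 2))
      + a * th ^+ 2 * (S * q ^+ 2 - 2).
    have -> : a * th ^+ 2 * (S * q ^+ 2 - 2) =
        s0 ^+ 2 * (Pp + Pm) * h ^+ 2 * q ^+ 2 - 2 * a * th ^+ 2.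
      have aE : a = 2 * kap ^+ 2 by rewrite kap2; field.
      rewrite aE.
      by rewrite s0E PpE PmE hE /rate_up /rate_down /S; field.
    by rewrite JpE JmE; ring.
  rewrite (le_trans (ler_normD _ _))// [leRHS]mulrDl lerD//.
    rewrite normrM (ger0_norm (sqr_ge0 _)).
    apply: (@le_trans _ _ (A2 * (th ^+ 2 / s ^+ 2))).
      have -> : A2 * (th ^+ 2 / s ^+ 2) = s0 ^+ 2 * (2 * (s ^+ 2 * Eb * (4 * C ^+ 2 * h ^+ 3))).
        by rewrite A2E s0E hE; field.
      by rewrite ler_wpM2l ?sqr_ge0// wsum.
    rewrite ler_wpM2l ?(ltW A20)// ler_pM ?invr_ge0 ?exprn_ge0 ?(ltW th0) ?(ltW s_gt0)//.
      by rewrite (le_trans thE)// ler_peMr ?(ltW th0)// lerDl.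
    by rewrite lef_pV2 ?posrE ?exprn_gt0.
  rewrite normrM (ger0_norm (mulr_ge0 (ltW a0) (sqr_ge0 _))).
  have HSp : `|S * q ^+ 2 - 2| <= B * `|m|.
    have -> : S * q ^+ 2 - 2 = (S - 2) * q ^+ 2 + 2 * ((q - 1) * (q + 1)) by ring.
    rewrite BE [leRHS]mulrDl (le_trans (ler_normD _ _))// lerD//.
      rewrite normrM normrX (mulrAC Cs) ler_pM//; first exact: HS.
      by rewrite lerXn2r ?nnegrE ?(ltW C0).
    rewrite normrM normr_nat -mulrA ler_wpM2l// normrM mulrAC ler_pM//.
    by rewrite (le_trans (ler_normD _ _))// normr1 lerD2r.
  (* That deviation is of order [|m|], which need not be small; but [|m|] is at most a multiple of
     [|psi m|], hence [th * |m|] of [|z| / s]. This is the origin of the weight [1 + z ^ 2]. *)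
  have mz : th * `|m| <= C / kap * ((1 + z ^+ 2) / s).
    have : th * `|m| <= th * (C * `|psi beta m|) by rewrite ler_wpM2l ?(ltW th0)// Hp3.
    have -> : th * (C * `|psi beta m|) = C / kap * (`|z| / s).
      rewrite zE [`|s0 * _|]normrM (gtr0_norm s00) s0E; field.
      by rewrite sN0 gt_eqF.
    move=> /le_trans; apply; rewrite ler_wpM2l ?divr_ge0 ?(ltW C0) ?(ltW kap0)//.
    rewrite ler_wpM2r ?invr_ge0 ?(ltW s_gt0)// -(real_normK (num_real z)).
    have := sqr_ge0 (`|z| - 1); rewrite sqrrB expr1n mulr1; have := sqr_ge0 `|z|.
    by clear; lra.
  apply: (@le_trans _ _ (a * th ^+ 2 * (B * `|m|))).
    by rewrite ler_wpM2l ?(mulr_ge0 (ltW a0) (sqr_ge0 _)).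
  have -> : a * th ^+ 2 * (B * `|m|) = (a * B * th) * (th * `|m|) by ring.
  have -> : A3 * (th * (1 + z ^+ 2) / s) = (a * B * th) * (C / kap * ((1 + z ^+ 2) / s)).
    by rewrite A3E; field; rewrite sN0 gt_eqF.
  by rewrite ler_wpM2l ?mulr_ge0 ?(ltW a0) ?(ltW B0) ?(ltW th0).
- apply: (fin A4) => //.
  have cube D : `|D| <= 3 * C * h -> `| `|s0 * D| ^+ 3| <= s0 ^+ 3 * (27 * C ^+ 3 * h ^+ 3).
    move=> HD; rewrite normrX normr_id normrM (gtr0_norm s00) exprMn.
    have -> : 27 * C ^+ 3 * h ^+ 3 = (3 * C * h) ^+ 3 by ring.
    rewrite ler_wpM2l ?exprn_ge0 ?(ltW s00)// lerXn2r ?nnegrE//.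
    by rewrite !mulr_ge0 ?(ltW C0) ?(ltW h0).
  have := wsum _ _ _ (cube _ Dp3) (cube _ Dm3).
  rewrite JpE JmE => /(le_trans (ler_norm _))/le_trans; apply.
  have -> : 2 * (s ^+ 2 * Eb * (s0 ^+ 3 * (27 * C ^+ 3 * h ^+ 3))) = A4 * (th ^+ 3 / s).
    by rewrite A4E s0E hE; field.
  rewrite ler_wpM2l ?(ltW A40)// ler_wpM2r ?invr_ge0 ?(ltW s_gt0)//.
  by rewrite exprS ler_piMr ?(ltW th0)// exprn_ile1 ?(ltW th0).
Qed.

(** * The spin-flip generator on functions of the magnetization *)

Section CurieWeissGenerator.
Context {R : realType} (beta : R) (N : nat).
Hypothesis N0 : (0 < N)%N.
Implicit Types x y : config N.

Local Notation M := (@magnetization R N).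
Local Notation n := (N%:R : R).

Let nN0 : n != 0. Proof. by rewrite pnatr_eq0 -lt0n. Qed.

Lemma sum_spin x : \sum_(i < N) spin R (x i) = n * M x.
Proof. by rewrite /magnetization mulrA divff// mul1r. Qed.

Lemma magnetization_flip (i : 'I_N) x :
  M (flip i x) = M x - 2 / n * spin R (x i).
Proof.
rewrite /magnetization (bigD1 i)//= [in RHS](bigD1 i)//=.
rewrite /flip ffunE eqxx.
have -> : \sum_(j < N | j != i) spin R ([ffun j => if j == i then ~~ x j else x j] j) =
    \sum_(j < N | j != i) spin R (x j).
  by apply: eq_bigr => j ji; rewrite ffunE (negbTE ji).
by case: (x i) => /=; field.
Qed.

Lemma magnetization_le1 x : `|M x| <= 1.
Proof.
rewrite /magnetization normrM normfV normr_nat mulrC ler_pdivrMr ?ltr0n// mul1r.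
apply: (le_trans (ler_norm_sum _ _ _)).
rewrite (eq_bigr (fun=> 1)); last first.
  by move=> i _; rewrite /spin; case: ifP; rewrite ?normrN normr1.
by rewrite sumr_const card_ord.
Qed.

Lemma sum_rate_flip x (u : config N -> R) :
  \sum_(y | y != x) cw_rate beta x y * (u y - u x) =
  \sum_(i < N) flip_rate beta i x * (u (flip i x) - u x).
Proof.
transitivity (\sum_y cw_rate beta x y * (u y - u x)).
  by rewrite [RHS](bigD1 x)//= subrr mulr0 add0r.
rewrite /cw_rate; under eq_bigr do rewrite mulr_suml.
rewrite (exchange_big_dep predT)//=; apply: eq_bigr => i _.
by rewrite big_pred1_eq.
Qed.

(** A function on [{-1, 1}] is affine, so the sum over the spins depends on the configuration only
    through the total spin: the magnetization has a closed dynamics. *)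
Lemma cw_generator x (f : R -> R) :
  \sum_(y | y != x) cw_rate beta x y * (f (M y) - f (M x)) =
  rate_up beta n (M x) * (f (M x + 2 / n) - f (M x)) +
  rate_down beta n (M x) * (f (M x + - (2 / n)) - f (M x)).
Proof.
rewrite (@sum_rate_flip x (fun y => f (M y))); set m := M x.
pose g (e : R) := expR (- beta * e * m) * (f (m - 2 / n * e) - f m).
have spinE (e : bool) : g (spin R e) = g 1 * ((1 + spin R e) / 2) + g (-1) * ((1 - spin R e) / 2).
  case: e => /=.
    by rewrite subrr mul0r mulr0 addr0 -mulr2n -[1 *+ 2]/(2%:R) divff ?pnatr_eq0// mulr1.
  by rewrite subrr mul0r mulr0 add0r opprK -mulr2n -[1 *+ 2]/(2%:R) divff ?pnatr_eq0// mulr1.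
transitivity (\sum_(i < N) (g 1 * ((1 + spin R (x i)) / 2) + g (-1) * ((1 - spin R (x i)) / 2))).
  apply: eq_bigr => i _; rewrite -spinE /g magnetization_flip /flip_rate.
  by rewrite -/m.
rewrite big_split/= -!mulr_sumr -!mulr_suml !big_split/= sumrN sum_spin sumr_const card_ord.
rewrite -/m /g /rate_up /rate_down !mulr1 !mulrN1 !opprK.
by field.
Qed.

End CurieWeissGenerator.

(** The first line of the bounded expression is the time derivative of the flow. It cancels the
    drift [a z] and the diffusion [2 a th ^ 2] in the Taylor expansion of [ncdf]; each moment error
    survives with a power of [ir] and a bounded derivative of [ncdf]. *)
Lemma smooth_step_defect (R : realType) (a th E Pp Pm Jp Jm z c ir y : R) :
  y = (c - z) * ir ->
  0 <= Pp -> 0 <= Pm -> 0 <= ir -> 0 <= E ->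
  `|Pp * Jp + Pm * Jm - a * z| <= E ->
  `|Pp * Jp ^+ 2 + Pm * Jm ^+ 2 - 2 * a * th ^+ 2| <= E * (1 + z ^+ 2) ->
  Pp * `|Jp| ^+ 3 + Pm * `|Jm| ^+ 3 <= E ->
  `|npdf y * (a * z * ir + a * th ^+ 2 * ir ^+ 2 * y)
    + (Pp * (ncdf ((c - (z + Jp)) * ir) - ncdf y)
       + Pm * (ncdf ((c - (z + Jm)) * ir) - ncdf y))|
  <= 3 * (ir + ir ^+ 2 + ir ^+ 3) * E * (1 + z ^+ 2).
Proof.
move=> yE Pp0 Pm0 ir0 E0 H1 H2 H3.
have shiftE J : (c - (z + J)) * ir = y + - (J * ir) by rewrite yE; ring.
rewrite !shiftE.
pose T h : R := ncdf (y + h) - ncdf y - h * npdf y - h ^+ 2 / 2 * (- y * npdf y).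
have HT J P : 0 <= P -> `|P * T (- (J * ir))| <= 3 * ir ^+ 3 * (P * `|J| ^+ 3).
  move=> P0; rewrite normrM (ger0_norm P0).
  have -> : 3 * ir ^+ 3 * (P * `|J| ^+ 3) = P * (3 * `|- (J * ir)| ^+ 3).
    by rewrite normrN normrM (ger0_norm ir0); ring.
  by rewrite ler_wpM2l// ncdf_taylor.
have -> : npdf y * (a * z * ir + a * th ^+ 2 * ir ^+ 2 * y)
    + (Pp * (ncdf (y + - (Jp * ir)) - ncdf y) + Pm * (ncdf (y + - (Jm * ir)) - ncdf y)) =
    - (ir * npdf y * (Pp * Jp + Pm * Jm - a * z)) +
    ir ^+ 2 / 2 * (- y * npdf y) * (Pp * Jp ^+ 2 + Pm * Jm ^+ 2 - 2 * a * th ^+ 2) +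
    (Pp * T (- (Jp * ir)) + Pm * T (- (Jm * ir))).
  by rewrite /T; field.
have z0 : 0 <= z ^+ 2 by exact: sqr_ge0.
have zE : E <= E * (1 + z ^+ 2) by rewrite ler_peMr// lerDl.
have n1 : `|- (ir * npdf y * (Pp * Jp + Pm * Jm - a * z))| <= 3 * ir * (E * (1 + z ^+ 2)).
  rewrite normrN normrM; apply: ler_pM => //; last exact: le_trans zE.
  rewrite normrM (ger0_norm ir0) (ger0_norm (npdf_ge0 _)) mulrC.
  by rewrite ler_wpM2r// npdf_le3.
have n2 : `|ir ^+ 2 / 2 * (- y * npdf y) * (Pp * Jp ^+ 2 + Pm * Jm ^+ 2 - 2 * a * th ^+ 2)|
    <= 3 * ir ^+ 2 * (E * (1 + z ^+ 2)).
  rewrite normrM; apply: ler_pM => //.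
  rewrite normrM [3 * _]mulrC; apply: ler_pM => //; last exact: npdf1_bound.
  rewrite ger0_norm ?divr_ge0 ?exprn_ge0//.
  by rewrite ler_pdivrMr// ler_peMr ?exprn_ge0// ler1n.
have n3 : `|Pp * T (- (Jp * ir)) + Pm * T (- (Jm * ir))| <= 3 * ir ^+ 3 * (E * (1 + z ^+ 2)).
  apply: (le_trans (ler_normD _ _)); apply: (le_trans (lerD (HT _ _ Pp0) (HT _ _ Pm0))).
  rewrite -mulrDr ler_wpM2l ?mulr_ge0 ?exprn_ge0//.
  exact: le_trans zE.
apply: (le_trans (ler_normD _ _)); apply: (le_trans (lerD (ler_normD _ _) (lexx _))).
apply: (le_trans (lerD (lerD n1 n2) n3)).
by rewrite le_eqVlt; apply/orP; left; apply/eqP; ring.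
Qed.

(** The drift of [z ^ 2] under the jumps cancels its decay in time. The first two moment errors cost
    [C] each and the diffusion [2 a], in units of [th * (1 + z ^ 2)]; the choice of [B] covers them
    and leaves one unit to spare. *)
Lemma lyapunov_defect (R : realType) (a th C B Pp Pm Jp Jm z : R) :
  0 <= a -> 0 < th <= 1 -> 0 <= C -> a * B = 2 * C + 2 * a + 1 ->
  `|Pp * Jp + Pm * Jm - a * z| <= C * th ->
  `|Pp * Jp ^+ 2 + Pm * Jm ^+ 2 - 2 * a * th ^+ 2| <= C * th * (1 + z ^+ 2) ->
  - (2 * a * z ^+ 2) - a * B * th * (1 + z ^+ 2)
    + (Pp * ((z + Jp) ^+ 2 - z ^+ 2) + Pm * ((z + Jm) ^+ 2 - z ^+ 2))
  <= - (th * (1 + z ^+ 2)).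
Proof.
move=> a0 /andP[th0 th1] C0 -> H1 H2.
have -> : - (2 * a * z ^+ 2) - (2 * C + 2 * a + 1) * th * (1 + z ^+ 2)
    + (Pp * ((z + Jp) ^+ 2 - z ^+ 2) + Pm * ((z + Jm) ^+ 2 - z ^+ 2)) =
   2 * (z * (Pp * Jp + Pm * Jm - a * z)) +
   (Pp * Jp ^+ 2 + Pm * Jm ^+ 2 - 2 * a * th ^+ 2) + 2 * a * th ^+ 2
   - (2 * C + 2 * a + 1) * (th * (1 + z ^+ 2)) by ring.
have z0 : 0 <= z ^+ 2 by exact: sqr_ge0.
have CW0 : 0 <= C * th by rewrite mulr_ge0// ltW.
have h1 : 2 * (z * (Pp * Jp + Pm * Jm - a * z)) <= C * th * (1 + z ^+ 2).
  apply: (le_trans (ler_norm _)); rewrite normrM normr_nat normrM.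
  apply: (@le_trans _ _ (2 * (`|z| * (C * th)))).
    by rewrite ler_wpM2l// ler_wpM2l.
  rewrite mulrA mulrC ler_wpM2l// -(real_normK (num_real z)).
  by have := sqr_ge0 (`|z| - 1); rewrite sqrrB expr1n mulr1; clear; lra.
have h2 : Pp * Jp ^+ 2 + Pm * Jm ^+ 2 - 2 * a * th ^+ 2 <= C * th * (1 + z ^+ 2).
  exact: le_trans (ler_norm _) H2.
have h3 : 2 * a * th ^+ 2 <= 2 * a * (th * (1 + z ^+ 2)).
  rewrite ler_wpM2l ?mulr_ge0// expr2 ler_wpM2l ?(ltW th0)//.
  by rewrite (le_trans th1)// lerDl.
move: h1 h2 h3; rewrite -mulrA; set W := th * (1 + z ^+ 2).
set u := 2 * (z * _); set v := _ - _; set w := 2 * a * th ^+ 2.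
have -> : (2 * C + 2 * a + 1) * W = C * W + C * W + 2 * a * W + W by ring.
clearbody u v w W; move: (C * W) (2 * a * W) => p q.
by clear=> *; lra.
Qed.

(** * Supersolutions *)

Lemma continuous_lincomb (R : realType) (f g : R -> R) (x y : R) :
  continuous f -> continuous g -> continuous (fun t => x * f t + y * g t).
Proof.
move=> cf cg t; apply: cvgD.
  by apply: cvgM; [exact: cvg_cst|exact: cf].
by apply: cvgM; [exact: cvg_cst|exact: cg].
Qed.

Section TimeProfiles.
Context {R : realType} (a v c B : R).
Hypothesis v0 : 0 < v.

Definition decay (t : R) : R := expR (- (a * t)).
(** For positive [x] this is [x ^ (-1/2)], in a form to which the differentiation rules apply. *)
Definition inv_sqrt (x : R) : R := expR (- (ln x / 2)).
(** The quadratic variation still to come after [t], the integral of [2 a exp (- 2 a s)] over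
    [s >= t], is [decay t ^ 2]; the smoothing adds [v]. *)
Definition inv_sd (t : R) : R := inv_sqrt (v + decay t ^+ 2).
Definition step_arg (w t : R) : R := (c - decay t * w) * inv_sd t.

(* ncdf (step_arg w t) is the Gaussian smoothing of variance decay t ^+ 2 of the
   smoothed indicator z |-> ncdf ((c - z) / sqrt v), taken at z = decay t * w. *)
Definition step_flow (w t : R) : R := ncdf (step_arg w t).
Definition step_flow' (w t : R) : R := npdf (step_arg w t) *
  (a * (decay t * w) * inv_sd t + a * decay t ^+ 2 * inv_sd t ^+ 2 * step_arg w t).

(** For nonnegative [a] and [B] the exponential factor decreases from [exp B] towards 1, and its
    logarithmic derivative has exactly the size [decay t] of the errors to be absorbed. *)
Definition lyapunov (w t : R) : R := (1 + (decay t * w) ^+ 2) * expR (B * decay t).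
Definition lyapunov' (w t : R) : R :=
  (- (2 * a * (decay t * w) ^+ 2) - a * B * decay t * (1 + (decay t * w) ^+ 2))
  * expR (B * decay t).

Lemma decay_gt0 t : 0 < decay t.
Proof. exact: expR_gt0. Qed.

Lemma is_derive_decay (t : R) : is_derive t 1 decay (- a * decay t).
Proof.
apply: (is_deriveE (is_derive_expf (is_deriveNf (is_deriveZf a (is_derive_idf t))))).
by rewrite /decay; ring.
Qed.

Lemma inv_sqrt_gt0 x : 0 < inv_sqrt x.
Proof. exact: expR_gt0. Qed.

Lemma inv_sqrt_sqr x : 0 < x -> inv_sqrt x ^+ 2 = x^-1.
Proof.
move=> x0; rewrite /inv_sqrt -expRM_natl -[2%:R in LHS]/2.
have -> : 2 * - (ln x / 2) = - ln x by field.
by rewrite expRN lnK ?posrE.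
Qed.

Let var_gt0 t : 0 < v + decay t ^+ 2.
Proof. by rewrite ltr_pwDl// sqr_ge0. Qed.

Lemma is_derive_inv_sd (t : R) :
  is_derive t 1 inv_sd (a * decay t ^+ 2 * inv_sd t ^+ 3).
Proof.
have dl := is_derive1_ln (var_gt0 t).
have dth := is_derive_decay t.
apply: (is_deriveE (is_derive_expf (is_deriveNf (is_deriveMf
   (is_derive_compf (g := fun t => v + decay t ^+ 2) dl
      (is_deriveDf (is_derive_cstf v t) (is_derive_sqrf dth)))
   (is_derive_cstf 2^-1 t))))).
have -> : a * decay t ^+ 2 * inv_sd t ^+ 3 = a * decay t ^+ 2 * inv_sd t ^+ 2 * inv_sd t by ring.
rewrite [inv_sd t ^+ 2](inv_sqrt_sqr (var_gt0 t)) /inv_sd /inv_sqrt.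
by field; rewrite gt_eqF.
Qed.

Lemma is_derive_step_arg w (t : R) : is_derive t 1 (step_arg w)
  (a * (decay t * w) * inv_sd t + a * decay t ^+ 2 * inv_sd t ^+ 2 * step_arg w t).
Proof.
apply: (is_deriveE (is_deriveMf (is_deriveBf (is_derive_cstf c t)
   (is_deriveMf (is_derive_decay t) (is_derive_cstf w t))) (is_derive_inv_sd t))).
by rewrite /step_arg; ring.
Qed.

Lemma is_derive_step_flow w (t : R) : is_derive t 1 (step_flow w) (step_flow' w t).
Proof.
exact: (is_derive_compf (is_derive_ncdf (step_arg w t)) (is_derive_step_arg w t)).
Qed.

Lemma continuous_step_flow' w : continuous (step_flow' w).
Proof.
move=> t; have dd := is_derive_decay t; have di := is_derive_inv_sd t.
have ds := is_derive_step_arg w t.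
exact: (is_derive_continuous (is_deriveMf (is_derive_compf (is_derive_npdf (step_arg w t)) ds)
  (is_deriveDf (is_deriveMf (is_deriveZf a (is_deriveMf dd (is_derive_cstf w t))) di)
    (is_deriveMf (is_deriveMf (is_deriveZf a (is_derive_sqrf dd)) (is_derive_sqrf di)) ds)))).
Qed.

Lemma is_derive_lyapunov w (t : R) : is_derive t 1 (lyapunov w) (lyapunov' w t).
Proof.
have dd := is_derive_decay t.
apply: (is_deriveE (is_deriveMf (is_deriveDf (is_derive_cstf 1 t)
   (is_derive_sqrf (is_deriveMf dd (is_derive_cstf w t)))) (is_derive_expf (is_deriveZf B dd)))).
by rewrite /lyapunov'; ring.
Qed.

Lemma continuous_lyapunov' w : continuous (lyapunov' w).
Proof.
move=> t; have dd := is_derive_decay t.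
have dz := is_derive_sqrf (is_deriveMf dd (is_derive_cstf w t)).
exact: (is_derive_continuous (is_deriveMf (is_deriveBf (is_deriveNf (is_deriveZf (2 * a) dz))
  (is_deriveMf (is_deriveZf (a * B) dd) (is_deriveDf (is_derive_cstf 1 t) dz)))
  (is_derive_expf (is_deriveZf B dd)))).
Qed.

Lemma inv_sd_le t : inv_sd t <= inv_sqrt v.
Proof.
by rewrite ler_expR lerN2 ler_pM2r// ler_ln ?posrE ?var_gt0// lerDl sqr_ge0.
Qed.

(** A difference of squares, where [decay t * inv_sd t <= 1] removes one factor. The first power of
    [decay t] is what can be bounded at the stopping time. *)
Lemma inv_sd_near t : `|inv_sd t - inv_sqrt v| <= decay t * inv_sqrt v ^+ 2.
Proof.
have i0 := inv_sqrt_gt0 (v + decay t ^+ 2); have iv0 := inv_sqrt_gt0 v.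
rewrite distrC ger0_norm ?subr_ge0 ?inv_sd_le//.
have E1 := inv_sqrt_sqr (var_gt0 t); have E2 := inv_sqrt_sqr v0.
rewrite -/(inv_sd t) in E1 i0.
have d0 := decay_gt0 t.
have di : decay t * inv_sd t <= 1.
  rewrite -(@ler_pXn2r _ 2) ?nnegrE ?mulr_ge0 ?(ltW d0) ?(ltW i0)//.
  by rewrite exprMn E1 expr1n ler_pdivrMr ?var_gt0// mul1r lerDr ltW.
have E3 : (inv_sqrt v - inv_sd t) * (inv_sqrt v + inv_sd t) =
    decay t ^+ 2 * inv_sqrt v ^+ 2 * inv_sd t ^+ 2.
  have -> : (inv_sqrt v - inv_sd t) * (inv_sqrt v + inv_sd t) =
    inv_sqrt v ^+ 2 - inv_sd t ^+ 2 by ring.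
  by rewrite E1 E2; field; rewrite !gt_eqF.
rewrite -(ler_pM2r (addr_gt0 iv0 i0)) E3.
have -> : decay t ^+ 2 * inv_sqrt v ^+ 2 * inv_sd t ^+ 2 =
  decay t * inv_sqrt v ^+ 2 * (decay t * inv_sd t * inv_sd t) by ring.
rewrite ler_wpM2l ?(mulr_ge0 (ltW d0) (sqr_ge0 _))//.
apply: (@le_trans _ _ (1 * inv_sd t)); first by rewrite ler_wpM2r ?(ltW i0).
by rewrite mul1r lerDr ltW.
Qed.

End TimeProfiles.

(** Multiplied by [decay a t], this is the near-martingale [Z]. *)
Definition scaled_psi {R : realType} (beta : R) (N : nat) (m : R) : R :=
  Num.sqrt N%:R * Num.sqrt (growth beta / 2) * psi beta m.

(** With [eps] equal to 1 or -1, the same computation yields the upper and the lower bound. *)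
Definition barrier {R : realType} (beta v c B A eps : R) (N : nat) (t : R) (m : R) : R :=
  eps * step_flow (growth beta) v c (scaled_psi beta N m) t
  + A / Num.sqrt N%:R * lyapunov (growth beta) B (scaled_psi beta N m) t.

(** The spare unit of the Lyapunov term, weighted by [A / s], pays for the defect of the flow. Since
    [inv_sd] is at most [inv_sqrt v], the bound on [A] is uniform in time. *)
Lemma barrier_defect (R : realType) (a v c B A eps s C t w wp wm z Jp Jm Pp Pm : R) :
  0 < a -> 0 <= B -> 0 < v -> 1 <= s -> 0 <= t -> 0 < C ->
  a * B = 2 * C + 2 * a + 1 -> `|eps| <= 1 ->
  3 * (inv_sqrt v + inv_sqrt v ^+ 2 + inv_sqrt v ^+ 3) * C <= A ->
  0 <= Pp -> 0 <= Pm ->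
  decay a t * w = z -> decay a t * wp = z + Jp -> decay a t * wm = z + Jm ->
  `|Pp * Jp + Pm * Jm - a * z| <= C * decay a t / s ->
  `|Pp * Jp ^+ 2 + Pm * Jm ^+ 2 - 2 * a * decay a t ^+ 2| <= C * decay a t / s * (1 + z ^+ 2) ->
  Pp * `|Jp| ^+ 3 + Pm * `|Jm| ^+ 3 <= C * decay a t / s ->
  eps * step_flow' a v c w t + A / s * lyapunov' a B w t +
  (Pp * ((eps * step_flow a v c wp t + A / s * lyapunov a B wp t) -
         (eps * step_flow a v c w t + A / s * lyapunov a B w t)) +
   Pm * ((eps * step_flow a v c wm t + A / s * lyapunov a B wm t) -
         (eps * step_flow a v c w t + A / s * lyapunov a B w t))) <= 0.
Proof.
move=> a0 B0 v0 sN1 t0 C0 aB eps1 A0A Pp0 Pm0 zE zJp zJm.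
have th01 : 0 < decay a t <= 1.
  by rewrite decay_gt0/= /decay -expR0 ler_expR oppr_le0 mulr_ge0// ltW.
rewrite /step_flow /step_flow' /lyapunov /lyapunov' /step_arg zJp zJm zE.
have := inv_sd_le a v0 t; have := inv_sqrt_gt0 (v + decay a t ^+ 2); rewrite -/(inv_sd a v t).
have iv0 := inv_sqrt_gt0 v.
move: (inv_sd a v t) (inv_sqrt v) A0A iv0 => ir iv A0A iv0 ir0 irv.
move: (decay a t) th01 {zE zJp zJm} => th th01 E1 E2 E3.
have s_gt0 : 0 < s by exact: lt_le_trans sN1.
case/andP: (th01) => th0 th1.
have ths : 0 <= th / s by rewrite divr_ge0 ?(ltW th0) ?(ltW s_gt0).
have E0 : 0 <= C * th / s by rewrite -mulrA mulr_ge0// ltW.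
have step := smooth_step_defect (erefl ((c - z) * ir)) Pp0 Pm0 (ltW ir0) E0 E1 E2 E3.
have Cths : C * th / s <= C * th.
  by rewrite ler_pdivrMr// ler_peMr// mulr_ge0// ltW.
have z2 : 0 <= 1 + z ^+ 2 by rewrite addr_ge0// sqr_ge0.
have lyap := @lyapunov_defect R a th C B Pp Pm Jp Jm z (ltW a0) th01 (ltW C0) aB
  (le_trans E1 Cths) (le_trans E2 (ler_wpM2r z2 Cths)).
set F0 := npdf _ * _ in step *; set fp := ncdf ((c - (z + Jp)) * ir) in step *.
set fm := ncdf ((c - (z + Jm)) * ir) in step *; set f0 := ncdf ((c - z) * ir) in step *.
set L := - (2 * a * z ^+ 2) - _ in lyap *.
set eB := expR (B * th).
have eB1 : 1 <= eB by rewrite -expR0 ler_expR mulr_ge0// ltW.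
have -> : eps * F0 + A / s * (L * eB)
   + (Pp * (eps * fp + A / s * ((1 + (z + Jp) ^+ 2) * eB)
          - (eps * f0 + A / s * ((1 + z ^+ 2) * eB)))
      + Pm * (eps * fm + A / s * ((1 + (z + Jm) ^+ 2) * eB)
          - (eps * f0 + A / s * ((1 + z ^+ 2) * eB)))) =
   eps * (F0 + (Pp * (fp - f0) + Pm * (fm - f0)))
   + A / s * eB * (L + (Pp * ((z + Jp) ^+ 2 - z ^+ 2) + Pm * ((z + Jm) ^+ 2 - z ^+ 2))).
  by ring.
have W0 : 0 <= th * (1 + z ^+ 2) by rewrite mulr_ge0// ltW.
have As0 : 0 < A / s.
  rewrite divr_gt0// (lt_le_trans _ A0A)//.
  by rewrite !mulr_gt0 ?addr_gt0 ?exprn_gt0.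
have b1 : eps * (F0 + (Pp * (fp - f0) + Pm * (fm - f0))) <= A / s * (th * (1 + z ^+ 2)).
  apply: (le_trans (ler_norm _)); rewrite normrM.
  apply: (@le_trans _ _ (1 * (3 * (ir + ir ^+ 2 + ir ^+ 3) * (C * th / s) * (1 + z ^+ 2)))).
    by apply: ler_pM.
  rewrite mul1r.
  have -> : 3 * (ir + ir ^+ 2 + ir ^+ 3) * (C * th / s) * (1 + z ^+ 2) =
     3 * (ir + ir ^+ 2 + ir ^+ 3) * C * (th / s * (1 + z ^+ 2)) by ring.
  have -> : A / s * (th * (1 + z ^+ 2)) = A * (th / s * (1 + z ^+ 2)) by ring.
  rewrite ler_wpM2r ?(mulr_ge0 ths z2)//; apply: le_trans A0A.
  rewrite ler_wpM2r ?(ltW C0)// ler_wpM2l//.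
  by rewrite !lerD// lerXn2r ?nnegrE ?(ltW ir0) ?(ltW iv0).
have b2 : A / s * eB * (L + (Pp * ((z + Jp) ^+ 2 - z ^+ 2) + Pm * ((z + Jm) ^+ 2 - z ^+ 2)))
    <= - (A / s * (th * (1 + z ^+ 2))).
  apply: (@le_trans _ _ (A / s * eB * - (th * (1 + z ^+ 2)))).
    rewrite ler_wpM2l// mulr_ge0 ?(ltW As0)//; exact: le_trans eB1.
  by rewrite mulrN lerN2 ler_wpM2r// ler_peMr// ltW.
by rewrite -(subrr (A / s * (th * (1 + z ^+ 2)))) lerD.
Qed.

(** The constants depend neither on [N] nor on the horizon [h], which will grow with [N]. [A] may
    exceed [A0], as it must also cover the comparison made at the stopping time. *)
Lemma cw_supermartingale (R : realType) (beta mstar x1 r v c : R) :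
  1 < beta -> is_mstar beta mstar -> 0 < x1 < mstar -> 0 < r < x1 -> 0 < v ->
  exists A0 B s0 : R, [/\ 0 < A0, 0 <= B, 1 <= s0 &
  forall (A eps h : R) (N : nat) (d : measure_display) (T : measurableType d)
    (Pr : probability T R) (X : R -> T -> config N),
  A0 <= A -> `|eps| <= 1 -> s0 <= Num.sqrt N%:R -> 0 < h ->
  curie_weiss_process beta Pr X ->
  let U t x := barrier beta v c B A eps N t (magnetization R x) in
  let sigma w := stop_time (fun x => `|magnetization R x| < r) (X^~ w) h in
  bounded_rv (fun w => U (sigma w) (X (sigma w) w)) /\
  expect Pr (fun w => U (sigma w) (X (sigma w) w)) <= expect Pr (fun w => U 0 (X 0 w))].
Proof.
move=> hbeta hmstar hx1 hr v0.
have a0 := growth_gt0 hbeta; set a := growth beta in a0 *.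
have [C [s0 [C0 s01 HG]]] := generator_moments hbeta hmstar hx1 hr.
pose iv := inv_sqrt v; have iv0 : 0 < iv by exact: inv_sqrt_gt0.
have [A0 A0E] : {y : R | y = 3 * (iv + iv ^+ 2 + iv ^+ 3) * C} by exact: exist _ _ erefl.
have [B BE] : {y : R | y = (2 * C + 2 * a + 1) / a} by exact: exist _ _ erefl.
have aB : a * B = 2 * C + 2 * a + 1 by rewrite BE mulrC divfK// gt_eqF.
have B0 : 0 <= B.
  by rewrite BE divr_ge0 ?(ltW a0)// !addr_ge0 ?mulr_ge0 ?(ltW C0) ?(ltW a0).
have A00 : 0 < A0 by rewrite A0E !mulr_gt0 ?addr_gt0 ?exprn_gt0.
exists A0, B, s0; split; [exact: A00|exact: B0|exact: s01|].
move=> A eps h N d T Pr X A0A eps1 sN h0 hX U sigma.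
have sN1 : 1 <= Num.sqrt N%:R :> R by exact: le_trans sN.
have NN : (0 < N)%N.
  by rewrite lt0n; apply: contraTneq sN1 => ->; rewrite sqrtr0 -ltNge.
set s := Num.sqrt N%:R in sN sN1 *.
have sE : s ^+ 2 = N%:R by rewrite sqr_sqrtr.
have s_gt0 : 0 < s by exact: lt_le_trans sN1.
pose U' t (x : config N) := eps * step_flow' a v c (scaled_psi beta N (magnetization R x)) t
  + A / s * lyapunov' a B (scaled_psi beta N (magnetization R x)) t.
apply: (@stopped_supermartingale R _ _ d T Pr X hX _ U U' h h0).
- move=> x t; apply: is_deriveDf; apply: is_deriveZf.
    exact: is_derive_step_flow.
  exact: is_derive_lyapunov.
- move=> x; apply: continuous_lincomb; first exact: continuous_step_flow'.
  exact: continuous_lyapunov'.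
move=> t x /andP[t0 _] Dx.
set m := magnetization R x.
have m1 : `|m| <= 1 by exact: magnetization_le1.
have [/andP[Pp0 _] /andP[Pm0 _]] := rate_bounds hbeta (ler0n R N) m1.
have th01 : 0 < decay a t <= 1.
  by rewrite decay_gt0/= /decay -expR0 ler_expR oppr_le0 mulr_ge0// ltW.
have [E1 E2 E3] := HG s m (decay a t) sN Dx th01.
have gen := cw_generator beta NN x (barrier beta v c B A eps N t).
rewrite -sE -/m in gen Pp0 Pm0; rewrite {}gen.
have wE y : decay a t * scaled_psi beta N y = decay a t * s * Num.sqrt (a / 2) * psi beta y.
  by rewrite /scaled_psi !mulrA.
have wJ y : decay a t * scaled_psi beta N y = decay a t * s * Num.sqrt (a / 2) * psi beta m
    + decay a t * s * Num.sqrt (a / 2) * (psi beta y - psi beta m).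
  by rewrite wE mulrBr addrC subrK.
have A0A' : 3 * (iv + iv ^+ 2 + iv ^+ 3) * C <= A by rewrite -A0E.
have H := barrier_defect c a0 B0 v0 sN1 t0 C0 aB eps1 A0A' Pp0 Pm0 (wE m)
  (wJ (m + 2 / s ^+ 2)) (wJ (m + - (2 / s ^+ 2))) E1 E2 E3.
exact: H.
Qed.

(** * The exit time in the scaled coordinate *)

(** The map from [G] to the limiting pair, inverted: a real number with the exit sign, whose modulus
    [y] gives back the centred exit time as [- ln y / a + D]. Its law has to approach the standard
    Gaussian. *)
Definition exit_coord {R : realType} (beta r : R) (N : nat) (T : Type)
    (X : R -> T -> config N) (w : T) : R :=
  let M := magnetization_process (R := R) X in let tau := exit_time M r w in
  Num.sg (M tau w) *
  expR (- growth beta * (tau - ln N%:R / (2 * growth beta) - Dconst beta r)).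

Section ExitCoordinate.
Context {R : realType} (beta : R) (N : nat).
Hypothesis hbeta : 1 < beta.
Hypothesis N0 : (0 < N)%N.
Local Notation a := (growth beta).

Definition below (r : R) : pred (config N) := fun x => `|magnetization R x| < r.

Lemma exit_timeE (T : Type) (X : R -> T -> config N) r w :
  exit_time (magnetization_process X) r w = inf (exit_set (below r) (X^~ w)).
Proof.
rewrite /exit_time /exit_set /below; congr inf; apply/seteqP; split=> t /= [t0].
  by rewrite -leNgt.
by rewrite -leNgt.
Qed.

Lemma expR_half_ln (x : R) : 0 < x -> expR (ln x / 2) = Num.sqrt x.
Proof.
move=> x0; rewrite -[LHS](@ger0_norm R) ?expR_ge0// -sqrtr_sqr; congr Num.sqrt.
rewrite -expRM_natl (_ : 2%:R * (ln x / 2) = ln x); last by field.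
by rewrite lnK ?posrE.
Qed.

(** The origin of [Dconst]: its three terms are the logarithms of the factors of [scaled_psi] at
    [r], so [exit_coord] is [Z] at the exit with [|M|] replaced by [r]. *)
Lemma exit_scale (r tau : R) : 0 < r ->
  expR (- a * (tau - ln N%:R / (2 * a) - Dconst beta r)) =
  decay a tau * scaled_psi beta N r.
Proof.
move=> r0; have a0 := growth_gt0 hbeta.
have aN0 : a != 0 by rewrite gt_eqF.
have -> : - a * (tau - ln N%:R / (2 * a) - Dconst beta r) =
    - (a * tau) + (ln N%:R / 2 + (ln (a / 2) / 2 + (ln r + a * Kconst beta r))).
  by rewrite /Dconst; field.
rewrite 4!expRD !expR_half_ln ?ltr0n ?divr_gt0// lnK ?posrE//.
by rewrite /decay /scaled_psi /psi gtr0_norm// !mulrA.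
Qed.

End ExitCoordinate.

(** A pathwise comparison at the minimum of the exit time and [ln N / a]. The first conclusion says
    that the variance still to come is negligible there, the second that [z] can replace
    [exit_coord]. *)
Lemma exit_coord_near (R : realType) (beta mstar x1 r : R) :
  1 < beta -> is_mstar beta mstar -> 0 < x1 < mstar -> 0 < r < x1 ->
  exists K s0 : R, [/\ 0 < K, 1 < s0 & forall (N : nat) (T : Type)
    (X : R -> T -> config N) (w : T), s0 <= Num.sqrt N%:R ->
  (forall t, 0 <= t -> \forall u \near t^'+, X u w = X t w) ->
  magnetization R (X 0 w) = 0 ->
  let sigma := stop_time (below (N := N) r) (X^~ w) (ln N%:R / growth beta) in
  `|magnetization R (X sigma w)| < r + 2 / N%:R ->
  let th := decay (growth beta) sigma in
  let z := th * scaled_psi beta N (magnetization R (X sigma w)) in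
  th <= K / Num.sqrt N%:R * (1 + `|z|) /\
  `|z - exit_coord beta r X w| <= K / Num.sqrt N%:R].
Proof.
move=> hbeta hmstar hx1 hr; have a0 := growth_gt0 hbeta.
have [C C1 [Hp1 Hp2 Hp3 Hp4]] := psi_facts hbeta hmstar hx1.
have C0 : 0 < C by exact: lt_le_trans C1.
have [kap kapE] : {y : R | y = Num.sqrt (growth beta / 2)} by exact: exist _ _ erefl.
have kap0 : 0 < kap by rewrite kapE sqrtr_gt0 divr_gt0.
have /andP[r0 rx1] := hr.
have rN : `|r| = r by rewrite gtr0_norm.
have x1_lt1 : x1 < 1.
  by have [/andP[_ ms1] _] := hmstar; case/andP: hx1 => _ /lt_trans; apply.
have [K KE] : {y : R | y = 1 + C / (kap * r) + 6 * (C * kap) + 2 * (C * kap)}.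
  exact: exist _ _ erefl.
have K1_0 : 0 < C / (kap * r) by rewrite divr_gt0 ?mulr_gt0.
have K2_0 : 0 < C * kap by rewrite mulr_gt0.
have xr0 : 0 < x1 - r by rewrite subr_gt0.
exists K, (2 + 2 / (x1 - r)); split.
- by rewrite KE; move: (C * kap) (C / _) K1_0 K2_0 => ? ?; clear; lra.
- by have : 0 < 2 / (x1 - r); [rewrite divr_gt0|move: (2 / _); clear=> *; lra].
move=> N T X w sN rc M0 sigma Msig th z.
have s1 : 1 <= Num.sqrt N%:R :> R.
  apply: le_trans sN; have : 0 < 2 / (x1 - r) by rewrite divr_gt0.
  by move: (2 / _); clear=> *; lra.
have NN : (0 < N)%N.
  by rewrite lt0n; apply: contraTneq s1 => ->; rewrite sqrtr0 -ltNge.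
have [s sE] : {y : R | y = Num.sqrt N%:R} by exact: exist _ _ erefl.
have s2 : N%:R = s ^+ 2 by rewrite sE sqr_sqrtr.
rewrite -sE in sN s1 *.
have s0 : 0 < s by exact: lt_le_trans s1.
have sN0 : s != 0 by rewrite gt_eqF.
have [h hE] : {y : R | y = 2 / N%:R} by exact: exist _ _ erefl.
rewrite -hE in Msig.
have hs : h = 2 / s ^+ 2 by rewrite hE s2.
have h0 : 0 < h by rewrite hs divr_gt0 ?exprn_gt0.
have h2 : h <= 2 by rewrite hs ler_pdivrMr ?exprn_gt0// ler_peMr// exprn_ege1.
have h_lt : h < x1 - r.
  rewrite hs ltr_pdivrMr ?exprn_gt0// mulrC -ltr_pdivrMr//.
  apply: (@lt_le_trans _ _ s); last by rewrite expr2 ler_peMr// ltW.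
  by apply: lt_le_trans sN; rewrite ltrDr.
have wE m : scaled_psi beta N m = s * kap * psi beta m by rewrite sE kapE.
have YE : exit_coord beta r X w =
    Num.sg (magnetization R (X (inf (exit_set (below r) (X^~ w))) w)) *
    (decay (growth beta) (inf (exit_set (below r) (X^~ w))) * (s * kap * psi beta r)).
  by rewrite /exit_coord exit_timeE exit_scale// wE.
have K_ge1 : 1 / s <= K / s.
  rewrite ler_wpM2r ?invr_ge0 ?(ltW s0)// KE.
  by move: (C * kap) (C / _) K1_0 K2_0 => ? ?; clear; lra.
have psir : `|psi beta r| <= C by apply: Hp4; rewrite rN.
have decay_ge0 t : 0 <= t -> decay (growth beta) t <= 1.
  by move=> t0; rewrite /decay -expR0 ler_expR oppr_le0 mulr_ge0// ltW.
rewrite YE /z wE; move: Msig; rewrite /th /sigma /stop_time.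
case: asboolP => [[t Et tT]|NE].
(* Exit before the horizon: [|m| >= r] bounds [|psi m|] from below, so [|z|] controls the decay
   factor; the overshoot of less than [2 / N], scaled by [sqrt N], costs [O(1 / sqrt N)]. *)
- have E0 : exit_set (below r) (X^~ w) !=set0 by exists t.
  have [tau0 /=] := exit_inf_mem rc E0; rewrite /below -leNgt.
  move: (inf _) tau0 => tau tau0 rM Mlt.
  have := decay_ge0 tau tau0; have := decay_gt0 (growth beta) tau.
  move: (decay (growth beta) tau) => q q0 q1.
  move: (magnetization R (X tau w)) rM Mlt => m rm mlt.
  have m_x1 : `|m| < x1 by apply: lt_trans mlt _; rewrite -ltrBrDl.
  have Hm := Hp3 m m_x1.
  split.
    have : q * r <= q * (C * `|psi beta m|) by rewrite ler_wpM2l ?(ltW q0)// (le_trans rm).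
    rewrite -ler_pdivlMr// => H; apply: (le_trans H).
    have -> : q * (C * `|psi beta m|) / r = C / (kap * r) / s * `|q * (s * kap * psi beta m)|.
      rewrite [`|q * _|]normrM (gtr0_norm q0) [`|s * kap * _|]normrM.
      rewrite (gtr0_norm (mulr_gt0 s0 kap0)); field.
      by rewrite sN0 !gt_eqF.
    apply: ler_pM => //; first exact: divr_ge0 (ltW K1_0) (ltW s0).
      2: by rewrite lerDr.
    rewrite ler_wpM2r ?invr_ge0 ?(ltW s0)// KE.
    by move: (C * kap) (C / _) K1_0 K2_0 => ? ?; clear; lra.
  have mN0 : m != 0 by rewrite -normr_gt0 (lt_le_trans r0).
  have psim : psi beta m = Num.sg m * psi beta `|m|.
    have [m_ge0|m_lt0] := leP 0 m.
      by rewrite gtr0_sg ?mul1r ?ger0_norm// lt_def mN0.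
    by rewrite ltr0_sg// ltr0_norm// psiN mulrNN mul1r.
  have -> : q * (s * kap * psi beta m) - Num.sg m * (q * (s * kap * psi beta r)) =
      Num.sg m * (q * (s * kap) * (psi beta `|m| - psi beta r)).
    by rewrite psim; move: (psi beta `|m|) (psi beta r); clear=> *; ring.
  rewrite normrM normr_sg mN0 mul1r normrM ger0_norm ?mulr_ge0 ?(ltW q0) ?(ltW s0) ?(ltW kap0)//.
  have dpsi : `|psi beta `|m| - psi beta r| <= 3 * C * h.
    have e0 : 0 <= `|m| - r by rewrite subr_ge0.
    have e_h : `|m| - r <= h by rewrite lerBlDl ltW.
    have [Hr _] := Hp1 r (eq_ind_r (fun y => y < x1) rx1 rN).
    have T1 : `|psi beta `|m| - psi beta r - (`|m| - r) * psi1 beta r| <= C * (`|m| - r) ^+ 2.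
      by apply: Hp2; rewrite ?normr_id ?rN.
    have T2 : `|(`|m| - r) * psi1 beta r| <= h * C.
      by rewrite normrM (ger0_norm e0) ler_pM.
    have T3 : C * (`|m| - r) ^+ 2 <= C * (2 * h).
      by rewrite ler_wpM2l ?(ltW C0)// expr2 ler_pM// (le_trans e_h).
    have : `|psi beta `|m| - psi beta r| <=
      `|psi beta `|m| - psi beta r - (`|m| - r) * psi1 beta r| + `|(`|m| - r) * psi1 beta r|.
      rewrite -[X in `|X| <= _](subrK ((`|m| - r) * psi1 beta r)).
      exact: ler_normD.
    move/le_trans; apply; apply: (le_trans (lerD T1 T2)).
    apply: (le_trans (lerD T3 (lexx _))); rewrite le_eqVlt; apply/orP; left; apply/eqP.
    by clear; ring.
  apply: (@le_trans _ _ (1 * (s * kap) * (3 * C * h))).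
    have sk0 : 0 <= s * kap by rewrite mulr_ge0 ?(ltW s0) ?(ltW kap0).
    apply: ler_pM => //; first by rewrite mulr_ge0 ?(ltW q0).
    by rewrite ler_wpM2r.
  have -> : 1 * (s * kap) * (3 * C * h) = 6 * (C * kap) / s by rewrite hs; field.
  rewrite ler_wpM2r ?invr_ge0 ?(ltW s0)// KE.
  by move: (C * kap) (C / _) K1_0 K2_0 => ? ?; clear; lra.
(* No exit before the horizon: the decay factor is [1 / N], so [z] and [exit_coord] are each of size
   [1 / sqrt N], and nothing need be known of the later path. *)
- have T0 : 0 <= ln N%:R / growth beta.
    by rewrite divr_ge0 ?(ltW a0)// ln_ge0// ler1n.
  have qE : decay (growth beta) (ln N%:R / growth beta) = (s ^+ 2)^-1.
    rewrite /decay mulrC divfK ?gt_eqF// expRN lnK ?posrE ?ltr0n//.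
    by rewrite s2.
  have DT : `|magnetization R (X (ln N%:R / growth beta) w)| < r.
    by apply: contrapT => /negP ND; apply: NE; exists (ln N%:R / growth beta).
  have q_s : (s ^+ 2)^-1 <= s^-1.
    by rewrite lef_pV2 ?posrE ?exprn_gt0// expr2 ler_peMr// ltW.
  rewrite qE => _.
  have m_x1 := lt_trans DT rx1.
  have psiM := Hp4 _ m_x1.
  move: (magnetization R (X (ln N%:R / growth beta) w)) psiM {DT m_x1} => m psiM.
  split.
    apply: (le_trans q_s); rewrite -[leLHS]mul1r; apply: (le_trans K_ge1).
    by rewrite ler_peMr ?lerDl// (le_trans _ K_ge1)// divr_ge0// ltW.
  have sk y q : `|y| <= C -> 0 <= q <= (s ^+ 2)^-1 -> `|q * (s * kap * y)| <= C * kap / s.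
    move=> yC /andP[q_0 q1]; rewrite normrM (ger0_norm q_0) normrM.
    rewrite (gtr0_norm (mulr_gt0 s0 kap0)).
    apply: (@le_trans _ _ ((s ^+ 2)^-1 * (s * kap * C))).
      have sk0 : 0 <= s * kap by rewrite mulr_ge0 ?(ltW s0) ?(ltW kap0).
      apply: ler_pM => //; first by rewrite mulr_ge0.
      by rewrite ler_wpM2l.
    by rewrite le_eqVlt; apply/orP; left; apply/eqP; field.
  have z1 : `|(s ^+ 2)^-1 * (s * kap * psi beta m)| <= C * kap / s.
    by apply: sk; rewrite ?lexx ?andbT ?invr_ge0 ?exprn_ge0 ?(ltW s0).
  have Y1 : `|Num.sg (magnetization R (X (inf (exit_set (below r) (X^~ w))) w)) *
     (decay (growth beta) (inf (exit_set (below r) (X^~ w))) * (s * kap * psi beta r))|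
     <= C * kap / s.
    (* A path that never exits has exit time 0 by convention; the magnetization is 0 there, so its
       sign makes [exit_coord] vanish. *)
    have [E0|E0] := pselect (exit_set (below r) (X^~ w) !=set0); last first.
      rewrite inf_out; last by case.
      by rewrite M0 sgr0 mul0r normr0 divr_ge0 ?(ltW K2_0) ?(ltW s0).
    have Etau := exit_inf_mem rc E0.
    rewrite normrM normr_sg; case: eqP => _; rewrite ?mul0r ?mul1r.
      by rewrite divr_ge0 ?(ltW K2_0) ?(ltW s0).
    apply: sk; first exact: psir.
    apply/andP; split; first exact: ltW (decay_gt0 _ _).
    rewrite -qE /decay ler_expR lerN2.
    rewrite ler_wpM2l ?(ltW a0)// leNgt; apply/negP => tauT; apply: NE.
    by exists (inf (exit_set (below r) (X^~ w))) => //; exact: ltW.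
  apply: (le_trans (ler_normB _ _)); apply: (le_trans (lerD z1 Y1)).
  have -> : C * kap / s + C * kap / s = 2 * (C * kap) / s by clear; ring.
  rewrite ler_wpM2r ?invr_ge0 ?(ltW s0)// KE.
  by move: (C * kap) (C / _) K1_0 K2_0 => ? ?; clear; lra.
Qed.

Lemma barrierN (R : realType) (beta v c B A : R) (N : nat) (t m : R) :
  barrier beta v c B A (-1) N t m =
  - step_flow (growth beta) v c (scaled_psi beta N m) t
  + A / Num.sqrt N%:R * lyapunov (growth beta) B (scaled_psi beta N m) t.
Proof. by rewrite /barrier mulN1r. Qed.

(** A single path may a priori flip several spins at once. But the indicator of an overshoot is
    annihilated by the generator inside [{|M| < r}], since one flip moves the magnetization by
    [2 / N]; stopped, its expectation stays at its initial value 0. *)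
Lemma no_overshoot (R : realType) (beta r h : R) (N : nat) (d : measure_display)
    (T : measurableType d) (Pr : probability T R) (X : R -> T -> config N) :
  (0 < N)%N -> 0 < r -> 0 < h -> curie_weiss_process beta Pr X ->
  Pr [set w | magnetization R (X 0 w) = 0] = 1%E ->
  let sigma w := stop_time (below r) (X^~ w) h in
  exists2 A : set T, measurable A /\ Pr A = 1%E &
  forall w, A w -> magnetization R (X 0 w) = 0 /\
    `|magnetization R (X (sigma w) w)| < r + 2 / N%:R.
Proof.
move=> N0 r0 h0 hX hX0 sigma.
pose U (_ : R) (x : config N) : R :=
  if r + 2 / N%:R <= `|magnetization R x| then 1 else 0.
have n0 : 0 < N%:R :> R by rewrite ltr0n.
have h2 : 0 < 2 / N%:R :> R by rewrite divr_gt0.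
have [||| [mf [C fC]] Ef] := @stopped_supermartingale R _ _ d T Pr X hX (below r) U
  (fun _ _ => 0) h h0.
- by move=> x t; exact: is_derive_cstf.
- by move=> x t; exact: cvg_cst.
- move=> t x _ Dx; rewrite add0r (@sum_rate_flip _ _ _ x (U t)) big1// => i _.
  have -> : U t x = 0 by rewrite /U leNgt (lt_trans Dx)// ltrDl.
  suff -> : U t (flip i x) = 0 by rewrite subrr mulr0.
  rewrite /U leNgt magnetization_flip// (le_lt_trans (ler_normB _ _))//.
  rewrite (_ : `|2 / N%:R * spin R (x i)| = 2 / N%:R) ?ltrD2r//.
  rewrite normrM (gtr0_norm h2) /spin; case: (x i); rewrite ?normrN normr1 mulr1//.
set f := (fun w => U _ _) in mf fC Ef.
have m0 : measurable [set w | magnetization R (X 0 w) = 0].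
  have := measurable_state hX (fun x => magnetization R x == 0) (lexx 0).
  by congr measurable; apply/seteqP; split=> w /= /eqP.
have bf : bounded_rv f by split=> //; exists C.
have bU0 : bounded_rv (fun w => U 0 (X 0 w)).
  exact: (initial_state_bounded hX (below r) (U 0)).
have EU0 : expect Pr (fun w => U 0 (X 0 w)) <= 0.
  rewrite -[leRHS](expect_cst Pr 0); apply: (le_expect_as m0 hX0) => //.
    exact: bounded_rv_cst.
  by move=> w /= Mw; rewrite /U Mw normr0 ifF//; apply/negbTE; rewrite -ltNge addr_gt0.
pose A1 := f @^-1` [set 1].
have mA1 : measurable A1.
  by have := mf measurableT [set 1] (measurable_set1 1); rewrite setTI.
have fE : f = \1_A1.
  apply/funext => w; rewrite indicE /f /U; case: (boolP (_ <= _)) => H /=.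
    by rewrite mem_set// /A1 /f /U/= H.
  rewrite memNset// /A1 /f /U/= (negbTE H).
  by move=> /eqP; rewrite eq_sym oner_eq0.
have PA1 : Pr A1 = 0%E.
  have : expect Pr f <= 0 by exact: le_trans EU0.
  rewrite fE expect_indic// => H; apply/eqP; rewrite eq_le measure_ge0 andbT.
  by rewrite -(@fineK _ (Pr A1)) ?fin_num_measure// lee_fin.
pose E0 := [set w | magnetization R (X 0 w) = 0].
have mE1 : measurable (E0 `&` ~` A1) by apply: measurableI => //; exact: measurableC.
exists (E0 `&` ~` A1).
  split=> //; apply/eqP; rewrite eq_le probability_le1//= -hX0.
  apply: (@le_trans _ _ (Pr ((E0 `&` ~` A1) `|` A1))).
    apply: le_measure; rewrite ?inE//; first exact: measurableU.
    by move=> w Ew; case: (pselect (A1 w)) => [?|?]; [right|left].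
  by rewrite measureU0.
move=> w [/= M0 NA1]; split=> //; rewrite ltNge; apply/negP => H; apply: NA1.
by rewrite /A1 /f /U /= H.
Qed.

Lemma measurable_exit_coord (R : realType) (beta r : R) (N : nat) (d : measure_display)
    (T : measurableType d) (Pr : probability T R) (X : R -> T -> config N) :
  curie_weiss_process beta Pr X ->
  [/\ measurable_fun setT (exit_time (magnetization_process (R := R) X) r),
      measurable_fun setT (fun w => Num.sg (magnetization_process X
        (exit_time (magnetization_process X) r w) w) : R) &
      measurable_fun setT (exit_coord beta r X)].
Proof.
move=> hX.
have m1 : measurable_fun setT (exit_time (magnetization_process (R := R) X) r).
  rewrite (_ : exit_time _ _ = fun w => inf (exit_set (below r) (X^~ w))).
    exact: measurable_exit_inf hX _.
  by apply/funext => w; rewrite exit_timeE.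
have m2 : measurable_fun setT (fun w => Num.sg (magnetization_process X
        (exit_time (magnetization_process X) r w) w) : R).
  rewrite (_ : (fun w => _) = fun w => Num.sg (magnetization R
      (X (inf (exit_set (below r) (X^~ w))) w))).
    exact: (measurable_exit_state hX (below r) (fun x => Num.sg (magnetization R x))).
  by apply/funext => w; rewrite exit_timeE.
split=> //; apply: measurable_funM => //; apply: measurableT_comp => //.
apply: measurable_funM => //; apply: measurable_funB => //.
exact: measurable_funB.
Qed.

(** The two barriers, evaluated at time 0 and at the stopping time, enclose the smoothed
    distribution function of [exit_coord]. *)
Lemma smoothed_cdf_bound (R : realType) (beta mstar r c v : R) :
  1 < beta -> is_mstar beta mstar -> 0 < r < mstar -> 0 < v ->
  exists C s0 : R, forall (N : nat) (d : measure_display)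
    (T : measurableType d) (Pr : probability T R) (X : R -> T -> config N),
  s0 <= Num.sqrt N%:R -> curie_weiss_process beta Pr X ->
  Pr [set w | magnetization R (X 0 w) = 0] = 1%E ->
  `|expect Pr (fun w => ncdf ((c - exit_coord beta r X w) * inv_sqrt v))
    - ncdf (c * inv_sqrt (v + 1))| <= C / Num.sqrt N%:R.
Proof.
move=> hbeta hmstar /andP[r0 rms] v0.
have a0 := growth_gt0 hbeta.
pose x1 := (r + mstar) / 2.
have hx1 : 0 < x1 < mstar by apply/andP; split; rewrite /x1; move: r0 rms; clear; lra.
have hr : 0 < r < x1 by apply/andP; split=> //; rewrite /x1; move: r0 rms; clear; lra.
clearbody x1.
have [A0 [B [s0 [A00 B0 s01 HS]]]] := cw_supermartingale c hbeta hmstar hx1 hr v0.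
have [K [s1 [K0 s11 HK]]] := exit_coord_near hbeta hmstar hx1 hr.
have [iv ivE] : {y : R | y = inv_sqrt v} by exact: exist _ _ erefl.
have iv0 : 0 < iv by rewrite ivE inv_sqrt_gt0.
(* The cost of replacing the flow at the stopping time by the smoothed step at [exit_coord]: 3 is a
   Lipschitz constant of [ncdf], the first term accounts for the variance left, the second for the
   distance from [z] to [exit_coord]. *)
have [A1 A1E] : {y : R | y = 3 * (2 * (`|c| + 1) * K * iv ^+ 2 + iv * K)}.
  exact: exist _ _ erefl.
have A10 : 0 <= A1.
  have c1 : 0 <= `|c| + 1 by rewrite addr_ge0.
  by rewrite A1E !(mulr_ge0, addr_ge0) ?exprn_ge0 ?(ltW K0) ?(ltW iv0).
pose A := A0 + A1.
have A_ge0 : A0 <= A by rewrite lerDl.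
have A_ge1 : A1 <= A by rewrite lerDr ltW.
exists (A * expR B), (s0 + s1) => N d T Pr X sN hX hX0.
have sN0 : s0 <= Num.sqrt N%:R.
  by apply: le_trans sN; rewrite lerDl ltW// (lt_trans ltr01).
have sN1 : s1 <= Num.sqrt N%:R.
  by apply: le_trans sN; rewrite lerDr (le_trans ler01).
have s_gt1 : 1 < Num.sqrt N%:R :> R by exact: lt_le_trans sN1.
have NN : (1 < N)%N.
  rewrite ltnNge; apply/negP => N1; move: s_gt1; rewrite ltNge -[X in _ <= X]sqrtr1.
  by rewrite ler_sqrt// lern1 N1.
have N0 : (0 < N)%N by exact: ltnW.
have h0 : 0 < ln N%:R / growth beta by rewrite divr_gt0// ln_gt0// ltr1n.
have [Ev [mEv PEv] HEv] := no_overshoot N0 r0 h0 hX hX0.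
have [_ _ mY] := measurable_exit_coord r hX.
have bY : bounded_rv (fun w => ncdf ((c - exit_coord beta r X w) * inv_sqrt v)).
  split; last by exists 1 => w; rewrite ger0_norm ?ncdf_ge0// ncdf_le1.
  apply: (measurableT_comp (f := ncdf)).
    apply: continuous_measurable_fun => x.
    exact: (is_derive_continuous (is_derive_ncdf x)).
  by apply: measurable_funM => //; exact: measurable_funB.
pose sigma w := stop_time (below (N := N) r) (X^~ w) (ln N%:R / growth beta).
have s_gt0 : 0 < Num.sqrt N%:R :> R by exact: lt_trans s_gt1.
have near_w w : Ev w -> `|ncdf ((c - exit_coord beta r X w) * inv_sqrt v) -
    step_flow (growth beta) v c (scaled_psi beta N (magnetization R (X (sigma w) w))) (sigma w)| <=
    A / Num.sqrt N%:R *
      lyapunov (growth beta) B (scaled_psi beta N (magnetization R (X (sigma w) w))) (sigma w).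
  move=> /HEv[M0 Mlt].
  have rc : forall t, 0 <= t -> \forall u \near t^'+, X u w = X t w.
    by move=> t; exact: (mjp_right_continuous hX).
  have [] := HK N T X w sN1 rc M0 Mlt; rewrite -/(sigma w).
  rewrite /step_flow /step_arg /lyapunov.
  have := inv_sd_near (growth beta) v0 (sigma w).
  have := decay_gt0 (growth beta) (sigma w).
  rewrite -ivE; move: (inv_sd (growth beta) v (sigma w)) => ir.
  move: (decay (growth beta) (sigma w)) => th th0.
  move: (th * scaled_psi _ _ _) (exit_coord beta r X w) => z Y irv thz zY.
  move: (Num.sqrt N%:R) s_gt0 thz zY => s s_0 thz zY.
  apply: (le_trans (ncdf_lipschitz _ _)).
  have -> : (c - Y) * iv - (c - z) * ir = (c - z) * (iv - ir) + (z - Y) * iv by ring.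
  have n1 : `|(c - z) * (iv - ir)| <= (`|c| + `|z|) * (K / s * (1 + `|z|) * iv ^+ 2).
    rewrite normrM; apply: ler_pM => //; first exact: ler_normB.
    rewrite distrC; apply: (le_trans irv); rewrite ler_wpM2r ?sqr_ge0//.
  have n2 : `|(z - Y) * iv| <= K / s * iv.
    by rewrite normrM (gtr0_norm iv0) ler_wpM2r// ltW.
  have z2 : 0 <= z ^+ 2 by exact: sqr_ge0.
  (* The error is quadratic in [z], which is not bounded uniformly in [N]; the Lyapunov term has the
     same growth and absorbs it. *)
  have n3 : (`|c| + `|z|) * (1 + `|z|) <= 2 * (`|c| + 1) * (1 + z ^+ 2).
    rewrite -(real_normK (num_real z)); have := normr_ge0 z; have := normr_ge0 c.
    move: `|c| `|z|; clear=> u y u0 y0.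
    have h : (1 + y) ^+ 2 <= 2 * (1 + y ^+ 2).
      by have := sqr_ge0 (1 - y); rewrite sqrrB sqrrD expr1n !mul1r; lra.
    apply: (@le_trans _ _ ((u + 1) * (1 + y) ^+ 2)).
      rewrite expr2 mulrA ler_wpM2r ?addr_ge0// mulrDl mul1r mulrDr mulr1.
      rewrite -addrA lerD2l; have : 0 <= u * y by rewrite mulr_ge0.
      by lra.
    have -> : 2 * (u + 1) * (1 + y ^+ 2) = (u + 1) * (2 * (1 + y ^+ 2)) by ring.
    by rewrite ler_wpM2l ?addr_ge0.
  have Ks : 0 <= K / s by rewrite divr_ge0 ?(ltW K0) ?(ltW s_0).
  apply: (@le_trans _ _ (A1 / s * (1 + z ^+ 2))).
    apply: (@le_trans _ _ (3 * ((`|c| + `|z|) * (K / s * (1 + `|z|) * iv ^+ 2) + K / s * iv))).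
      rewrite ler_wpM2l//; apply: (le_trans (ler_normD _ _)); exact: lerD.
    have -> : 3 * ((`|c| + `|z|) * (K / s * (1 + `|z|) * iv ^+ 2) + K / s * iv) =
       3 * (K / s) * (((`|c| + `|z|) * (1 + `|z|)) * iv ^+ 2 + iv) by ring.
    have -> : A1 / s * (1 + z ^+ 2) = 3 * (K / s) *
       (2 * (`|c| + 1) * (1 + z ^+ 2) * iv ^+ 2 + iv * (1 + z ^+ 2)) by rewrite A1E; ring.
    rewrite ler_wpM2l ?(mulr_ge0 (ler0n _ 3) Ks)//; apply: lerD; first by rewrite ler_wpM2r ?sqr_ge0.
    by rewrite ler_peMr ?(ltW iv0)// lerDl.
  apply: (@le_trans _ _ (A / s * (1 + z ^+ 2))).
    by rewrite ler_wpM2r ?addr_ge0// ler_wpM2r ?invr_ge0 ?(ltW s_0).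
  have A_0 : 0 <= A / s by rewrite divr_ge0 ?(ltW s_0)// (le_trans A10).
  rewrite ler_wpM2l// ler_peMr ?addr_ge0//.
  by rewrite -expR0 ler_expR mulr_ge0 ?(ltW th0).
(* At time 0 the coordinate is 0 and the decay factor 1, so the flow starts at the distribution
   function of a centred Gaussian of variance [v + 1]. *)
have init eps : expect Pr (fun w => barrier beta v c B A eps N 0 (magnetization R (X 0 w))) <=
    eps * ncdf (c * inv_sqrt (v + 1)) + A / Num.sqrt N%:R * expR B.
  rewrite -[leRHS](expect_cst Pr).
  apply: (le_expect_as mEv PEv) => //; last 1 first.
  - move=> w /HEv[M0 _]; rewrite M0 /barrier /scaled_psi psi0 mulr0.
    have d0 : decay (growth beta) 0 = 1 by rewrite /decay mulr0 oppr0 expR0.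
    rewrite /step_flow /step_arg /lyapunov /inv_sd d0.
    by rewrite !mulr0 subr0 expr0n addr0 expr1n mul1r mulr1.
  - exact: (initial_state_bounded hX (below r)
      (fun x => barrier beta v c B A eps N 0 (magnetization R x))).
  - exact: bounded_rv_cst.
have upper : expect Pr (fun w => ncdf ((c - exit_coord beta r X w) * inv_sqrt v)) <=
    ncdf (c * inv_sqrt (v + 1)) + A * expR B / Num.sqrt N%:R.
  have e1 : `|1| <= 1 :> R by rewrite normr1.
  have [bU EU] := HS A 1 _ N d T Pr X A_ge0 e1 sN0 h0 hX.
  have := le_trans EU (init 1); rewrite mul1r mulrAC => /(le_trans _); apply.
  apply: (le_expect_as mEv PEv bY bU) => w Ew; have := near_w w Ew.
  rewrite ler_norml => /andP[_]; rewrite lerBlDl.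
  by rewrite /barrier mul1r.
have lower : - expect Pr (fun w => ncdf ((c - exit_coord beta r X w) * inv_sqrt v)) <=
    - ncdf (c * inv_sqrt (v + 1)) + A * expR B / Num.sqrt N%:R.
  have e1 : `|-1| <= 1 :> R by rewrite normrN normr1.
  have [bU EU] := HS A (-1) _ N d T Pr X A_ge0 e1 sN0 h0 hX.
  have := le_trans EU (init (-1)); rewrite mulN1r mulrAC => /(le_trans _); apply.
  have EN := expectZ Pr (-1) bY; rewrite mulN1r in EN; rewrite -{}EN.
  apply: (le_expect_as mEv PEv (bounded_rvZ (-1) bY) bU) => w Ew.
  have := near_w w Ew; rewrite ler_norml => /andP[+ _].
  rewrite barrierN mulN1r -/(sigma w).
  by move: (ncdf _) (step_flow _ _ _ _ _) (_ * lyapunov _ _ _ _); clear=> *; lra.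
rewrite ler_norml; move: upper lower; move: (expect _ _) (ncdf _) (_ / _); clear=> *.
by apply/andP; split; lra.
Qed.

(** * From smoothed distribution functions to convergence in distribution *)

Lemma tail_sum (R : realType) (eps nL0 nL nNL nNL0 ne nNe : R) :
  1 - nL0 <= eps / 4 -> nNL0 <= eps / 4 -> nL0 <= nL -> nNL <= nNL0 ->
  `|ne - nNe| <= eps / 2 -> 1 - (nL - ne) - (nNe - nNL) <= eps.
Proof. by move=> ? ? ? ?; rewrite ler_norml => /andP[? ?]; lra. Qed.

Lemma approximation_bound (R : realType) (C eps e0 ek s0 sk r0 rk : R) :
  0 <= C -> 0 <= eps -> `|ek - sk| <= eps + C * rk -> `|e0 - s0| <= eps + C * r0 ->
  r0 <= eps -> `|s0 - sk| <= eps -> `|r0 - rk| <= eps ->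
  `|e0 - ek| <= (3 + 3 * C) * eps.
Proof.
move=> C0 eps0 h1 h2 r0e h3 h4.
have rke : rk <= 2 * eps by move: h4 r0e; rewrite ler_norml => /andP[? ?] ?; lra.
have c1 : C * rk <= C * (2 * eps) by rewrite ler_wpM2l.
have c2 : C * r0 <= C * eps by rewrite ler_wpM2l.
have -> : e0 - ek = (e0 - s0) + (s0 - sk) - (ek - sk) by ring.
rewrite (le_trans (ler_normB _ _))//; apply: (le_trans (lerD (ler_normD _ _) h1)).
apply: (le_trans (lerD (lerD h2 h3) (lexx _))).
have -> : (3 + 3 * C) * eps = (eps + C * eps + eps) + (eps + C * (2 * eps)) by ring.
by move: c1 c2; move: (C * rk) (C * (2 * eps)) (C * r0) (C * eps) => *; lra.
Qed.

Lemma sandwich_bound (R : realType) (Nu Nl Eu El Fu Fl F p e : R) :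
  `|Nu - Eu| <= e -> `|Nl - El| <= e -> `|Nu - Fu| <= e -> `|Nl - Fl| <= e ->
  `|Fu - F| <= e -> `|Fl - F| <= e -> p <= Eu + e -> El <= p + e ->
  `|F - p| <= e + e + e + e.
Proof.
rewrite !ler_norml => /andP[? ?] /andP[? ?] /andP[? ?] /andP[? ?] /andP[? ?] /andP[? ?] ? ?.
by apply/andP; split; lra.
Qed.

Section CdfConvergence.
Context {R : realType}.
Context {d : nat -> measure_display} {T : forall k, measurableType (d k)}.
Variable P : forall k, probability (T k) R.
Variable Y : forall k, T k -> R.
Arguments Y : clear implicits.
Hypothesis mY : forall k, measurable_fun setT (Y k).
Context {dG : measure_display} {TG : measurableType dG} {PG : probability TG R}.
Variable G : {RV PG >-> R}.
Hypothesis hG : standard_gaussian G.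

Lemma cdf_ncdf x : cdf G x = (ncdf x)%:E.
Proof. by rewrite ncdf_EFin -hG. Qed.

Lemma ncdf_tails (eps : R) : 0 < eps ->
  exists2 L : R, 0 < L & 1 - ncdf L <= eps /\ ncdf (- L) <= eps.
Proof.
move=> e0.
have cE : cdf G = EFin \o ncdf by apply/funext => x; exact: cdf_ncdf.
have := cvg_cdfy1 G; rewrite cE => /fine_cvg /= c1.
have := cvg_cdfNy0 G; rewrite cE => /fine_cvg /= c2.
have n1 : \forall x \near +oo%R, 1 - ncdf x <= eps.
  have /cvgrPdist_le/(_ _ e0) := c1; apply: filterS => x /=.
  by rewrite ger0_norm ?subr_ge0 ?ncdf_le1.
have n2 : \forall x \near -oo%R, ncdf x <= eps.
  have /cvgrPdist_le/(_ _ e0) := c2; apply: filterS => x /=.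
  by rewrite sub0r normrN ger0_norm ?ncdf_ge0.
have [M1 [_ H1]] := n1; have [M2 [_ H2]] := n2.
exists (Num.max 1 (Num.max (M1 + 1) (1 - M2))).
  by rewrite lt_max ltr01.
split; [apply: H1|apply: H2].
  by rewrite !lt_max ltrDl ltr01 orbT.
by rewrite ltrNl !lt_max ltrDr ltr01 !orbT.
Qed.

Let le_ind (c y : R) : R := if y <= c then 1 else 0.

Let measurable_le_ind c : measurable_fun setT (le_ind c).
Proof.
rewrite (_ : le_ind c = \1_`]-oo, c]); first exact: measurable_indic.
apply/funext => y; rewrite indicE /le_ind; case: (boolP (y <= c)) => yc.
  by rewrite mem_set//= in_itv.
by rewrite memNset//= in_itv/=; exact/negP.
Qed.

(** The test functions along which convergence holds. They form a vector space; once it contains the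
    indicators of half-lines, it contains all step functions. *)
Definition dist_cvg (s : R -> R) := [/\ measurable_fun setT s,
  exists C, forall y, `|s y| <= C &
  expect (P k) (fun w => s (Y k w)) @[k --> \oo] --> expect PG (fun w => s (G w))].

Let comp_bounded k (s : R -> R) : measurable_fun setT s -> (exists C, forall y, `|s y| <= C) ->
  bounded_rv (fun w : T k => s (Y k w)).
Proof. by move=> ms [C sC]; split; [exact: measurableT_comp|exists C => w]. Qed.

Let comp_boundedG (s : R -> R) : measurable_fun setT s -> (exists C, forall y, `|s y| <= C) ->
  bounded_rv (fun w => s (G w)).
Proof. by move=> ms [C sC]; split; [exact: measurableT_comp|exists C => w]. Qed.

Lemma dist_cvg_cst c : dist_cvg (fun=> c).
Proof.
split=> //; first by exists `|c|.
by under eq_fun do rewrite expect_cst; rewrite expect_cst; exact: cvg_cst.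
Qed.

Lemma dist_cvg_lin x y s t : dist_cvg s -> dist_cvg t ->
  dist_cvg (fun u => x * s u + y * t u).
Proof.
move=> [ms bs cs] [mt bt ct]; split.
- by apply: measurable_funD; exact: measurable_funM.
- case: bs bt => [C sC] [C' tC]; exists (`|x| * C + `|y| * C') => u.
  by rewrite (le_trans (ler_normD _ _))// !normrM lerD// ler_wpM2l.
have EE d' (T' : measurableType d') (P' : probability T' R) (Z : T' -> R) :
    bounded_rv (fun w => s (Z w)) -> bounded_rv (fun w => t (Z w)) ->
    expect P' (fun w => x * s (Z w) + y * t (Z w)) =
    x * expect P' (fun w => s (Z w)) + y * expect P' (fun w => t (Z w)).
  by move=> b1 b2; rewrite expectD ?expectZ//; exact: bounded_rvZ.
rewrite EE; [|exact: comp_boundedG|exact: comp_boundedG].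
rewrite (_ : (fun k => _) = fun k => x * expect (P k) (fun w => s (Y k w)) +
    y * expect (P k) (fun w => t (Y k w))); last first.
  by apply/funext => k; rewrite EE//; exact: comp_bounded.
by apply: cvgD; apply: cvgM => //; exact: cvg_cst.
Qed.

Lemma expect_le_ind c : expect PG (fun w => le_ind c (G w)) = ncdf c.
Proof.
transitivity (expect PG \1_(G @^-1` `]-oo, c])).
  congr expect; apply/funext => w; rewrite indicE /le_ind.
  case: (boolP (G w <= c)) => Gc; first by rewrite mem_set//= in_itv.
  by rewrite memNset//= in_itv/=; exact/negP.
rewrite expect_indic; last exact: measurable_funPTI.
by have := cdf_ncdf c; rewrite /cdf /distribution /pushforward => ->.
Qed.

Hypothesis smooth_cvg : forall c v, 0 < v ->
  expect (P k) (fun w => ncdf ((c - Y k w) * inv_sqrt v)) @[k --> \oo]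
    --> ncdf (c * inv_sqrt (v + 1)).

(** The indicator is enclosed between smoothed steps centred at [c - del] and [c + del], for a [v]
    fixed before [k] tends to infinity. *)
Lemma dist_cvg_le_ind c : dist_cvg (le_ind c).
Proof.
split=> //.
  by exists 1 => y; rewrite /le_ind; case: ifP; rewrite ?normr1 ?normr0.
rewrite expect_le_ind; apply/cvgrPdist_le => eps eps0.
pose e4 := eps / 4; have e40 : 0 < e4 by rewrite divr_gt0.
have [L L0 [HL1 HL2]] := ncdf_tails e40.
pose del := e4 / 3; have del0 : 0 < del by rewrite divr_gt0.
pose q := 3 * (`|c| + del).
have q0 : 0 < q by rewrite mulr_gt0// ltr_wpDl.
(* The first bound gives [L <= del / sqrt v], so at distance [del] from its centre the smoothed step
   is within [e4] of 0 or 1; the second makes the extra variance [v] in the limit cost at most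
   [e4]. *)
have [v [v0 vL vq]] : exists v, [/\ 0 < v, v <= (del / L) ^+ 2 & q * v <= e4].
  exists (Num.min ((del / L) ^+ 2) (e4 / q)); split.
  - by rewrite lt_min exprn_gt0 ?divr_gt0.
  - by rewrite ge_min lexx.
  - by rewrite mulrC -ler_pdivlMr// ge_min lexx orbT.
have v1 : 0 < v + 1 by rewrite addr_gt0.
have ivL : L <= del * inv_sqrt v.
  have Ld0 : 0 < L / del by exact: divr_gt0.
  rewrite mulrC -ler_pdivrMr// -(@ler_pXn2r _ 2) ?nnegrE ?(ltW Ld0) ?(ltW (inv_sqrt_gt0 _))//.
  have Ld2 : 0 < (L / del) ^+ 2 by exact: exprn_gt0.
  rewrite inv_sqrt_sqr// -[leLHS]invrK lef_pV2 ?posrE ?invr_gt0//.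
  by rewrite -exprVn invf_div.
have i1 : `|inv_sqrt (v + 1) - 1| <= v.
  have i0 := inv_sqrt_gt0 (v + 1); have i2 := inv_sqrt_sqr v1.
  have E : (1 - inv_sqrt (v + 1)) * (1 + inv_sqrt (v + 1)) = v / (v + 1).
    have -> : (1 - inv_sqrt (v + 1)) * (1 + inv_sqrt (v + 1)) = 1 - inv_sqrt (v + 1) ^+ 2.
      by ring.
    by rewrite i2; field; rewrite gt_eqF.
  have p1 : 0 < 1 + inv_sqrt (v + 1) by rewrite addr_gt0.
  have n1 : 0 <= 1 - inv_sqrt (v + 1).
    by rewrite -(pmulr_lge0 _ p1) E divr_ge0 ?ltW.
  rewrite distrC ger0_norm//; apply: (@le_trans _ _ (v / (v + 1))).
    by rewrite -E ler_peMr// lerDl ltW.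
  by rewrite ler_pdivrMr// ler_peMr ?(ltW v0)// lerDr ltW.
have close u : `|u| <= `|c| + del -> `|ncdf (u * inv_sqrt (v + 1)) - ncdf u| <= e4.
  move=> uc; apply: (le_trans (ncdf_lipschitz _ _)).
  have -> : u * inv_sqrt (v + 1) - u = u * (inv_sqrt (v + 1) - 1) by ring.
  rewrite normrM; apply: le_trans vq; rewrite /q -mulrA ler_wpM2l//.
  by apply: ler_pM.
have delE : 3 * del = e4 by rewrite /del mulrC divfK.
have up := @smooth_cvg (c + del) v v0; have low := @smooth_cvg (c - del) v v0.
have eE : eps = e4 + e4 + e4 + e4 by rewrite /e4; field.
have bind k : bounded_rv (fun w : T k => le_ind c (Y k w)).
  apply: comp_bounded => //; exists 1 => y.
  by rewrite /le_ind; case: ifP; rewrite ?normr1 ?normr0.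
have mncdf : measurable_fun setT (@ncdf R).
  by apply: continuous_measurable_fun => x; exact: (is_derive_continuous (is_derive_ncdf x)).
have bsm k u : bounded_rv (fun w : T k => ncdf ((u - Y k w) * inv_sqrt v)).
  split; last by exists 1 => w; rewrite ger0_norm ?ncdf_ge0// ncdf_le1.
  apply: (measurableT_comp mncdf); apply: measurable_funM => //.
  exact: measurable_funB.
have iv0 := inv_sqrt_gt0 v.
rewrite lerBlDl in HL1.
have /cvgrPdist_le/(_ _ e40) up4 := up; have /cvgrPdist_le/(_ _ e40) low4 := low.
apply: filterS2 up4 low4 => k uk lk.
have cu : `|ncdf ((c + del) * inv_sqrt (v + 1)) - ncdf (c + del)| <= e4.
  by apply: close; rewrite (le_trans (ler_normD _ _))// (gtr0_norm del0).
have cl : `|ncdf ((c - del) * inv_sqrt (v + 1)) - ncdf (c - del)| <= e4.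
  by apply: close; rewrite (le_trans (ler_normB _ _))// (gtr0_norm del0).
have du : `|ncdf (c + del) - ncdf c| <= e4.
  have := ncdf_lipschitz c (c + del).
  by rewrite (_ : c + del - c = del) ?(gtr0_norm del0) ?delE//; ring.
have dl : `|ncdf (c - del) - ncdf c| <= e4.
  have := ncdf_lipschitz c (c - del).
  by rewrite (_ : c - del - c = - del) ?normrN ?(gtr0_norm del0) ?delE//; ring.
have e4E : e4 = expect (P k) (fun=> e4) by rewrite expect_cst.
have hu : expect (P k) (fun w => le_ind c (Y k w)) <=
    expect (P k) (fun w => ncdf ((c + del - Y k w) * inv_sqrt v)) + e4.
  rewrite [in leRHS]e4E -expectD//; last exact: bounded_rv_cst.
  apply: le_expect => //; first by apply: bounded_rvD => //; exact: bounded_rv_cst.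
  move=> w; rewrite /le_ind; case: (leP (Y k w) c) => Yc; last first.
    by rewrite addr_ge0 ?ncdf_ge0// ltW.
  have : ncdf L <= ncdf ((c + del - Y k w) * inv_sqrt v).
    apply: ncdf_nondecreasing; apply: (le_trans ivL); rewrite ler_wpM2r ?(ltW iv0)//.
    by rewrite addrAC lerDr subr_ge0.
  by move=> H; rewrite (le_trans HL1)// lerD2r.
have hl : expect (P k) (fun w => ncdf ((c - del - Y k w) * inv_sqrt v)) <=
    expect (P k) (fun w => le_ind c (Y k w)) + e4.
  rewrite [in leRHS]e4E -expectD//; last exact: bounded_rv_cst.
  apply: le_expect => //; first by apply: bounded_rvD => //; exact: bounded_rv_cst.
  move=> w; rewrite /le_ind; case: (leP (Y k w) c) => Yc.
    by rewrite (le_trans (ncdf_le1 _))// lerDl ltW.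
  rewrite add0r (le_trans _ HL2)//; apply: ncdf_nondecreasing.
  rewrite lerNr -mulNr (le_trans ivL)// ler_wpM2r ?(ltW iv0)//.
  rewrite (_ : - (c - del - Y k w) = del + (Y k w - c)); last by ring.
  by rewrite lerDl subr_ge0 ltW.
by rewrite eE; exact: (sandwich_bound uk lk cu cl du dl hu hl).
Qed.

Let cell (p q y : R) : R := le_ind q y - le_ind p y.

Let cellE p q y : p <= q -> cell p q y = if p < y <= q then 1 else 0.
Proof.
move=> pq; rewrite /cell /le_ind; have [yp|py] := leP y p.
  by rewrite (le_trans yp pq) subrr.
by case: ifP; rewrite subr0.
Qed.

Lemma dist_cvg_cell p q : dist_cvg (cell p q).
Proof.
have := dist_cvg_lin 1 (-1) (dist_cvg_le_ind q) (dist_cvg_le_ind p).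
by congr dist_cvg; apply/funext => y; rewrite mul1r mulN1r.
Qed.

(** Each cell takes the value of [g] at its left end. Vanishing outside the interval lets
    approximants on disjoint intervals be added. *)
Lemma step_approx (g : R -> R) (p del eps : R) (n : nat) : 0 <= del ->
  (forall x y, p <= x -> x <= y <= x + del -> y <= p + n%:R * del -> `|g y - g x| <= eps) ->
  exists2 s, dist_cvg s & forall y,
    (p < y <= p + n%:R * del -> `|g y - s y| <= eps) /\
    (~~ (p < y <= p + n%:R * del) -> s y = 0).
Proof.
move=> del0; elim: n => [_|n IHn H].
  exists (fun=> 0); first exact: dist_cvg_cst.
  by move=> y; rewrite mul0r addr0; split=> //; rewrite ltNge andNb.
have del1 : n.+1%:R * del = n%:R * del + del by rewrite -natr1 mulrDl mul1r.
have [x y px xy yn|s cs Hs] := IHn.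
  by apply: H => //; rewrite (le_trans yn)// lerD2l del1 lerDl.
pose p1 := p + n%:R * del; pose p2 := p + n.+1%:R * del.
have p12 : p1 <= p2 by rewrite lerD2l del1 lerDl.
have pp1 : p <= p1 by rewrite lerDl mulr_ge0.
exists (fun y => 1 * s y + g p1 * cell p1 p2 y).
  by apply: dist_cvg_lin => //; exact: dist_cvg_cell.
move=> y; rewrite cellE// mul1r -/p2; have [Hy1 Hy2] := Hs y.
have [yp1|p1y] := leP y p1.
  rewrite mulr0 addr0; rewrite yp1 andbT in Hy1 Hy2; rewrite (le_trans yp1 p12) andbT.
  by split.
rewrite Hy2; last by rewrite negb_and -ltNge p1y orbT.
rewrite add0r (le_lt_trans pp1 p1y)/=; split=> [yp2|/negbTE ->]; last by rewrite mulr0.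
rewrite yp2 mulr1; apply: H => //; rewrite ltW//=.
by rewrite -addrA -del1.
Qed.

Lemma cell_approx (g : R -> R) (p q eps : R) : continuous g -> p < q -> 0 < eps ->
  exists2 s, dist_cvg s & forall y,
    (p < y <= q -> `|g y - s y| <= eps) /\ (~~ (p < y <= q) -> s y = 0).
Proof.
move=> cg pq eps0.
have [h0 h0_gt0 H] := continuous_segment_uniform p q cg eps0.
pose n := (Num.bound ((q - p) / h0)).+1.
have n_gt0 : 0 < n%:R :> R by rewrite ltr0n.
pose del := (q - p) / n%:R.
have qE : p + n%:R * del = q by rewrite /del mulrC divfK ?gt_eqF// subrKC.
have del0 : 0 <= del by rewrite divr_ge0 ?ltW// subr_gt0.
have delh : del < h0.
  rewrite /del ltr_pdivrMr// mulrC -ltr_pdivrMr//.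
  have qp : 0 <= (q - p) / h0 by rewrite divr_ge0 ?(ltW h0_gt0)// subr_ge0 ltW.
  by apply: (lt_trans (archi_boundP qp)); rewrite ltr_nat.
rewrite -qE; apply: step_approx => // x y px /andP[xy yd] yn.
rewrite -[y](subrKC x); apply: H.
  by rewrite subr_ge0 xy/= (le_lt_trans _ delh)// lerBlDl.
by rewrite px (le_trans xy)// -qE.
Qed.

(** A continuous mapping argument for functionals that are continuous in the coordinate only away
    from 0, by one formula on each side. The functions [g1] and [g2] may depend on [eta], which
    allows formulas truncated near 0. *)
Lemma weak_cvg (F : forall k, T k -> R) (F0 : TG -> R) (C : R) :
  (forall k, measurable_fun setT (F k)) -> measurable_fun setT F0 ->
  (forall k w, `|F k w| <= C) -> (forall w, `|F0 w| <= C) ->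
  (forall eta, 0 < eta -> exists g1 g2 : R -> R, [/\ continuous g1, continuous g2,
    (forall k w, (eta <= Y k w -> F k w = g1 (Y k w)) /\
                 (Y k w <= - eta -> F k w = g2 (Y k w))) &
    (forall w, (eta <= G w -> F0 w = g1 (G w)) /\ (G w <= - eta -> F0 w = g2 (G w)))]) ->
  expect (P k) (F k) @[k --> \oo] --> expect PG F0.
Proof.
move=> mF mF0 FC F0C Hg; apply/cvgrPdist_le => eps0 eps0_gt0.
have C0 : 0 <= C by exact: le_trans (F0C point).
pose eps := eps0 / (3 + 3 * C).
have den0 : 0 < 3 + 3 * C by rewrite ltr_pwDl// mulr_ge0.
have eps_gt0 : 0 < eps by rewrite divr_gt0.
have epsE : eps0 = (3 + 3 * C) * eps by rewrite /eps mulrC divfK// gt_eqF.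
have e4 : 0 < eps / 4 by rewrite divr_gt0.
have [L0 L00 [HL1 HL2]] := ncdf_tails e4.
(* As [ncdf] is 3-Lipschitz, the window of length [2 * eta] around 0 has Gaussian mass at most
   [6 * eta = eps / 2]. *)
pose eta := eps / 12; have eta0 : 0 < eta by rewrite divr_gt0.
pose L := L0 + eta; have etaL : eta < L by rewrite ltrDr.
have [g1 [g2 [cg1 cg2 HF HF0]]] := Hg eta eta0.
have [s1 cs1 Hs1] := cell_approx cg1 etaL eps_gt0.
have NL : - L < - eta by rewrite ltrN2.
have [s2 cs2 Hs2] := cell_approx cg2 NL eps_gt0.
(* The indicator of the points where only the bound [C] is available: near 0 and in the tails. Being
   a step function, it converges in expectation as well. *)
pose rho y := 1 * (1 * 1 + (-1) * cell eta L y) + (-1) * cell (- L) (- eta) y.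
have crho : dist_cvg rho.
  apply: dist_cvg_lin; last exact: dist_cvg_cell.
  by apply: dist_cvg_lin; [exact: dist_cvg_cst|exact: dist_cvg_cell].
pose s y := 1 * s1 y + 1 * s2 y.
have cs : dist_cvg s by exact: dist_cvg_lin.
have key (f y : R) : `|f| <= C -> (eta <= y -> f = g1 y) -> (y <= - eta -> f = g2 y) ->
    `|f - s y| <= eps + C * rho y.
  move=> fC f1 f2; rewrite /rho /s !mul1r !mulN1r.
  rewrite !cellE ?(ltW etaL) ?(ltW NL)//.
  have [h1 h1'] := Hs1 y; have [h2 h2'] := Hs2 y.
  case: ifPn => [i1|/h1' ->].
    have /negbTE i2 : ~~ (- L < y <= - eta).
      case/andP: i1 => i1 _; rewrite negb_and -ltNge orbC.
      by rewrite (lt_trans _ i1)// gtrN.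
    rewrite i2 h2' ?i2// addr0 subrr subr0 mulr0 addr0 f1; first exact: h1.
    by case/andP: i1 => /ltW.
  rewrite add0r subr0; case: ifPn => [i2|/h2' ->].
    rewrite subrr mulr0 addr0 f2; first exact: h2.
    by case/andP: i2.
  by rewrite !subr0 mulr1 (le_trans fC)// lerDr ltW.
have bF k : bounded_rv (F k) by split=> //; exists C.
have bF0 : bounded_rv F0 by split=> //; exists C.
have [ms bs Es] := cs; have [mr br Er] := crho.
have diff d' (T' : measurableType d') (P' : probability T' R) (Z : T' -> R) (f : T' -> R) :
    bounded_rv f -> bounded_rv (fun w => s (Z w)) -> bounded_rv (fun w => rho (Z w)) ->
    (forall w, `|f w - s (Z w)| <= eps + C * rho (Z w)) ->
    `|expect P' f - expect P' (fun w => s (Z w))| <=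
    eps + C * expect P' (fun w => rho (Z w)).
  move=> b1 b2 b3 H.
  have bc : bounded_rv (fun w : T' => eps) by exact: bounded_rv_cst.
  have bC : bounded_rv (fun w => C * rho (Z w)) by exact: bounded_rvZ.
  have bR : bounded_rv (fun w => eps + C * rho (Z w)) by exact: bounded_rvD.
  have ER : expect P' (fun w => eps + C * rho (Z w)) = eps + C * expect P' (fun w => rho (Z w)).
    by rewrite (expectD P' bc bC) expect_cst (expectZ P' C b3).
  rewrite -ER -(expectB P' b1 b2).
  have bD : bounded_rv (fun w => f w - s (Z w)) by exact: bounded_rvB.
  rewrite ler_norml -[- expect _ _]mulN1r -(expectZ P' (-1) bR); apply/andP; split.
    apply: le_expect => //; first exact: bounded_rvZ.
    by move=> w; have := H w; rewrite ler_norml mulN1r => /andP[].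
  by apply: le_expect => // w; have := H w; rewrite ler_norml => /andP[].
have dk k : `|expect (P k) (F k) - expect (P k) (fun w => s (Y k w))| <=
    eps + C * expect (P k) (fun w => rho (Y k w)).
  apply: diff => //; [exact: comp_bounded|exact: comp_bounded|].
  by move=> w; apply: key; [exact: FC|case: (HF k w)|case: (HF k w)].
have d0 : `|expect PG F0 - expect PG (fun w => s (G w))| <=
    eps + C * expect PG (fun w => rho (G w)).
  apply: diff => //; [exact: comp_boundedG|exact: comp_boundedG|].
  by move=> w; apply: key; [exact: F0C|case: (HF0 w)|case: (HF0 w)].
have Erho : expect PG (fun w => rho (G w)) <= eps.
  have bi c : bounded_rv (fun w => le_ind c (G w)).
    apply: comp_boundedG => //; exists 1 => y.
    by rewrite /le_ind; case: ifP; rewrite ?normr1 ?normr0.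
  have -> : (fun w => rho (G w)) = fun w => (1 - (le_ind L (G w) - le_ind eta (G w)))
      - (le_ind (- eta) (G w) - le_ind (- L) (G w)).
    by apply/funext => w; rewrite /rho /cell !mul1r !mulN1r.
  have bB c c' : bounded_rv (fun w => le_ind c (G w) - le_ind c' (G w)) by exact: bounded_rvB.
  have b1 : bounded_rv (fun _ : TG => 1 : R) by exact: bounded_rv_cst.
  have bB1 c c' : bounded_rv (fun w => 1 - (le_ind c (G w) - le_ind c' (G w))).
    exact: bounded_rvB.
  rewrite !expectB// expect_cst !expect_le_ind.
  have t1 : ncdf L0 <= ncdf L by apply: ncdf_nondecreasing; rewrite lerDl ltW.
  have t2 : ncdf (- L) <= ncdf (- L0).
    by apply: ncdf_nondecreasing; rewrite lerN2 lerDl ltW.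
  have t3 : `|ncdf eta - ncdf (- eta)| <= eps / 2.
    apply: (le_trans (ncdf_lipschitz _ _)); rewrite opprK -mulr2n.
    rewrite ger0_norm ?mulrn_wge0 ?(ltW eta0)// /eta.
    by rewrite le_eqVlt; apply/orP; left; apply/eqP; field.
  exact: (tail_sum HL1 HL2 t1 t2 t3).
have /cvgrPdist_le/(_ _ eps_gt0) Es' := Es; have /cvgrPdist_le/(_ _ eps_gt0) Er' := Er.
apply: filterS2 Es' Er' => k esk erk; rewrite epsE.
exact: (approximation_bound C0 (ltW eps_gt0) (dk k) d0 Erho esk erk).
Qed.

End CdfConvergence.

(** * From the scaled coordinate back to the sign and the time *)

Lemma expectation_expect (R : realType) (d : measure_display) (T : measurableType d)
    (P : probability T R) (f : T -> R) : bounded_rv f -> 'E_P[f]%E = (expect P f)%:E.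
Proof.
move=> bf; rewrite unlock /expect /Rintegral fineK//.
exact: integrable_fin_num (bounded_rv_integrable P bf).
Qed.

Lemma measurable_sg (R : realType) : measurable_fun setT (Num.sg : R -> R).
Proof.
rewrite (_ : Num.sg = fun x => if 0 < x then 1 else if x < 0 then -1 else 0).
  apply: measurable_fun_ifT => //; first exact: measurable_fun_ltr.
  by apply: measurable_fun_ifT => //; exact: measurable_fun_ltr.
apply/funext => x; have [x0|x0|->] := ltrgt0P x; last by rewrite sgr0.
  by rewrite gtr0_sg.
by rewrite ltr0_sg.
Qed.

Lemma continuous_section (R : realType) (f : R * R -> R) (x : R) :
  continuous f -> continuous (fun y => f (x, y)).
Proof.
move=> cf y; apply: (cvg_comp (fun y => (x, y)) f); last exact: cf.
apply: (@cvg_pair _ _ _ (nbhs y) (nbhs x) (nbhs y) _ _ _ (fun=> x) id).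
  exact: cvg_cst.
exact: cvg_id.
Qed.

(** [S] takes only the values -1, 0 and 1, so measurability reduces to the three sections of [f] at
    these values. *)
Lemma measurable_sign_section (R : realType) (d : measure_display) (T : measurableType d)
    (f : R * R -> R) (S t : T -> R) : continuous f ->
  measurable_fun setT S -> measurable_fun setT t -> (forall w, Num.sg (S w) = S w) ->
  measurable_fun setT (fun w => f (S w, t w)).
Proof.
move=> cf mS mt sgS.
have mf e : measurable_fun setT (fun w => f (e, t w)).
  apply: (measurableT_comp (f := fun y => f (e, y))) => //.
  by apply: continuous_measurable_fun; exact: continuous_section.
have -> : (fun w => f (S w, t w)) = fun w => if 0 < S w then f (1, t w)
    else if S w < 0 then f (-1, t w) else f (0, t w).
  apply/funext => w; rewrite -{1}sgS; have [S0|S0|S0] := ltrgt0P (S w).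
  - by rewrite gtr0_sg.
  - by rewrite ltr0_sg.
  - by rewrite S0 sgr0.
apply: measurable_fun_ifT => //; first exact: measurable_fun_ltr.
by apply: measurable_fun_ifT => //; exact: measurable_fun_ltr.
Qed.

Lemma sqrt_double_ge (R : realType) (x : R) :
  \forall k \near \oo, x <= Num.sqrt (k.+1.*2)%:R.
Proof.
have := @nbhs_infty_ger R (x ^+ 2); apply: filterS => k xk.
apply: (le_trans (ler_norm x)); rewrite -sqrtr_sqr ler_sqrt//.
by apply: (le_trans xk); rewrite ler_nat -addnn addSn ltnW// ltnS leq_addr.
Qed.

Theorem theorem2p1 (R : realType) (beta : R) (hbeta : 1 < beta)
    (d : nat -> measure_display) (T : forall N : nat, measurableType (d N))
    (P : forall N : nat, probability (T N) R)
    (X : forall N : nat, R -> T N -> config N)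
    (hX : forall N : nat, (0 < N)%N -> ~~ odd N ->
       curie_weiss_process beta (P N) (X N))
    (hX0 : forall N : nat, (0 < N)%N -> ~~ odd N ->
       P N [set w | magnetization_process (X N) 0 w = 0] = 1%E)
    (dG : measure_display) (TG : measurableType dG) (PG : probability TG R)
    (G : {RV PG >-> R}) (hG : standard_gaussian G)
    (mstar r : R) (hmstar : is_mstar beta mstar) (hr : 0 < r < mstar) :
  let a := growth beta in
  let M := fun N : nat => magnetization_process (X N) in
  let tau := fun N : nat => exit_time (M N) r in
  let even k : nat := k.+1.*2 in
  cvg_in_distribution
    (fun k => P (even k))
    (fun k w => (Num.sg (M (even k) (tau (even k) w) w),
                 tau (even k) w - ln (even k)%:R / (2 * a)))
    PG
    (fun w => (Num.sg (G w), - (ln `|G w| / a) + Dconst beta r)).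
Proof.
move=> a M tau even.
have a0 : 0 < a by exact: growth_gt0.
have even0 k : (0 < even k)%N by rewrite double_gt0.
have hXk k : curie_weiss_process beta (P (even k)) (X (even k)).
  by apply: hX => //; rewrite odd_double.
have hX0k k : P (even k) [set w | magnetization R (X (even k) 0 w) = 0] = 1%E.
  by apply: hX0 => //; rewrite odd_double.
have mk k := measurable_exit_coord r (hXk k).
have mtau k : measurable_fun setT (fun w => tau (even k) w - ln (even k)%:R / (2 * a)).
  by case: (mk k) => m1 _ _; exact: measurable_funB.
have msg k : measurable_fun setT (fun w => Num.sg (M (even k) (tau (even k) w) w)).
  by case: (mk k).
have mGsg : measurable_fun setT (fun w => Num.sg (G w)).
  by apply: (measurableT_comp (@measurable_sg R)).
have mGln : measurable_fun setT (fun w => - (ln `|G w| / a) + Dconst beta r).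
  apply: measurable_funD => //; apply: measurableT_comp => //.
  apply: measurable_funM => //; apply: (measurableT_comp (@measurable_ln R)).
  exact: measurableT_comp.
split.
- by move=> k; exact: measurable_fun_pair.
- exact: measurable_fun_pair.
move=> f cf [C fC].
have mF k : measurable_fun setT (fun w => f (Num.sg (M (even k) (tau (even k) w) w),
    tau (even k) w - ln (even k)%:R / (2 * a))).
  by apply: measurable_sign_section => // w; rewrite sgr_id.
have mF0 : measurable_fun setT (fun w => f (Num.sg (G w), - (ln `|G w| / a) + Dconst beta r)).
  by apply: measurable_sign_section => // w; rewrite sgr_id.
rewrite expectation_expect; last by split=> //; exists C.
rewrite (_ : (fun k => _) = fun k => (expect (P (even k)) (fun w =>
    f (Num.sg (M (even k) (tau (even k) w) w),
       tau (even k) w - ln (even k)%:R / (2 * a))))%:E); last first.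
  by apply/funext => k; rewrite expectation_expect//; split=> //; exists C.
apply: cvg_EFin; first exact: nearW.
apply: (@weak_cvg R (fun k => d (even k)) (fun k => T (even k)) (fun k => P (even k))
  (fun k => exit_coord beta r (X (even k))) _ _ _ _ G hG _ _ _ C) => //.
- by move=> k; case: (mk k).
- move=> c v v0.
  have [C' [s0 H]] := smoothed_cdf_bound c hbeta hmstar hr v0.
  apply/cvgrPdist_le => eps eps0.
  have := sqrt_double_ge s0; have := sqrt_double_ge (`|C'| / eps).
  have := @sqrt_double_ge R 1.
  apply: filterS3 => k k1 k2 k3; rewrite distrC.
  apply: (le_trans (H _ _ _ _ _ k3 (hXk k) (hX0k k))).
  have s_gt0 : 0 < Num.sqrt (k.+1.*2)%:R :> R by exact: lt_le_trans k1.
  rewrite ler_pdivrMr// (le_trans (ler_norm _))// mulrC -ler_pdivrMr//.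
- move=> eta eta0.
  (* Truncating the logarithm at [eta] makes the formula continuous on the whole line without
     changing it where [e * y >= eta]. *)
  pose g (e : R) (y : R) := f (e, - (ln (Num.max (e * y) eta) / a) + Dconst beta r).
  have cg e : continuous (g e).
    have cmax : continuous (fun y : R => Num.max (e * y) eta).
      move=> y; apply: (@continuous_max R R (fun y => e * y) (fun=> eta)); last exact: cvg_cst.
      by apply: cvgM; [exact: cvg_cst|exact: cvg_id].
    have cl : continuous (fun y => - (ln (Num.max (e * y) eta) / a) + Dconst beta r).
      move=> y; apply: cvgD; last exact: cvg_cst.
      apply: cvgN; apply: cvgM; last exact: cvg_cst.
      have pos : 0 < Num.max (e * y) eta by rewrite lt_max eta0 orbT.
      exact: (cvg_comp _ _ (cmax y) (continuous_ln pos)).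
    move=> y; have cs := @continuous_section R f e cf.
    apply: (cvg_comp (fun y => - (ln (Num.max (e * y) eta) / a) + Dconst beta r)
      (fun u => f (e, u)) (cl y)).
    exact: cs.
  exists (g 1), (g (-1)); split=> //.
  + move=> k w; rewrite /exit_coord -/(M (even k)) -/(tau (even k)) -/a.
    set m := M (even k) _ w; set t := tau (even k) w.
    (* The modulus of [exit_coord] determines the centred exit time, by the same formula that the
       limit applies to [|G|]. *)
    have tE (y : R) : y = expR (- a * (t - ln (even k)%:R / (2 * a) - Dconst beta r)) ->
        - (ln y / a) + Dconst beta r = t - ln (even k)%:R / (2 * a).
      move=> ->; rewrite expRK; move: (t - _) (Dconst beta r) => u D.
      by field; rewrite gt_eqF.
    have epos := expR_gt0 (- a * (t - ln (even k)%:R / (2 * a) - Dconst beta r)).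
    split=> [etaY|Yeta].
      have m0 : 0 < m.
        rewrite ltNge; apply/negP => m_le0; move: (lt_le_trans eta0 etaY).
        by rewrite pmulr_lgt0// ltNge sgr_le0 m_le0.
      move: etaY; rewrite gtr0_sg// !mul1r /g mul1r => /max_idPl ->.
      by rewrite (tE _ erefl).
    have m0 : m < 0.
      rewrite ltNge; apply/negP => m_ge0; move: Yeta; apply/negP.
      rewrite -ltNge (@lt_le_trans _ _ 0)// ?oppr_lt0//.
      by rewrite pmulr_lge0// sgr_ge0.
    move: Yeta; rewrite ltr0_sg// !mulN1r lerN2 /g mulN1r opprK => /max_idPl ->.
    by rewrite (tE _ erefl).
  + move=> w; split=> [etaG|Geta].
      have G0 : 0 < G w by exact: lt_le_trans etaG.
      by rewrite /g mul1r (max_idPl etaG) gtr0_sg// gtr0_norm.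
    have G0 : G w < 0 by rewrite (le_lt_trans Geta)// oppr_lt0.
    have etaG : eta <= - G w by rewrite lerNr.
    by rewrite /g mulN1r (max_idPl etaG) ltr0_sg// ltr0_norm.
Qed.
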